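(* In the shared network, in the limit $\sigma^2\to0$, the SINR distributions of the typical active D2D link and of the typical cellular user are, for every $\beta>0$, respectively $$\mathbb{P}_D^{(S)}(\beta)=\frac{1}{2\delta^2\tilde\lambda_D\kappa\pi\beta^{2/\alpha}+4\delta^2\pi\rho^{(S)}\lambda_BH_0(\beta,\alpha)+1},$$ $$\mathbb{P}_C^{(S)}(\beta)=\frac{1}{\frac{\tilde\lambda_D}{\lambda_B}\kappa\left(\beta\frac{P_D}{P_B}\right)^{2/\alpha}+2\rho^{(S)}H_1(\beta,\alpha)+1},$$ where $\kappa=\frac{2\pi/\alpha}{\sin(2\pi/\alpha)}$, $H_0(\beta,\alpha)=\int_0^\infty\frac{x}{1+\beta^{-1}(P_D/P_B)x^\alpha}dx$, $H_1(\beta,\alpha)=\int_1^\infty\frac{x}{1+\beta^{-1}x^\alpha}dx$, $\mathbb{P}_D^{(S)}(\beta)=\mathbb{P}(\mathrm{SINR}_D>\beta)$ and $\mathbb{P}_C^{(S)}(\beta)=\mathbb{P}(\mathrm{SINR}_C>\beta)$.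
   Context: In the shared network D2D links and the downlink cellular network use the same resources. All fading variables are i.i.d. exponential with mean 1, independent of locations; $P_D,P_B>0$ are the transmit powers of D2D transmitters and base stations (BSs), $\sigma^2$ is the noise power, and $\alpha>2$ is the path loss exponent. There are $M$ types of potential D2D links with densities $\lambda_{D_i}$, time hopping probabilities $p_{t_i}\in[0,1]$ (probability of operating in D2D mode), frequency hopping probabilities $p_{f_i}\in[0,1]$; $\tilde\lambda_D=\sum_{i=1}^Mp_{t_i}p_{f_i}\lambda_{D_i}$. $\lambda_B$ and $\lambda_U$ are the BS and cellular user densities, $b_C,b_{D_i}$ the numbers of subbands demanded by a cellular user and a type-$i$ D2D link, $B$ the total number of subbands, and $\rho^{(S)}=\min\left\{\frac{b_C\lambda_U+\sum_{i=1}^Mb_{D_i}(1-p_{t_i})\lambda_{D_i}}{\lambda_BB},1\right\}$. D2D link: receiver at the origin, own transmitter at distance $v$ with density $\frac{v}{\delta^2}e^{-v^2/(2\delta^2)}$; interfering D2D transmitters $X_i$ form a Poisson point process (PPP) on $\mathbb{R}^2$ with density $\tilde\lambda_D$, and interfering BSs $B_i$ form a PPP on $\mathbb{R}^2$ with density $\rho^{(S)}\lambda_B$, all independent. $\mathrm{SINR}_D=\frac{P_Dh_0v^{-\alpha}}{\sum_iP_Dh_i|X_i|^{-\alpha}+\sum_iP_Bh_i'|B_i|^{-\alpha}+\sigma^2}$. Cellular user: at the origin, served by its nearest BS at distance $r$ with density $2\pi\lambda_Bre^{-\lambda_B\pi r^2}$; given $r$, interfering BSs $B_i$ form a PPP with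 density $\rho^{(S)}\lambda_B$ on $\{|z|>r\}$, and interfering D2D transmitters $X_i$ form an independent PPP on $\mathbb{R}^2$ with density $\tilde\lambda_D$. $\mathrm{SINR}_C=\frac{P_Bh_0r^{-\alpha}}{\sum_iP_Dh_i|X_i|^{-\alpha}+\sum_iP_Bh_i'|B_i|^{-\alpha}+\sigma^2}$. *)

(* Defs.v *)
From HB Require Import structures.
From mathcomp Require Import all_boot all_order all_algebra.
From mathcomp Require Import all_classical all_reals all_analysis.
Set Implicit Arguments.
Unset Strict Implicit.
Unset Printing Implicit Defensive.
Import Order.TTheory GRing.Theory Num.Theory numFieldNormedType.Exports.

Local Open Scope classical_set_scope.
Local Open Scope ring_scope.

Section probability_notions.
Context d (T : measurableType d) (R : realType) (P : probability T R).

Definition has_density (Y : {RV P >-> R}) (f : R -> R) :=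
  forall A : set R, measurable A ->
    distribution P Y A = (\int[lebesgue_measure]_(x in A) (f x)%:E)%E.

Definition mutually_independent (I : eqType) (F : I -> set (set T)) :=
  forall (J : seq I) (A : I -> set T), uniq J ->
    (forall i, i \in J -> F i (A i)) ->
    P (\bigcap_(i in [set` J]) A i) = (\prod_(i <- J) P (A i))%E.

Definition rv_events (Y : T -> R) : set (set T) :=
  preimage_set_system setT Y measurable.

End probability_notions.

Section point_processes.
Context d (T : measurableType d) (R : realType) (P : probability T R).

(* The norm `|z| of the library on R * R is the maximum norm. *)
Definition enorm (z : R * R) : R := Num.sqrt (z.1 ^+ 2 + z.2 ^+ 2).

Definition area : set (R * R) -> \bar R :=
  (@lebesgue_measure R \x @lebesgue_measure R)%E.

(* A point process is an enumeration of random points; X i t = None means that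
   the realization t has no i-th point, so that realizations with finitely many
   points are allowed. *)
Definition points := nat -> T -> option (R * R).

Definition point_events (X : points) : set (set T) :=
  [set E | exists i (A : set (R * R)),
     measurable A /\ E = X i @^-1` (Some @` A)].

Definition point_process (X : points) := point_events X `<=` measurable.

Definition num_points (X : points) (A : set (R * R)) (t : T) : \bar R :=
  (\esum_(i in [set: nat]) (if X i t is Some z then \1_A z else 0)%:E)%E.

(* The probability that a Poisson variable of mean m is k. The second argument
   of poisson_prob is a dummy one. We do not use poisson_pmf, which is
   constantly 1 when m = 0. *)
Definition poisson_mass (m : R) (k : nat) : \bar R :=
  poisson_prob m 0%N [set k].

(* Poisson point process of constant density lam on the region D, given by its
   finite-dimensional distributions: the numbers of points in disjoint sets of
   finite area are independent Poisson variables of means lam |A_j `&` D|. *)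
Definition poisson_process (X : points) (lam : R) (D : set (R * R)) :=
  point_process X /\
  forall (n : nat) (A : 'I_n -> set (R * R)) (k : 'I_n -> nat),
    (forall j, measurable (A j)) -> (forall j, area (A j) < +oo)%E ->
    trivIset setT A ->
    P (\bigcap_(j in [set: 'I_n]) [set t | num_points X (A j) t = (k j)%:R%:E]) =
    (\prod_(j < n) poisson_mass (lam * fine (area (A j `&` D))) (k j))%E.

(* Conditionally on Z, X is a Poisson point process of density lam on the
   region D Z: the identity above holds for the conditional probabilities given
   Z, i.e. after integration over every event {Z \in E}. *)
Definition poisson_process_given (Z : {RV P >-> R}) (X : points) (lam : R)
    (D : R -> set (R * R)) :=
  point_process X /\
  forall (E : set R) (n : nat) (A : 'I_n -> set (R * R)) (k : 'I_n -> nat),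
    measurable E ->
    (forall j, measurable (A j)) -> (forall j, area (A j) < +oo)%E ->
    trivIset setT A ->
    P (Z @^-1` E `&`
       \bigcap_(j in [set: 'I_n]) [set t | num_points X (A j) t = (k j)%:R%:E]) =
    (\int[P]_(t in Z @^-1` E) \prod_(j < n)
       poisson_mass (lam * fine (area (A j `&` D (Z t)))) (k j))%E.

End point_processes.
Arguments points {d} T R.

Section sinr.
Context d (T : measurableType d) (R : realType).

(* The fading variables are nonnegative almost surely, and the unordered sum of
   nonnegative terms is esum, possibly infinite. *)
Definition interference (Pw alpha : R) (h : nat -> T -> R) (X : points T R)
    (t : T) : \bar R :=
  (\esum_(i in [set: nat])
     (if X i t is Some z then Pw * h i t * enorm z `^ (- alpha) else 0)%:E)%E.

Definition sinr (Ps PD PB alpha sigma2 : R) (h0 dist : T -> R)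
    (hD : nat -> T -> R) (X : points T R) (hB : nat -> T -> R) (Y : points T R)
    (t : T) : \bar R :=
  ((Ps * h0 t * dist t `^ (- alpha))%R%:E /
   (interference PD alpha hD X t + interference PB alpha hB Y t + sigma2%:E))%E.

End sinr.

(* Below X enumerates the interfering D2D transmitters, with fadings hD, and Y
   the interfering base stations, with fadings hB. The hypotheses that the
   fadings are independent of each other and of all locations, and that the
   location variables are independent, are split into two levels: inside the
   family of fadings, and between the generated sigma-algebras. *)
Section models.
Context d (T : measurableType d) (R : realType) (P : probability T R).

Definition all_fadings (h0 : {RV P >-> R}) (hD hB : nat -> {RV P >-> R})
    (k : option (nat + nat)) : {RV P >-> R} :=
  match k with None => h0 | Some (inl i) => hD i | Some (inr i) => hB i end.

Definition fading_events h0 hD hB : set (set T) :=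
  \bigcup_k rv_events (all_fadings h0 hD hB k).

Definition iid_exp1_fading (h0 : {RV P >-> R}) (hD hB : nat -> {RV P >-> R}) :=
  (forall k, has_density (all_fadings h0 hD hB k) (exponential_pdf 1)) /\
  mutually_independent P (fun k => rv_events (all_fadings h0 hD hB k)).

Definition link_distance_pdf (delta : R) : R -> R :=
  (fun x => x / delta ^+ 2 * expR (- (x ^+ 2 / (2 * delta ^+ 2))))
    \_ `[0, +oo[.

Definition nearest_bs_pdf (lamB : R) : R -> R :=
  (fun x => 2 * pi * lamB * x * expR (- (lamB * pi * x ^+ 2))) \_ `[0, +oo[.

Definition d2d_link_model (delta lamX lamY : R) (v h0 : {RV P >-> R})
    (hD hB : nat -> {RV P >-> R}) (X Y : points T R) :=
  [/\ has_density v (link_distance_pdf delta),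
      poisson_process P X lamX setT,
      poisson_process P Y lamY setT,
      iid_exp1_fading h0 hD hB &
      mutually_independent P (tnth [tuple
        <<s rv_events v >>; <<s point_events X >>; <<s point_events Y >>;
        <<s fading_events h0 hD hB >>])].

(* Y depends on r, so that r and Y jointly generate one of the independent
   sigma-algebras. *)
Definition cellular_user_model (lamB lamX lamY : R) (r h0 : {RV P >-> R})
    (hD hB : nat -> {RV P >-> R}) (X Y : points T R) :=
  [/\ has_density r (nearest_bs_pdf lamB),
      poisson_process P X lamX setT,
      poisson_process_given r Y lamY (fun x => [set z | x < enorm z]),
      iid_exp1_fading h0 hD hB &
      mutually_independent P (tnth [tuple
        <<s rv_events r `|` point_events Y >>; <<s point_events X >>;
        <<s fading_events h0 hD hB >>])].

End models.

Section formulas.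
Context (R : realType).

Definition active_d2d_density (M : nat) (pt pf lamD : 'I_M -> R) : R :=
  \sum_(i < M) pt i * pf i * lamD i.

Definition bs_load (M : nat) (bC : nat) (bD : 'I_M -> nat) (B : nat)
    (lamU lamB : R) (pt lamD : 'I_M -> R) : R :=
  Num.min
    ((bC%:R * lamU + \sum_(i < M) (bD i)%:R * (1 - pt i) * lamD i)
       / (lamB * B%:R))
    1.

Definition kappa (alpha : R) : R := (2 * pi / alpha) / sin (2 * pi / alpha).

Definition H0 (PD PB beta alpha : R) : R :=
  \int[lebesgue_measure]_(x in `[0, +oo[)
    (x / (1 + beta^-1 * (PD / PB) * x `^ alpha)).

Definition H1 (beta alpha : R) : R :=
  \int[lebesgue_measure]_(x in `[1, +oo[) (x / (1 + beta^-1 * x `^ alpha)).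

End formulas.

(* Main.v *)
Require Import Defs.
From HB Require Import structures.
From mathcomp Require Import all_boot all_order all_algebra.
From mathcomp Require Import all_classical all_reals all_analysis measurable_realfun.
From mathcomp Require Import ring lra.
Set Implicit Arguments.
Unset Strict Implicit.
Unset Printing Implicit Defensive.
Import Order.TTheory GRing.Theory Num.Theory numFieldNormedType.Exports.

Local Open Scope classical_set_scope.
Local Open Scope ring_scope.

(* Since the fading of the serving link is exponential, SINR > beta means that
   it exceeds q (I + sigma^2), with q = (beta / Ps) z^alpha for a link of
   length z. Averaging over all fadings turns the conditional probability of
   this event into exp (- q sigma^2 - sum_i ln (1 + q Pw |X_i|^-alpha)), whose
   mean, by the Laplace functional of the Poisson processes, is
   exp (- lam int (1 - (1 + q Pw |x|^-alpha)^-1) dx) when sigma = 0. Polar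
   coordinates and the scaling |x| = z t give an exponent K z^2, and the
   density of z, which is of the form 2 A z exp (- A z^2), integrates
   exp (- K z^2) to A / (A + K). The constant kappa comes from the integral
   int_0^oo t / (1 + t^alpha) dt = (pi / alpha) / sin (2 pi / alpha), that is,
   from Euler's reflection formula; it is proved by showing that the error in
   that formula is Lipschitz and is contracted by triplication of the angle. *)

(** * Plane Lebesgue measure *)

(** Two features shape the proof. The Poisson processes are known only through the joint laws of
    their counts in finitely many disjoint cells, conditionally on the link length Z in the cellular
    case; and conditioning is expressed by sigma-algebras on a single probability space, without
    kernels. Independence is therefore turned into Tonelli's theorem through the diagonal map t ->
    (t, t), after which one coordinate can be frozen. The link length enters both the region of the
    interferers and the function that is summed over them. So the Laplace functional is proved on
    each event {Z in E} for a fixed function, and the dependence of the function on Z is recovered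
    by rounding q down to dyadic values, which are constant on such events. Interference and
    exponents may be infinite, so limits are taken for exp (- x) on [0, +oo], where everything is
    bounded by 1. In the reflection formula the poles would spoil the Lipschitz bound: they are
    isolated on both sides, and they cancel. *)

Section plane_measure.
Context (R : realType).
Local Notation leb := (@lebesgue_measure R).
Local Notation rT := (measurableTypeR R).

(* Same function as [area], with the structure of a sigma-finite measure. *)
Definition plane_measure : set (rT * rT) -> \bar R :=
  lebesgue_integral_fubini_product_measure1__canonical__measure_function_Measure leb leb.

HB.instance Definition _ := Measure.copy plane_measure
  (lebesgue_integral_fubini_product_measure1__canonical__measure_function_Measure leb leb).

(** Sigma-finiteness gives the measurability in z of areas of, and integrals over, the sections D z
    of a measurable family of regions. The squares of an exhaustion of the line exhaust the plane
    because the exhaustion is nondecreasing. *)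
Lemma plane_measure_sigma_finite : sigma_finite setT plane_measure.
Proof.
have /sigma_finiteP[F [TF ndF Foo]] := sigma_finiteT leb.
exists (fun n => F n `*` F n).
  rewrite -setXTT {1 2}TF predeqE => -[x y]; split.
    move=> [/= [n _ Fnx] [k _ Gky]]; exists (maxn n k) => //; split.
    - by move: x Fnx; exact/subsetPset/ndF/leq_maxl.
    - by move: y Gky; exact/subsetPset/ndF/leq_maxr.
  by move=> [n _ []/= ? ?]; split; exists n.
move=> k; have [? ?] := Foo k; split; first exact: measurableX.
by rewrite /plane_measure/= product_measure1E// lte_mul_pinfty// ge0_fin_numE.
Qed.

HB.instance Definition _ := Measure_isSigmaFinite.Build _ _ _ plane_measure
  plane_measure_sigma_finite.

Lemma areaE : @area R = plane_measure. Proof. by []. Qed.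

End plane_measure.

(** * Independence of generated sigma-algebras *)

Lemma bigcap_in_cons (I : eqType) (T : Type) (x : I) (s : seq I)
    (A : I -> set T) :
  \bigcap_(i in [set` x :: s]) A i = A x `&` \bigcap_(i in [set` s]) A i.
Proof.
apply/seteqP; split => [t H | t [Ax H] i /=].
  split; first by apply: H; rewrite /= mem_head.
  by move=> i si; apply: H; rewrite /= in_cons (si : i \in s) orbT.
by rewrite in_cons => /orP[/eqP -> // | si]; exact: H.
Qed.

Lemma bigcap_in_nil (I : eqType) (T : Type) (A : I -> set T) :
  \bigcap_(i in [set` [::]]) A i = setT.
Proof. by apply/seteqP; split => // t _ i. Qed.

Section independence.
Context d (T : measurableType d) (R : realType) (P : probability T R).
Local Open Scope ereal_scope.

(** Dynkin's argument: for fixed A, the events B that satisfy the product rule are stable under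
    proper differences and nondecreasing unions, so they contain the sigma-algebra generated by the
    pi-system C. *)
Lemma product_rule_sigma (A : set T) (c : \bar R) (C : set (set T)) :
    measurable A -> C `<=` measurable -> setI_closed C ->
    P A = c ->
    (forall B, C B -> P (A `&` B) = c * P B) ->
  forall B, <<s C >> B -> P (A `&` B) = c * P B.
Proof.
move=> mA Cm CI PA H.
have sCm : <<s C >> `<=` @measurable _ T.
  by apply: smallest_sub => //; exact: sigma_algebra_measurable.
have cfin : c \is a fin_num by rewrite -PA fin_num_measure.
suff : <<s C >> `<=` [set B | measurable B /\ P (A `&` B) = c * P B].
  by move=> K B /K[].
apply: lambda_system_subset => //; last first.
  by move=> B CB; split; [exact: Cm | exact: H].
split => //.
- by split => //; rewrite setIT probability_setT mule1.
- move=> X Y YX [mX PX] [mY PY]; split; first exact: measurableD.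
  rewrite setIDA measureD; last 3 first.
    exact: measurableI.
    by [].
    by rewrite -ge0_fin_numE// fin_num_measure//; exact: measurableI.
  have e1 : P (A `&` X `&` Y) = c * P Y by rewrite -PY -setIA (setIidr YX).
  rewrite [LHS](_ : _ = P (A `&` X) - P (A `&` X `&` Y))// e1 PX.
  have -> : P (X `\` Y) = P X - P (X `&` Y).
    by rewrite measureD// -ge0_fin_numE// fin_num_measure.
  by rewrite (setIidr YX) muleBr// fin_num_adde_defr// fin_num_measure.
- move=> F ndF mF; split; first by apply: bigcup_measurable => n _; exact: (mF n).1.
  rewrite setI_bigcupr.
  have mF1 n : measurable (F n) by exact: (mF n).1.
  have c1 : P (A `&` F n) @[n --> \oo] --> P (\bigcup_n (A `&` F n)).
    apply: nondecreasing_cvg_mu => //.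
    - by move=> n; exact: measurableI.
    - by apply: bigcup_measurable => n _; exact: measurableI.
    - by move=> m n mn; apply/subsetPset; apply: setIS; exact/subsetPset/ndF.
  have c2 : c * P (F n) @[n --> \oo] --> c * P (\bigcup_n F n).
    apply: cvgeZl => //; apply: nondecreasing_cvg_mu => //.
    by apply: bigcup_measurable.
  have e : (fun n => P (A `&` F n)) = (fun n => c * P (F n)).
    by apply/funext => n; exact: (mF n).2.
  by rewrite e in c1; exact: (cvg_unique _ c1 c2).
Qed.

Definition indep_systems (F G : set (set T)) :=
  forall A B, <<s F >> A -> <<s G >> B -> P (A `&` B) = P A * P B.

(** Independence says that the law of t -> (t, t), on T with sigma-algebra [<<s F >>] times T with
    [<<s G >>], is the product of its marginals, since both agree on rectangles. Tonelli then
    decouples the two coordinates; this replaces conditional expectation throughout. *)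
Lemma indep_integral (F G : set (set T))
    (phi : g_sigma_algebraType F * g_sigma_algebraType G -> \bar R) :
    F `<=` measurable -> G `<=` measurable -> indep_systems F G ->
    measurable_fun setT phi -> (forall z, 0 <= phi z) ->
  \int[P]_t phi (t, t) = \int[P]_t1 \int[P]_t2 phi (t1, t2).
Proof.
move=> Fm Gm FG mphi phi0.
have sm (H : set (set T)) : H `<=` measurable ->
    measurable_fun setT (idfun : T -> g_sigma_algebraType H).
  move=> Hm _ A mA; rewrite setTI.
  have sHm : <<s H >> `<=` @measurable _ T.
    by apply: smallest_sub => //; exact: sigma_algebra_measurable.
  exact: sHm.
pose PF := pushforward P (idfun : T -> g_sigma_algebraType F).
pose PG := pushforward P (idfun : T -> g_sigma_algebraType G).
have mF := sm _ Fm; have mG := sm _ Gm.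
have mdiag : measurable_fun setT
    (fun t : T => ((t, t) : g_sigma_algebraType F * g_sigma_algebraType G)).
  exact/measurable_fun_pair.
pose mFp : {mfun T >-> g_sigma_algebraType F} := HB.pack (idfun : T ->
  g_sigma_algebraType F) (isMeasurableFun.Build _ _ _ _ _ mF).
pose mGp : {mfun T >-> g_sigma_algebraType G} := HB.pack (idfun : T ->
  g_sigma_algebraType G) (isMeasurableFun.Build _ _ _ _ _ mG).
pose mDp : {mfun T >-> (g_sigma_algebraType F * g_sigma_algebraType G)%type} :=
  HB.pack (fun t : T => ((t, t) :
    g_sigma_algebraType F * g_sigma_algebraType G)) (isMeasurableFun.Build _ _ _ _ _ mdiag).
transitivity (\int[distribution P mDp]_z phi z).
  by rewrite ge0_integral_distribution.
transitivity (\int[(distribution P mFp) \x (distribution P mGp)]_z phi z).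
  apply: eq_measure_integral => A mA _; symmetry.
  by apply: product_measure_unique => // B C mB mC; exact: FG.
rewrite fubini_tonelli1//.
rewrite ge0_integral_distribution//; last 2 first.
- exact: measurable_fun_fubini_tonelli_F.
- by move=> y; exact: integral_ge0.
apply: eq_integral => t _ /=; rewrite /fubini_F.
rewrite ge0_integral_distribution//.
exact: measurableT_comp.
Qed.

(** The product rule is known for single events of F j and finite intersections of events of the
    other families. [product_rule_sigma] extends it first on the side of the union, then on the side
    of F j. *)
Lemma mutual_indep_bigcup (I : eqType) (F : I -> set (set T)) (j : I)
    (J : set I) :
    mutually_independent P F -> (forall i, F i `<=` measurable) ->
    (forall i, F i setT) -> (forall i, setI_closed (F i)) -> ~ J j ->
  indep_systems (F j) (\bigcup_(i in J) F i).
Proof.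
move=> PF Fm FT FI Jj.
(* Finite intersections with one event for each index: a pi-system that contains the union, and on
   which mutual independence applies directly. *)
pose C : set (set T) := [set B | exists (s : seq I) (A : I -> set T),
  [/\ uniq s, {in s, forall i, J i}, forall i, F i (A i) &
      B = \bigcap_(i in [set` s]) A i]].
have Cm : C `<=` measurable.
  move=> _ [s [A [_ _ FA ->]]];
  elim: s => [|i s IH]; first by rewrite bigcap_in_nil.
  by rewrite bigcap_in_cons; apply: measurableI => //; exact: (Fm i).
have CI : setI_closed C.
  move=> _ _ [s [A [us Js FA ->]]] [s' [A' [us' Js' FA' ->]]].
  (* Two intersections over different lists merge into one over the union of the lists, each being
     padded with the whole space. *)
  exists (undup (s ++ s')), (fun i => (if i \in s then A i else setT) `&`
    (if i \in s' then A' i else setT)); split.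
  - exact: undup_uniq.
  - by move=> i; rewrite mem_undup mem_cat => /orP[/Js|/Js'].
  - by move=> i; apply: FI; case: ifP.
  - apply/seteqP; split => [t [H H'] i /= |t H].
      rewrite mem_undup mem_cat => _; split.
        by case: ifPn => // si; exact: H.
      by case: ifPn => // si; exact: H'.
    split => i /= si.
      by have := H i; rewrite /= mem_undup mem_cat si => /(_ isT)[].
    by have := H i; rewrite /= mem_undup mem_cat si orbT => /(_ isT)[].
have sFm i : <<s F i >> `<=` @measurable _ T.
  by apply: smallest_sub => //; exact: sigma_algebra_measurable.
have step1 : forall A B, F j A -> C B -> P (A `&` B) = P A * P B.
  move=> A _ FA [s [A' [us Js FA' ->]]].
  have js : j \notin s by apply/negP => /Js.
  (* Mutual independence speaks of one indexed family, so A is inserted at the index j, which does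
     not occur in s. *)
  pose A'' i := if i == j then A else A' i.
  have e : \bigcap_(i in [set` s]) A' i = \bigcap_(i in [set` s]) A'' i.
    apply: eq_bigcapr => i /= si; rewrite /A''; case: eqP => // ij.
    by move: js; rewrite -ij si.
  have e2 : A `&` \bigcap_(i in [set` s]) A'' i = \bigcap_(i in [set` j :: s]) A'' i.
    by rewrite bigcap_in_cons {2}/A'' eqxx.
  have FA'' i : F i (A'' i) by rewrite /A''; case: eqP => // ->.
  rewrite e e2 PF//; last by rewrite /= js.
  by rewrite PF// big_cons {1}/A'' eqxx.
have step2 : forall A B, F j A -> <<s C >> B -> P (A `&` B) = P A * P B.
  move=> A B FA CB; apply: (product_rule_sigma _ Cm CI) => //; first exact: (Fm j).
  by move=> B' CB'; exact: step1.
move=> A B sA sB.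
have sCm : <<s C >> `<=` @measurable _ T.
  by apply: smallest_sub => //; exact: sigma_algebra_measurable.
have CB : <<s C >> B.
  move: sB; apply: smallest_sub; first exact: smallest_sigma_algebra.
  move=> E [i Ji FE]; apply: sub_gen_smallest.
  exists [:: i], (fun k => if k == i then E else setT); split => //.
  - by move=> k; rewrite inE => /eqP ->.
  - by move=> k; case: eqP => // ->.
  - by rewrite bigcap_in_cons bigcap_in_nil setIT eqxx.
rewrite setIC muleC; apply: (product_rule_sigma _ (Fm j) (FI j)) => //.
  exact: sCm.
by move=> A' FA'; rewrite setIC muleC; exact: step2.
Qed.

End independence.

(** * Dominated limits and densities *)

Section ereal_facts.
Context (R : realType).
Local Open Scope ereal_scope.

(** An unordered sum is a supremum over finite subsets, and dropping the negative terms of a finite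
    subset only increases its sum. This is why positive parts of the fadings appear below. *)
Lemma esum_positive_part (f : nat -> R) :
  \esum_(i in [set: nat]) (f i)%:E = \sum_(i <oo) (Num.max (f i) 0%R)%:E.
Proof.
rewrite nneseries_esumT; last by move=> n; rewrite lee_fin le_max lexx orbT.
apply/eqP; rewrite eq_le; apply/andP; split.
  apply: ge_ereal_sup => _ [A [fA _] <-]; apply: esum_ge; exists A => //.
  by apply: lee_fsum => // i _; rewrite lee_fin le_max lexx.
apply: ge_ereal_sup => _ [A [fA _] <-].
pose A' := A `&` [set i | (0 < f i)%R].
have fA' : finite_set A' by apply: finite_setIl.
apply: esum_ge; exists A' => //.
rewrite (fsbigID [set i | (0 < f i)%R])//= [X in _ + X]fsbig1 ?adde0.
  apply: lee_fsum => // i [_ /= fi]; rewrite lee_fin ge_max lexx ltW//.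
by move=> i [_ /= /negP]; rewrite -leNgt => fi; rewrite max_r.
Qed.

(** Continuity of exp (- x) on [0, +oo], the point +oo included, because sums over infinitely many
    points may diverge. *)
Lemma cvg_expeRN (u : nat -> \bar R) (l : \bar R) :
    (forall n, 0 <= u n) -> 0 <= l -> u @ \oo --> l ->
  expeR (- u n) @[n --> \oo] --> expeR (- l).
Proof.
move=> u0; case: l => [r| |//] l0 ul /=.
  have /fine_cvgP[ufin ur] := ul.
  apply/fine_cvgP; split.
    near=> n; have : u n \is a fin_num by near: n.
    by case: (u n).
  have : expR (- fine (u n)) @[n --> \oo] --> expR (- r).
    by apply: continuous_cvg; [exact: continuous_expR | exact: cvgN].
  apply: cvg_trans; apply: near_eq_cvg; near=> n.
  have : u n \is a fin_num by near: n.
  by rewrite /=; case: (u n).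
have e1 n : expeR (- u n) = (fine (expeR (- u n)))%:E.
  by have := u0 n; case: (u n) => //.
rewrite (_ : (fun n => _) = (fun n => (fine (expeR (- u n)))%:E)); last by apply/funext.
apply: cvg_EFin; first by near=> n.
apply/cvgrPdist_lt => e e0.
move/cvgeyPgt : ul => /(_ (- ln e)%R) ul.
near=> n; rewrite sub0r normrN ger0_norm; last first.
  by rewrite /= fine_ge0// expeR_ge0.
rewrite -lte_fin /= -e1.
have : (- ln e)%R%:E < u n by near: n.
case: (u n) => [x| |] //=; rewrite !lte_fin => ?.
by rewrite -[ltRHS](lnK (e0 : e \in Num.pos)) ltr_expR ltrNl.
Unshelve. all: by end_near. Qed.

Lemma expeRN_ge0_le1 (x : \bar R) : 0 <= x -> 0 <= expeR (- x) <= 1.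
Proof.
move=> x0; rewrite expeR_ge0/= -[leRHS]expeR0 lee_expeR.
by rewrite leeNl oppe0.
Qed.

Lemma measurable_expeR : measurable_fun [set: \bar R] (@expeR R).
Proof.
rewrite (_ : @expeR R = fun x => if x == +oo then +oo else if x == -oo then 0 else (expR
  (fine x))%:E); last first.
  by apply/funext => -[].
apply: measurable_fun_if => //.
- apply: (measurable_fun_bool true); rewrite setTI.
  rewrite (_ : _ @^-1` _ = [set +oo]); first exact: emeasurable_set1.
  by apply/seteqP; split => x /= /eqP.
- rewrite setTI; apply: measurable_funTS; apply: measurable_fun_if => //.
  + apply: (measurable_fun_bool true); rewrite setTI.
    rewrite (_ : _ @^-1` _ = [set -oo]); first exact: emeasurable_set1.
    by apply/seteqP; split => x /= /eqP.
  + apply: measurable_funTS; apply/measurable_EFinP.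
    by apply: measurableT_comp => //; exact: fine_measurable.
Qed.

End ereal_facts.

Section bounded_convergence.
Context d (T : measurableType d) (R : realType) (P : probability T R).
Local Open Scope ereal_scope.

Lemma bounded_cvg_integral (D : set T) (f_ : nat -> T -> \bar R) (f : T -> \bar R) :
    measurable D -> (forall n, measurable_fun setT (f_ n)) ->
    (forall n t, 0 <= f_ n t <= 1) ->
    (forall t, f_ n t @[n --> \oo] --> f t) ->
  \int[P]_(t in D) f_ n t @[n --> \oo] --> \int[P]_(t in D) f t.
Proof.
move=> mD mf f01 ff; apply: (@dominated_cvg _ _ _ _ _ _ _ _ (cst 1)) => //.
- by move=> n; apply: measurable_funTS.
- by apply: finite_measure_integrable_cst.
- by move=> n t _; have /andP[f0 f1] := f01 n t; rewrite gee0_abs.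
Qed.

End bounded_convergence.

Section density.
Context d (T : measurableType d) (R : realType) (P : probability T R).
Local Open Scope ereal_scope.

Import HBNNSimple.

(** The density is given on measurable sets only; simple functions and monotone convergence carry it
    over to nonnegative integrands. *)
Lemma has_density_integral (Z : {RV P >-> R}) (f : R -> R) (F : R -> \bar R) :
    has_density Z f -> measurable_fun setT f -> (forall x, (0 <= f x)%R) ->
    measurable_fun setT F -> (forall x, 0 <= F x) ->
  \int[P]_t F (Z t) = \int[lebesgue_measure]_x (F x * (f x)%:E).
Proof.
move=> Zf mf f0 mF F0.
rewrite -(@ge0_integral_distribution _ _ _ _ _ P Z F)//.
pose F_ := nnsfun_approx measurableT mF.
have cF x : (F_ n x)%:E @[n --> \oo] --> F x by exact: cvg_nnsfun_approx.
have mF_ n : measurable_fun setT (EFin \o F_ n).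
  exact/measurable_EFinP/measurable_funP.
have ndF x : {homo (fun n => (F_ n x)%:E) : m n / (m <= n)%N >-> m <= n}.
  by move=> m n mn; rewrite lee_fin; exact/lefP/nd_nnsfun_approx.
have c1 : \int[distribution P Z]_x (F_ n x)%:E @[n --> \oo] -->
    \int[distribution P Z]_x F x.
  rewrite [X in _ --> X](_ : _ = \int[distribution P Z]_x limn (fun n => (F_ n x)%:E)).
    by apply: cvg_monotone_convergence => // n x _; rewrite lee_fin.
  by apply: eq_integral => x _; apply/esym/cvg_lim => //; exact: cF.
have c2 : \int[lebesgue_measure]_x ((F_ n x)%:E * (f x)%:E) @[n --> \oo] -->
    \int[lebesgue_measure]_x (F x * (f x)%:E).
  rewrite [X in _ --> X](_ : _ =
      \int[lebesgue_measure]_x limn (fun n => (F_ n x)%:E * (f x)%:E)).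
    apply: cvg_monotone_convergence => //.
    - move=> n; apply: emeasurable_funM; first exact: mF_.
      by apply/measurable_EFinP; exact: mf.
    - by move=> n x _; rewrite -EFinM lee_fin mulr_ge0.
    - by move=> x _ m n mn; rewrite lee_wpmul2r ?lee_fin// -lee_fin; exact: ndF.
  apply: eq_integral => x _; apply/esym/cvg_lim => //.
  by apply: cvgeZr => //; exact: cF.
have mk n (k : R) : measurable (F_ n @^-1` [set k]) by [].
have e n : \int[distribution P Z]_x (F_ n x)%:E =
    \int[lebesgue_measure]_x ((F_ n x)%:E * (f x)%:E).
  transitivity (\sum_(k \in range (F_ n)) k%:E * distribution P Z (F_ n @^-1` [set k])).
    by rewrite integral_nnsfun//= patch_setT sintegralE.
  transitivity (\sum_(k \in range (F_ n))
      \int[lebesgue_measure]_x (k%:E * (\1_(F_ n @^-1` [set k]) x * f x)%:E)).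
    apply: eq_fsbigr => k; rewrite inE => -[y _ <-].
    rewrite ge0_integralZl//; last 3 first.
    - apply/measurable_EFinP; apply: measurable_funM; last exact: mf.
      by apply: measurable_indic; exact: mk.
    - by move=> x _; rewrite lee_fin mulr_ge0.
    - by rewrite lee_fin.
    congr (_ * _); rewrite Zf// [LHS]integral_mkcond; apply: eq_integral => x _.
    rewrite patchE indicE; case: ifPn => xA; first by rewrite ?xA /= mul1r.
    by rewrite ?(negbTE xA) /= mul0r.
  rewrite -ge0_integral_fsum//.
  - apply: eq_integral => x _; rewrite [in RHS]fimfunE -fsumEFin//.
    rewrite ge0_mule_fsuml; last first.
      by move=> y; rewrite nnfun_muleindic_ge0.
    by apply: eq_fsbigr => k _; rewrite -!EFinM mulrA.
  - move=> k; apply: measurable_funeM; apply/measurable_EFinP; apply: measurable_funM;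
    last exact: mf.
    by apply: measurable_indic; exact: mk.
  - move=> k x _.
    (* A value k that is not attained may be negative; its level set is then empty and its term is
       0. *)
    have [->|/set0P[y yk]] := eqVneq (F_ n @^-1` [set k]) set0.
      by rewrite indicE in_set0 mul0r mule0.
    by rewrite -EFinM lee_fin mulr_ge0 ?mulr_ge0// -yk.
rewrite (funext e) in c1.
exact: (cvg_unique _ c1 c2).
Qed.

End density.

(** * Averaging out the exponential fadings *)

Section exponential_fading.
Context d (T : measurableType d) (R : realType) (P : probability T R).
Local Open Scope ereal_scope.

(** The exponential density times exp (- c x) is (1 + c)^-1 times the exponential density of rate 1
    + c, which has mass 1. The truncation at 0 is invisible because the density vanishes on negative
    numbers. *)
Lemma exp1_laplace (H : {RV P >-> R}) (c : R) :
    has_density H (exponential_pdf 1) -> (0 <= c)%R ->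
  \int[P]_t (expR (- (c * Num.max (H t) 0)))%:E = ((1 + c)^-1)%:E.
Proof.
move=> Hd c0.
have mF : measurable_fun setT (fun x : R => (expR (- (c * Num.max x 0)))%:E).
  apply/measurable_EFinP; apply: continuous_measurable_fun => x.
  apply: continuous_comp; last exact: continuous_expR.
  apply: continuousN; apply: continuousM; first exact: cst_continuous.
  by apply: continuous_max => //; exact: cst_continuous.
rewrite (has_density_integral Hd (measurable_exponential_pdf _) _ mF); last 2 first.
- by move=> x; exact: exponential_pdf_ge0.
- by move=> x; rewrite lee_fin expR_ge0.
transitivity (\int[lebesgue_measure]_x (((1 + c)^-1)%:E * (exponential_pdf (1 + c) x)%:E)).
  apply: eq_integral => x _; rewrite -!EFinM; congr EFin.
  have [x0|x0] := leP 0%R x.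
    rewrite !exponential_pdfE// mul1r.
    rewrite mulrA mulVf ?mul1r ?gt_eqF ?ltr_wpDr//.
    rewrite -expRD; congr expR; ring.
  by rewrite !lt0_exponential_pdf// !mulr0.
have c1 : (0 < 1 + c)%R by rewrite ltr_wpDr.
rewrite ge0_integralZl//.
- by rewrite integral_exponential_pdf// mule1.
- by apply/measurable_EFinP; exact: measurable_exponential_pdf.
- by move=> x _; rewrite lee_fin exponential_pdf_ge0// ltW.
- by rewrite lee_fin invr_ge0 ltW.
Qed.

(** The level w will be an interference sum and may be +oo, where both sides are 0. *)
Lemma exp1_tail (H : {RV P >-> R}) (w : \bar R) :
    has_density H (exponential_pdf 1) -> 0 <= w ->
  P [set t | w < (H t)%:E] = expeR (- w).
Proof.
move=> Hd; case: w => [w| |//] /= w0; last first.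
  by rewrite (_ : [set _ | _] = set0) ?measure0//; apply/seteqP; split.
rewrite lee_fin in w0.
transitivity (distribution P H `]w, +oo[%classic).
  congr (P _); apply/seteqP; split => t /=; by rewrite in_itv/= andbT lte_fin.
rewrite Hd// integral_itv_obnd_cbnd; last first.
  apply: measurable_funTS; apply/measurable_EFinP; exact: measurable_exponential_pdf.
transitivity (\int[lebesgue_measure]_(x in `[w, +oo[) (expR (- x))%:E).
  apply: eq_integral => x; rewrite inE/= in_itv/= andbT => wx.
  by rewrite exponential_pdfE ?(le_trans w0)// mul1r mulN1r.
have dF y : is_derive y (1%R : R) (fun y : R => - expR (- y))%R (expR (- y))%R.
  have d1 := is_deriveN (is_derive_id y (1%R : R)).
  have d2 := @is_derive1_comp R (@expR R) (fun z => - z)%R y _ _ (is_derive_expR (- y)%R) d1.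
  have d3 := is_deriveN d2.
  refine (is_derive_eq d3 _).
  by rewrite mulrN1 opprK.
rewrite (@ge0_continuous_FTC2y _ _ (fun y => - expR (- y))%R w 0%R).
- by rewrite EFinN oppeK add0e.
- by move=> y _; exact: expR_ge0.
- apply: continuous_subspaceT => y; apply: continuous_comp; last exact: continuous_expR.
  exact: continuousN.
- by rewrite -oppr0; apply: cvgN; exact: cvgr_expR.
- by move=> y _; have [] := dF y.
- have [+ _] := dF w => /derivable1_diffP/differentiable_continuous; exact: cvg_at_right_filter.
- by move=> y _; rewrite derive1E; exact: derive_val.
Qed.

Lemma rv_events_measurable (Y : {RV P >-> R}) : rv_events Y `<=` measurable.
Proof. by move=> _ [B mB <-]; rewrite setTI; exact: measurable_funPTI. Qed.

Lemma rv_eventsT (Y : T -> R) : rv_events Y setT.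
Proof. by exists setT => //; rewrite setTI. Qed.

Lemma rv_eventsI (Y : T -> R) : setI_closed (rv_events Y).
Proof.
move=> _ _ [A mA <-] [B mB <-]; exists (A `&` B); first exact: measurableI.
by rewrite !setTI.
Qed.

Lemma measurable_fun_generated (G : set (set T)) (Y : T -> R) :
  rv_events Y `<=` <<s G >> ->
  measurable_fun setT (Y : g_sigma_algebraType G -> R).
Proof. by move=> YG _ B mB; rewrite setTI; apply: YG; exists B => //; rewrite setTI. Qed.

(** By induction on s: the head variable is independent of the union of the others, so
    [indep_integral] splits off its factor, which [exp1_laplace] evaluates. *)
Lemma indep_prod (I : eqType) (H : I -> {RV P >-> R}) (c : I -> R) (s : seq I) :
    (forall i, has_density (H i) (exponential_pdf 1)) ->
    mutually_independent P (fun i => rv_events (H i)) ->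
    (forall i, (0 <= c i)%R) -> uniq s ->
  \int[P]_t (\prod_(i <- s) expR (- (c i * Num.max (H i t) 0)))%:E =
  (\prod_(i <- s) (1 + c i)^-1)%:E.
Proof.
move=> Hd Hi c0; elim: s => [_|x s IH /= /andP[xs us]].
  under eq_integral do rewrite big_nil.
  by rewrite integral_cst//= probability_setT mule1 big_nil.
pose F := rv_events (H x); pose G := \bigcup_(i in [set` s]) rv_events (H i).
pose f i (t : T) : R := expR (- (c i * Num.max (H i t) 0))%R.
have mf (K : set (set T)) i : rv_events (H i) `<=` <<s K >> ->
    measurable_fun setT (f i : g_sigma_algebraType K -> R).
  move=> HK; apply: measurableT_comp => //; apply: measurableT_comp => //.
  apply: measurable_funM; first exact: measurable_cst.
  by apply: measurable_maxr => //; exact: measurable_fun_generated.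
have mp : measurable_fun setT
    ((fun t => (\prod_(i <- s) f i t)%R) : g_sigma_algebraType G -> R).
  rewrite (_ : (fun t => _) = (fun t => (\prod_(i <- s) (if i \in s then f i t else
    1))%R)); last first.
    by apply/funext => t; rewrite big_seq [RHS]big_seq; apply: eq_bigr => i ->.
  apply: measurable_prod => i si; rewrite si.
  by apply: mf => A HA; apply: sub_gen_smallest; exists i.
pose phi (z : g_sigma_algebraType F * g_sigma_algebraType G) : \bar R :=
  (f x z.1)%:E * (\prod_(i <- s) f i z.2)%:E.
have p0 t : (0 <= \prod_(i <- s) f i t)%R by apply: prodr_ge0 => i _; exact: expR_ge0.
transitivity (\int[P]_t phi (t, t)).
  by apply: eq_integral => t _; rewrite big_cons EFinM.
have ind : indep_systems P F G.
  apply: (@mutual_indep_bigcup _ _ _ P I (fun i => rv_events (H i)) x [set` s]) => //.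
  - by move=> i; exact: rv_events_measurable.
  - by move=> i; exact: rv_eventsT.
  - by move=> i; exact: rv_eventsI.
  - exact/negP.
rewrite (indep_integral _ _ ind); last 4 first.
- exact: rv_events_measurable.
- by move=> A [i _]; exact: rv_events_measurable.
- apply: emeasurable_funM; apply/measurable_EFinP.
    apply: measurableT_comp; last exact: measurable_fst.
    by apply: mf => A HA; exact: sub_gen_smallest.
  exact: (measurableT_comp mp measurable_snd).
- by move=> z; rewrite /phi -EFinM lee_fin mulr_ge0 ?expR_ge0.
have mf0 i : measurable_fun setT (f i).
  apply: measurableT_comp => //; apply: measurableT_comp => //.
  by apply: measurable_funM => //; apply: measurable_maxr.
have mp0 : measurable_fun setT (fun t => (\prod_(i <- s) f i t)%R).
  by apply: measurable_prod => i _; exact: mf0.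
rewrite /phi/=.
transitivity (\int[P]_t1 ((f x t1)%:E * (\prod_(i <- s) (1 + c i)^-1)%:E)).
  apply: eq_integral => t1 _; rewrite -IH//.
  apply: ge0_integralZl; [exact: measurableT|exact/measurable_EFinP| |].
    by move=> t _; rewrite lee_fin.
  by rewrite lee_fin expR_ge0.
rewrite ge0_integralZr//; last 3 first.
- exact/measurable_EFinP.
- by move=> t _; rewrite lee_fin expR_ge0.
- by rewrite lee_fin prodr_ge0// => i _; rewrite invr_ge0 addr_ge0.
by rewrite exp1_laplace// big_cons EFinM.
Qed.

Lemma measurable_nneseries (d' : measure_display) (S : measurableType d')
    (f : nat -> S -> R) :
    (forall i, measurable_fun setT (f i)) -> (forall i t, (0 <= f i t)%R) ->
  measurable_fun setT (fun t => \sum_(i <oo) (f i t)%:E).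
Proof.
move=> mf f0; apply: ge0_emeasurable_sum => //.
- by move=> k t _; rewrite lee_fin.
- by move=> k _; apply/measurable_EFinP.
Qed.

Lemma nneseries_EFin_ge0 (a : nat -> R) : (forall i, (0 <= a i)%R) ->
  0 <= \sum_(i <oo) (a i)%:E.
Proof. by move=> a0; apply: nneseries_ge0 => n _ _; rewrite lee_fin. Qed.

Lemma cvg_nneseries_EFin (a : nat -> R) : (forall i, (0 <= a i)%R) ->
  (\sum_(i < n) a i)%R%:E @[n --> \oo] --> \sum_(i <oo) (a i)%:E.
Proof.
move=> a0.
rewrite (_ : (fun n => _) = (fun n => \sum_(0 <= i < n) (a i)%:E)); last first.
  by apply/funext => n; rewrite big_mkord sumEFin.
by apply: is_cvg_nneseries => n _ _; rewrite lee_fin.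
Qed.

Lemma prob_bool (b : T -> bool) : measurable [set t | b t] ->
  P [set t | b t] = \int[P]_t ((b t)%:R : R)%:E.
Proof.
move=> mb; rewrite -[in LHS](setIT [set t | b t]) -integral_indic//.
apply: eq_integral => t _; rewrite indicE; congr (_%:R%:E).
by case: (boolP (b t)) => bt; [rewrite mem_set | rewrite memNset//; exact/negP].
Qed.

Lemma measurable_lt_ereal (f g : T -> \bar R) :
  measurable_fun setT f -> measurable_fun setT g -> measurable [set t | f t < g t].
Proof.
move=> mf mg; have := measurable_fun_lte mf mg measurableT.
by move=> /(_ [set true]); rewrite setTI; apply.
Qed.

(** The serving fading is independent of the weighted sum W, so its exponential tail gives the mean
    of exp (- W). Truncated to finitely many fadings, this mean is a product of factors (1 + c)^-1 =
    exp (- ln (1 + c)), and bounded convergence removes the truncation. The weights are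
    deterministic here: this is the situation once all locations are frozen. *)
Lemma fading_tail (h0 : {RV P >-> R}) (hD hB : nat -> {RV P >-> R})
    (a b : nat -> R) (w : R) :
    iid_exp1_fading h0 hD hB -> (0 <= w)%R ->
    (forall i, (0 <= a i)%R) -> (forall i, (0 <= b i)%R) ->
  P [set t | w%:E + \sum_(i <oo) (a i * Num.max (hD i t) 0)%:E
                  + \sum_(i <oo) (b i * Num.max (hB i t) 0)%:E < (h0 t)%:E] =
  expeR (- (w%:E + \sum_(i <oo) (ln (1 + a i))%:E + \sum_(i <oo) (ln (1 + b i))%:E)).
Proof.
move=> [Hd Hi] w0 a0 b0.
pose I := option (nat + nat).
pose H : I -> {RV P >-> R} := all_fadings h0 hD hB.
(* [None] is the index of the serving fading, so F carries the interfering fadings only. *)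
pose F := \bigcup_(i in [set~ None]) rv_events (H i); pose G := rv_events (H None).
pose W (t : T) : \bar R := w%:E + \sum_(i <oo) (a i * Num.max (hD i t) 0)%:E
                  + \sum_(i <oo) (b i * Num.max (hB i t) 0)%:E.
have p0 (c x : R) : (0 <= c -> 0 <= c * Num.max x 0)%R.
  by move=> c0; rewrite mulr_ge0// le_max lexx orbT.
have W0 t : 0 <= W t.
  by rewrite adde_ge0 ?adde_ge0 ?nneseries_EFin_ge0// => i; exact: p0.
have ind : indep_systems P F G.
  have ind' : indep_systems P G F.
    apply: (@mutual_indep_bigcup _ _ _ P I (fun i => rv_events (H i)) None) => //.
    - by move=> i; exact: rv_events_measurable.
    - by move=> i; exact: rv_eventsT.
    - by move=> i; exact: rv_eventsI.
    - by apply.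
  by move=> A B FA GB; rewrite setIC ind'// muleC.
have mW : measurable_fun setT (W : g_sigma_algebraType F -> \bar R).
  have mh i c : i != None -> measurable_fun setT
      ((fun t => (c * Num.max (H i t) 0)%R) : g_sigma_algebraType F -> R).
    move=> iN; apply: measurable_funM; first exact: measurable_cst.
    apply: measurable_maxr => //; apply: measurable_fun_generated.
    by move=> A HA; apply: sub_gen_smallest; exists i => //; apply/eqP.
  apply: emeasurable_funD; first apply: emeasurable_funD; first exact: measurable_cst.
  - apply: measurable_nneseries => [i|i t]; last exact: p0.
    exact: (mh (Some (inl i))).
  - apply: measurable_nneseries => [i|i t]; last exact: p0.
    exact: (mh (Some (inr i))).
have mWT : measurable_fun setT W.
  apply: emeasurable_funD; first apply: emeasurable_funD; first exact: measurable_cst.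
  - apply: measurable_nneseries => [i|i t]; last exact: p0.
    by apply: measurable_funM => //; exact: measurable_maxr.
  - apply: measurable_nneseries => [i|i t]; last exact: p0.
    by apply: measurable_funM => //; exact: measurable_maxr.
pose phi (z : g_sigma_algebraType F * g_sigma_algebraType G) : \bar R :=
  ((W z.1 < (h0 z.2)%:E)%E%:R : R)%:E.
have mlt : measurable [set t | W t < (h0 t)%:E].
  apply: measurable_lt_ereal => //; exact/measurable_EFinP.
transitivity (\int[P]_t phi (t, t)).
  by rewrite prob_bool.
rewrite (indep_integral _ _ ind); last 4 first.
- by move=> A [i _]; exact: rv_events_measurable.
- exact: rv_events_measurable.
- apply/measurable_EFinP; apply: measurableT_comp => //.
  apply: measurable_fun_lte.
    by apply: measurableT_comp; [exact: mW | exact: measurable_fst].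
  apply/measurable_EFinP; apply: measurableT_comp; last exact: measurable_snd.
  by apply: measurable_fun_generated => A HA; exact: sub_gen_smallest.
- by move=> z; rewrite lee_fin.
transitivity (\int[P]_t expeR (- W t)).
  apply: eq_integral => t1 _; rewrite -(exp1_tail (Hd None))//=.
  rewrite prob_bool//; apply: measurable_lt_ereal; first exact: measurable_cst.
  exact/measurable_EFinP.
pose u n : T -> R := fun t => (w + \sum_(i < n) a i * Num.max (hD i t) 0
   + \sum_(i < n) b i * Num.max (hB i t) 0)%R.
pose v n : R := (w + \sum_(i < n) ln (1 + a i) + \sum_(i < n) ln (1 + b i))%R.
have u0 n t : (0 <= u n t)%R.
  by rewrite !addr_ge0// sumr_ge0// => i _; exact: p0.
have c1 : \int[P]_t expeR (- (u n t)%:E) @[n --> \oo] --> \int[P]_t expeR (- W t).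
  apply: bounded_cvg_integral => //.
  - move=> n; apply/measurable_EFinP; apply: measurableT_comp => //.
    apply: measurableT_comp => //.
    by apply: measurable_funD; first apply: measurable_funD => //;
      apply: measurable_sum => i; apply: measurable_funM => //; exact: measurable_maxr.
  - by move=> n t; apply: expeRN_ge0_le1; rewrite lee_fin.
  - move=> t; apply: cvg_expeRN => //; first by move=> n; rewrite lee_fin.
    suff : w%:E + (\sum_(i < n) a i * Num.max (hD i t) 0)%R%:E
      + (\sum_(i < n) b i * Num.max (hB i t) 0)%R%:E @[n --> \oo] --> W t by [].
    apply: cvgeD; [|apply: cvgeD|].
    + by rewrite ge0_adde_def// inE ?adde_ge0// ?nneseries_EFin_ge0// => i; exact: p0.
    + by rewrite fin_num_adde_defr.
    + exact: cvg_cst.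
    + by apply: cvg_nneseries_EFin => i; exact: p0.
    + by apply: cvg_nneseries_EFin => i; exact: p0.
have l0 (x : R) : (0 <= x -> 0 <= ln (1 + x))%R by move=> x0; rewrite ln_ge0// lerDl.
have v0 n : (0 <= v n)%R.
  by rewrite !addr_ge0// sumr_ge0// => i _; exact: l0.
have c2 : expeR (- (v n)%:E) @[n --> \oo] -->
  expeR (- (w%:E + \sum_(i <oo) (ln (1 + a i))%:E + \sum_(i <oo) (ln (1 + b i))%:E)).
  apply: cvg_expeRN => //.
    by rewrite adde_ge0 ?adde_ge0 ?nneseries_EFin_ge0// => i; exact: l0.
  suff : w%:E + (\sum_(i < n) ln (1 + a i))%R%:E
      + (\sum_(i < n) ln (1 + b i))%R%:E @[n --> \oo] -->
      w%:E + \sum_(i <oo) (ln (1 + a i))%:E + \sum_(i <oo) (ln (1 + b i))%:E by [].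
  apply: cvgeD; [|apply: cvgeD|].
  + by rewrite ge0_adde_def// inE ?adde_ge0// ?nneseries_EFin_ge0// => i; exact: l0.
  + by rewrite fin_num_adde_defr.
  + exact: cvg_cst.
  + by apply: cvg_nneseries_EFin => i; exact: l0.
  + by apply: cvg_nneseries_EFin => i; exact: l0.
have e n : \int[P]_t expeR (- (u n t)%:E) = expeR (- (v n)%:E).
  (* The first n fadings of each kind in one list, so that [indep_prod] treats both kinds at
     once. *)
  pose s : seq I := [seq Some (inl i) | i <- iota 0 n] ++ [seq Some (inr i) | i <- iota 0 n].
  pose c (i : I) : R := match i with None => 0%R | Some (inl i) => a i | Some (inr i) =>
    b i end.
  have us : uniq s.
    rewrite cat_uniq !map_inj_uniq ?iota_uniq ?andbT/=; last 2 first.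
    - by move=> ? ? [].
    - by move=> ? ? [].
    by apply/hasPn => _ /mapP[i _ ->]; apply/mapP => -[j _].
  have cs (g : I -> R) : (\sum_(i <- s) g i =
      \sum_(i < n) g (Some (inl (val i))) + \sum_(i < n) g (Some (inr (val i))))%R.
    rewrite big_cat/= !big_map (_ : iota 0 n = index_iota 0 n) ?/index_iota ?subn0//.
    by rewrite -[iota 0 n]/(iota 0 n) -{1 2}(subn0 n) -/(index_iota 0 n) !big_mkord.
  have c0 i : (0 <= c i)%R by case: i => [[]|].
  transitivity (\int[P]_t ((expR (- w))%:E *
      (\prod_(i <- s) expR (- (c i * Num.max (H i t) 0)))%:E)).
    apply: eq_integral => t _; rewrite -EFinM -expR_sum -expRD /=; congr (expR _)%:E.
    by rewrite sumrN cs /u !opprD addrA.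
  transitivity ((expR (- w))%:E * \int[P]_t
      (\prod_(i <- s) expR (- (c i * Num.max (H i t) 0)))%:E).
    apply: ge0_integralZl; [exact: measurableT| | |].
    - apply/measurable_EFinP; apply: measurable_prod => i _.
      apply: measurableT_comp => //; apply: measurableT_comp => //.
      by apply: measurable_funM => //; exact: measurable_maxr.
    - by move=> t _; rewrite lee_fin prodr_ge0// => i _; exact: expR_ge0.
    - by rewrite lee_fin expR_ge0.
  rewrite indep_prod// -EFinM /=; congr EFin.
  rewrite (_ : (\prod_(i <- s) (1 + c i)^-1 = \prod_(i <- s) expR (- ln (1 + c i)))%R);
    last first.
    by apply: eq_bigr => i _; rewrite expRN lnK// posrE ltr_wpDr.
  by rewrite -expR_sum -expRD sumrN cs /v !opprD addrA.
rewrite (funext e) in c1.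
exact: (cvg_unique _ c1 c2).
Qed.

End exponential_fading.

(** * Laplace functional of a Poisson point process *)

Section poisson_generating_function.
Context (R : realType).

Definition poisson_weight (m : R) (k : nat) : R := m ^+ k / k`!%:R * expR (- m).

Lemma poisson_weight_ge0 m k : 0 <= m -> 0 <= poisson_weight m k.
Proof. by move=> m0; rewrite mulr_ge0 ?expR_ge0// divr_ge0// exprn_ge0. Qed.

(** At m = 0 the mass is the Dirac mass at 0, and the formula agrees with it because 0 ^ 0 = 1. *)
Lemma poisson_massE m k : 0 <= m -> poisson_mass m k = (poisson_weight m k)%:E.
Proof.
rewrite le_eqVlt => /orP[/eqP <-|m0]; rewrite /poisson_mass /poisson_prob /poisson_weight.
  rewrite ltxx diracE oppr0 expR0 mulr1; congr EFin.
  case: k => [|k]; first by rewrite mem_set//= expr0 fact0 divr1.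
  by rewrite memNset//= expr0n/= mul0r.
by rewrite m0 esum_set1 /poisson_pmf m0// lee_fin !mulr_ge0 ?expR_ge0// ?exprn_ge0// ltW.
Qed.

(** Once exp (- m) is factored out, the sum is the exponential series at m exp (- y). *)
Lemma poisson_generating_function (m y : R) : 0 <= m ->
  (\sum_(k <oo) (expR (- (y * k%:R)) * poisson_weight m k)%:E =
   (expR (- (m * (1 - expR (- y)))))%:E)%E.
Proof.
move=> m0.
have p0 k : 0 <= expR (- (y * k%:R)) * poisson_weight m k.
  by rewrite mulr_ge0 ?expR_ge0// poisson_weight_ge0.
have c1 := cvg_nneseries_EFin p0.
apply: (cvg_unique _ c1) => //.
apply: cvg_EFin; first by apply: nearW.
have e n : \sum_(i < n) expR (- (y * i%:R)) * poisson_weight m i =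
    expR (- m) * series (exp_coeff (m * expR (- y))) n.
  rewrite /series/= big_mkord mulr_sumr; apply: eq_bigr => i _.
  rewrite /poisson_weight /exp_coeff/= exprMn -expRM_natr mulNr; ring.
rewrite (_ : expR _ = expR (- m) * expR (m * expR (- y))); last first.
  by rewrite -expRD; congr expR; ring.
rewrite (_ : _ \o _ = (fun n => expR (- m) * series (exp_coeff (m * expR (- y))) n)).
  by apply: cvgMr; exact: is_cvg_series_exp_coeff.
by apply/funext => n /=; exact: e.
Qed.

End poisson_generating_function.

Section marks.
Context (R : realType).
Local Open Scope ereal_scope.

Definition omark (g : R * R -> R) (o : option (R * R)) : R :=
  if o is Some z then g z else 0%R.

Lemma omark_ge0 g o : (forall z, (0 <= g z)%R) -> (0 <= omark g o)%R.
Proof. by move=> g0; case: o. Qed.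

(** The events at hand say that a point exists and lies in A. A missing point has mark 0, so the
    complement of the event that the point exists has to be added exactly when B contains 0. *)
Lemma measurable_omark d (S : measurableType d) (Y : S -> option (R * R)) (g : R * R -> R) :
    (forall A, measurable A -> measurable (Y @^-1` (Some @` A))) ->
    measurable_fun setT g ->
  measurable_fun setT (fun s => omark g (Y s)).
Proof.
move=> mY mg _ B mB; rewrite setTI.
have mgB : measurable (g @^-1` B) by rewrite -[X in measurable X]setTI; exact: mg.
have [B0|B0] := pselect (B 0%R).
  rewrite (_ : _ @^-1` _ = Y @^-1` (Some @` (g @^-1` B)) `|` ~` (Y @^-1` (Some @` setT))).
    by apply: measurableU; [exact: mY | apply: measurableC; exact: mY].
  apply/seteqP; split => s /=; rewrite /omark.
    case: (Y s) => [z|] Bz; [left; by exists z|right].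
    by move=> [z _].
  by case=> [[z Bz <-]//|]; case: (Y s) => [z|//] H; exfalso; apply: H; exists z.
rewrite (_ : _ @^-1` _ = Y @^-1` (Some @` (g @^-1` B))); first exact: mY.
apply/seteqP; split => s /=; rewrite /omark.
  by case: (Y s) => [z|] Bz; [exists z|].
by case=> z Bz <-.
Qed.

(** Monotone convergence for the counting measure; the limit series may be infinite. *)
Lemma cvg_monotone_nneseries (a : nat -> nat -> R) (b : nat -> R) :
    (forall n i, (0 <= a n i)%R) ->
    (forall i, {homo a^~ i : m n / (m <= n)%N >-> (m <= n)%R}) ->
    (forall i, a n i @[n --> \oo] --> b i) ->
  \sum_(i <oo) (a n i)%:E @[n --> \oo] --> \sum_(i <oo) (b i)%:E.
Proof.
move=> a0 nda ab.
have b0 i : (0 <= b i)%R.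
  rewrite -(cvg_lim (@Rhausdorff R) (ab i)); apply: limr_ge.
    by apply: cvgP; exact: (ab i).
  exact: nearW.
have p0 n : forall k, 0 <= (a n k)%:E by move=> k; rewrite lee_fin.
have q0 k : 0 <= (b k)%:E by rewrite lee_fin.
rewrite -(ge0_integral_count q0).
rewrite (_ : (fun n => _) = (fun n => \int[counting]_k (a n k)%:E)); last first.
  by apply/funext => n; rewrite -(ge0_integral_count (p0 n)).
rewrite [X in _ --> X](_ : _ = \int[counting]_k limn (fun n => (a n k)%:E)).
  apply: cvg_monotone_convergence => //.
  by move=> k _ m n mn; rewrite lee_fin; exact: nda.
apply: eq_integral => k _; apply/esym/cvg_lim => //.
by apply: cvg_EFin; [exact: nearW | exact: ab].
Qed.

End marks.

Section laplace.
Context d (T : measurableType d) (R : realType) (P : probability T R).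
Local Open Scope ereal_scope.
Local Notation vol := (@plane_measure R).

Lemma num_points_indic (X : points T R) (A : set (R * R)) t :
  num_points X A t = \sum_(i <oo) (omark \1_A (X i t))%:E.
Proof.
rewrite nneseries_esumT; last by move=> i; rewrite lee_fin omark_ge0.
by apply: eq_esum => i _; congr EFin; rewrite /omark; case: (X i t).
Qed.

(** The sum is the counting measure of the set of indices whose point lies in A. *)
Lemma num_points_nat (X : points T R) (A : set (R * R)) t :
  num_points X A t = +oo \/ exists k : nat, num_points X A t = k%:R%:E.
Proof.
pose S := [set i | exists2 z, X i t = Some z & A z].
have e : num_points X A t = counting S.
  rewrite num_points_indic -(setIT S) -integral_indic//.
  rewrite -ge0_integral_count; last by move=> k; rewrite lee_fin omark_ge0.
  apply: eq_integral => i _; congr EFin; rewrite /omark.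
  case Xi : (X i t) => [z|]; rewrite !indicE.
    congr ((nat_of_bool _)%:R); apply/idP/idP; rewrite !inE => h; first by exists z.
    by case: h => z' ; rewrite Xi => -[->].
  by rewrite memNset// => -[z]; rewrite Xi.
rewrite e /counting; case: ifPn => _; [right|by left].
by eexists.
Qed.

Lemma measurable_num_points (X : points T R) (A : set (R * R)) :
  point_process X -> measurable A -> measurable_fun setT (num_points X A).
Proof.
move=> pX mA.
rewrite (_ : num_points X A = fun t => \sum_(i <oo) (omark \1_A (X i t))%:E); last first.
  by apply/funext => t; exact: num_points_indic.
apply: measurable_nneseries => [i|i t]; last exact: omark_ge0.
apply: measurable_omark => //.
by move=> B mB; apply: pX; exists i, B.
Qed.

(* [expN y x] is [exp (- y x)], which vanishes when [y > 0] and [x = +oo]. *)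
Let expN (y : R) (x : \bar R) : R := fine (expeR (- (y%:E * x))).

Let expN_ge0 y x : (0 <= expN y x)%R.
Proof. by rewrite fine_ge0// expeR_ge0. Qed.

Let measurable_expN y (f : T -> \bar R) :
  measurable_fun setT f -> measurable_fun setT (fun t => expN y (f t)).
Proof.
move=> mf; apply: (measurableT_comp (fine_measurable measurableT)) => //.
apply: measurableT_comp; first exact: measurable_expeR.
by apply: measurableT_comp => //; exact: measurable_funeM.
Qed.

(** Splits according to the value v of a count x, with r standing for the remaining factors. An
    infinite count meets no v, and the left side is then 0 because y is positive. *)
Let expN_series y (x : \bar R) (r : R) : (0 < y)%R -> (0 <= r)%R ->
    (x = +oo \/ exists k : nat, x = k%:R%:E) ->
  (expN y x * r)%:E =
  \sum_(v <oo) (expR (- (y * v%:R)) * ((x == v%:R%:E)%:R * r))%:E.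
Proof.
move=> y0 r0 [->|[k ->]].
  rewrite /expN gt0_muley ?lte_fin//= mul0r eseries0// => i _ _.
  by rewrite ?mul0r mulr0.
rewrite (@nneseriesD1 _ _ k xpredT)//; last first.
  by move=> i _; rewrite lee_fin !mulr_ge0 ?expR_ge0.
rewrite eqxx mul1r eseries0 ?adde0 /expN ?mulrNN//=.
move=> i _ ik; rewrite eqe eqr_nat eq_sym (negbTE ik) mul0r mulr0//.
Qed.

Section finite_partition.
Context (Z : {RV P >-> R}) (X : points T R) (lam : R) (D : R -> set (R * R)).
Hypothesis lam0 : (0 <= lam)%R.
Hypothesis mD : measurable [set zx : R * (R * R) | D zx.1 zx.2].
Hypothesis ppX : poisson_process_given Z X lam D.
Context (E : set R) (n : nat) (A : 'I_n -> set (R * R)) (y : 'I_n -> R).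
Hypothesis mE : measurable E.
Hypothesis mA : forall j, measurable (A j).
Hypothesis finA : forall j, area (A j) < +oo.
Hypothesis trivA : trivIset setT A.
Hypothesis y0 : forall j, (0 < y j)%R.

Lemma measurable_section (z : R) : measurable (D z).
Proof.
rewrite (_ : D z = (pair z) @^-1` [set zx : R * (R * R) | D zx.1 zx.2])//.
rewrite -[X in measurable X]setTI; exact: pair1_measurable.
Qed.

Let m (j : 'I_n) (z : R) : R := (lam * fine (area (A j `&` D z)))%R.

Let m0 j z : (0 <= m j z)%R. Proof. by rewrite mulr_ge0// fine_ge0// measure_ge0. Qed.

Let measurable_m j : measurable_fun setT (m j).
Proof.
apply: measurable_funM; first exact: measurable_cst.
apply: (measurableT_comp (fine_measurable measurableT)) => //.
pose B : set (R * (R * R)) := [set zx | D zx.1 zx.2] `&` (setT `*` A j).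
have mB : measurable B by apply: measurableI => //; apply: measurableX.
have := @measurable_fun_xsection _ _ R _ _ vol B mB.
congr (measurable_fun _ _); apply/funext => z /=; congr (vol _).
apply/seteqP; split => x; rewrite /xsection/= inE /B/=; tauto.
Qed.

(** Interpolates between the defining identity of the process (l = 0, every factor tests a
    prescribed count) and the Laplace transform (l = n, every factor is an exponential), one cell at
    a time. [Psi] below holds the matching conditional means. *)
Let psi (l : nat) (k : 'I_n -> nat) (t : T) (j : 'I_n) : R :=
  if (j < l)%N then expN (y j) (num_points X (A j) t)
  else (num_points X (A j) t == (k j)%:R%:E)%:R.

Let Psi (l : nat) (k : 'I_n -> nat) (z : R) (j : 'I_n) : R :=
  if (j < l)%N then expR (- (m j z * (1 - expR (- y j))))
  else poisson_weight (m j z) (k j).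

Let psi_ge0 l k t j : (0 <= psi l k t j)%R.
Proof. by rewrite /psi; case: ifP => _. Qed.

Let Psi_ge0 l k z j : (0 <= Psi l k z j)%R.
Proof. by rewrite /Psi; case: ifP => _; rewrite ?expR_ge0 ?poisson_weight_ge0. Qed.

Let pX : point_process X. Proof. by case: ppX. Qed.

Let measurable_eq_num j (k : nat) :
  measurable [set t | num_points X (A j) t = k%:R%:E].
Proof.
have := measurable_num_points pX (mA j) measurableT (emeasurable_set1 k%:R%:E).
by rewrite setTI.
Qed.

Let measurable_psi l k j : measurable_fun setT (fun t => psi l k t j).
Proof.
rewrite /psi; case: (ltnP j l) => _; first by apply: measurable_expN; exact:
  measurable_num_points.
rewrite (_ : (fun t => _) = \1_[set t | num_points X (A j) t = (k j)%:R%:E]).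
  by apply: measurable_indic; exact: measurable_eq_num.
apply/funext => t; rewrite indicE; case: eqP => h; first by rewrite mem_set.
by rewrite memNset.
Qed.

Let measurable_Psi l k j : measurable_fun setT (fun z => Psi l k z j).
Proof.
rewrite /Psi; case: (ltnP j l) => _.
  apply: measurableT_comp => //; apply: measurableT_comp => //.
  by apply: measurable_funM; [exact: measurable_m | exact: measurable_cst].
apply: measurable_funM.
  by apply: measurable_funM; [apply: measurable_funX; exact: measurable_m | exact:
    measurable_cst].
apply: measurableT_comp => //; apply: measurableT_comp => //; exact: measurable_m.
Qed.

Let mZE : measurable (Z @^-1` E). Proof. exact: measurable_funPTI. Qed.

Let level0 k : \int[P]_(t in Z @^-1` E) (\prod_j psi 0 k t j)%R%:E =
  \int[P]_(t in Z @^-1` E) (\prod_j Psi 0 k (Z t) j)%R%:E.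
Proof.
transitivity (\int[P]_(t in Z @^-1` E) \prod_(j < n)
       poisson_mass (lam * fine (area (A j `&` D (Z t)))) (k j)); last first.
  apply: eq_integral => t _; rewrite -prodEFin; apply: eq_bigr => j _.
  by rewrite poisson_massE// mulr_ge0// fine_ge0// measure_ge0.
have [_ H] := ppX; rewrite -H//.
rewrite setIC -integral_indic//; last first.
  by apply: fin_bigcap_measurable; [exact: finite_finset | move=> j _; exact:
    measurable_eq_num].
apply: eq_integral => t _; congr EFin; rewrite indicE.
case: (boolP (t \in _)) => [|h].
  rewrite inE => h; apply: big1 => j _; rewrite /psi ltn0.
  by have := h j I; rewrite /= => ->; rewrite eqxx.
have [j /eqP hj] : exists j, num_points X (A j) t <> (k j)%:R%:E.
  apply/existsNP => H'; move: h; rewrite mem_set// => j _; exact: H'.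
by rewrite (bigD1 j)//= /psi ltn0 (negbTE hj) mul0r.
Qed.

(** Summing the identity of level l over all counts v of the cell l, with weights exp (- y v),
    replaces the test on this cell by an exponential on the left and by the Poisson generating
    function on the right. *)
Let level l k : (l <= n)%N ->
  \int[P]_(t in Z @^-1` E) (\prod_j psi l k t j)%R%:E =
  \int[P]_(t in Z @^-1` E) (\prod_j Psi l k (Z t) j)%R%:E.
Proof.
elim: l k => [|l IH] k ln; first exact: level0.
pose j0 := Ordinal ln.
(* The induction hypothesis is used with the prescribed count of the cell j0 changed to v, which is
   why k is generalized. *)
pose upd v (j : 'I_n) := if j == j0 then v else k j.
have lj j : j != j0 -> (j < l.+1)%N = (j < l)%N.
  by move=> jj0; rewrite ltnS leq_eqVlt -(inj_eq val_inj) in jj0 *; rewrite (negbTE jj0).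
pose c v : R := expR (- (y j0 * v%:R)).
have e1 t : (\prod_j psi l.+1 k t j)%R%:E =
    \sum_(v <oo) (c v * \prod_j psi l (upd v) t j)%R%:E.
  rewrite (bigD1 j0)//= {1}/psi ltnSn expN_series//; last 2 first.
    by apply: prodr_ge0 => j _.
    exact: num_points_nat.
  apply: eq_eseriesr => v _; congr EFin; congr (_ * _)%R.
  rewrite [RHS](bigD1 j0)//= {2}/psi ltnn /upd eqxx; congr (_ * _)%R.
  by apply: eq_bigr => j jj0; rewrite /psi lj// /upd (negbTE jj0).
have e2 t : (\prod_j Psi l.+1 k (Z t) j)%R%:E =
    \sum_(v <oo) (c v * \prod_j Psi l (upd v) (Z t) j)%R%:E.
  rewrite (bigD1 j0)//= {1}/Psi ltnSn EFinM -poisson_generating_function//.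
  rewrite muleC -nneseriesZl; last by move=> v _ ;
    rewrite lee_fin mulr_ge0 ?expR_ge0// poisson_weight_ge0.
  apply: eq_eseriesr => v _; rewrite -EFinM; congr EFin.
  rewrite mulrC -mulrA; congr (_ * _)%R.
  rewrite [RHS](bigD1 j0)//= {2}/Psi ltnn /upd eqxx; congr (_ * _)%R.
  by apply: eq_bigr => j jj0; rewrite /Psi lj// /upd (negbTE jj0).
under eq_integral do rewrite e1.
under [RHS]eq_integral do rewrite e2.
have mp v : measurable_fun setT (fun t => (c v * \prod_j psi l (upd v) t j)%R).
  by apply: measurable_funM => //; apply: measurable_prod => j _; exact: measurable_psi.
have mP v : measurable_fun setT (fun t => (c v * \prod_j Psi l (upd v) (Z t) j)%R).
  apply: measurable_funM => //; apply: measurable_prod => j _.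
  exact: (measurableT_comp (measurable_Psi _ _ _)).
have c0 v : (0 <= c v)%R by exact: expR_ge0.
rewrite !integral_nneseries//; last 4 first.
- by move=> v; apply: measurable_funTS; exact/measurable_EFinP.
- by move=> v t _; rewrite lee_fin mulr_ge0// prodr_ge0.
- by move=> v; apply: measurable_funTS; exact/measurable_EFinP.
- by move=> v t _; rewrite lee_fin mulr_ge0// prodr_ge0.
apply: eq_eseriesr => v _.
under eq_integral do rewrite EFinM.
under [RHS]eq_integral do rewrite EFinM.
rewrite !ge0_integralZl_EFin//; last 4 first.
- by move=> t _; rewrite lee_fin prodr_ge0.
- apply: measurable_funTS; apply/measurable_EFinP; apply: measurable_prod => j _.
  exact: (measurableT_comp (measurable_Psi _ _ _)).
- by move=> t _; rewrite lee_fin prodr_ge0.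
- by apply: measurable_funTS; apply/measurable_EFinP; apply: measurable_prod => j _;
  exact: measurable_psi.
by congr (_ * _); apply: IH; exact: ltnW.
Qed.

Lemma laplace_finite_partition :
  \int[P]_(t in Z @^-1` E) expeR (- \sum_(j < n) ((y j)%:E * num_points X (A j) t)) =
  \int[P]_(t in Z @^-1` E)
    expeR (- (lam * \sum_(j < n) (1 - expR (- y j)) * fine (area (A j `&` D (Z t))))%R%:E).
Proof.
(* At level n no test on a count is left, so any prescribed counts will do. *)
transitivity (\int[P]_(t in Z @^-1` E) (\prod_j psi n (fun=> 0%N) t j)%R%:E).
  apply: eq_integral => t _; rewrite -prodEFin.
  have np j : 0 <= num_points X (A j) t.
    by rewrite num_points_indic nneseries_EFin_ge0// => i; exact: omark_ge0.
  have yp j : 0 <= (y j)%:E * num_points X (A j) t.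
    by apply: mule_ge0; rewrite ?np// lee_fin ltW.
  have s0 (s : seq 'I_n) : 0 <= \sum_(j <- s) ((y j)%:E * num_points X (A j) t).
    by apply: sume_ge0.
  elim: (index_enum _) => [|j s IH]; first by rewrite !big_nil oppe0 expeR0.
  rewrite !big_cons -IH /psi ltn_ord /expN.
  have p0 := yp j.
  rewrite fineK; last first.
    rewrite ge0_fin_numE ?expeR_ge0//; apply: (@le_lt_trans _ _ 1); last exact: ltry.
    by have /andP[] := expeRN_ge0_le1 p0.
  rewrite -expeRD; congr expeR; rewrite oppeD// ge0_adde_def// inE; exact: s0.
rewrite level//; apply: eq_integral => t _ /=; congr EFin.
rewrite mulr_sumr -sumrN expR_sum; apply: eq_bigr => j _.
by rewrite /Psi ltn_ord /m; congr (expR (- _)); ring.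
Qed.

End finite_partition.

End laplace.

(** * Dyadic approximation from below *)

Section dyadic.
Context (R : realType).

Definition dyadic_index (n : nat) (q : R) : nat := Num.truncn (2 ^+ n * q).
Definition dyadic (n : nat) (q : R) : R := (dyadic_index n q)%:R / 2 ^+ n.

Let p2 n : 0 < 2 ^+ n :> R. Proof. by rewrite exprn_gt0. Qed.

Lemma dyadic_ge0 n q : 0 <= dyadic n q.
Proof. by rewrite divr_ge0// ltW. Qed.

Lemma dyadic_index_itv n q : 0 <= q ->
  (dyadic_index n q)%:R <= 2 ^+ n * q < (dyadic_index n q).+1%:R.
Proof. by move=> q0; apply: truncn_itv; rewrite mulr_ge0// ltW. Qed.

Lemma dyadic_le n q : 0 <= q -> dyadic n q <= q.
Proof.
by move=> /(dyadic_index_itv n)/andP[h _]; rewrite /dyadic ler_pdivrMr// mulrC.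
Qed.

Lemma dyadic_gt n q : 0 <= q -> q - 2^-1 ^+ n < dyadic n q.
Proof.
move=> /(dyadic_index_itv n)/andP[_ h].
rewrite /dyadic ltrBlDr exprVn -[X in _ + X]mul1r -mulrDl ltr_pdivlMr// mulrC.
by rewrite natr1.
Qed.

(** Twice the integer part of x is at most the integer part of 2 x: this makes the approximations
    increase with n. *)
Lemma dyadic_index_double n q : 0 <= q ->
  ((dyadic_index n q).*2 <= dyadic_index n.+1 q)%N.
Proof.
move=> q0; rewrite /dyadic_index truncn_ge_nat; last by rewrite mulr_ge0// exprn_ge0.
have /andP[h _] := dyadic_index_itv n q0.
by rewrite -muln2 natrM exprS -mulrA mulrC ler_pM2l.
Qed.

Lemma dyadic_nd q : 0 <= q -> {homo dyadic ^~ q : m n / (m <= n)%N >-> m <= n}.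
Proof.
move=> q0; apply/nondecreasing_seqP => n; rewrite /dyadic ler_pdivrMr// mulrAC ler_pdivlMr//.
rewrite exprS mulrA ler_pM2r// -natrM ler_nat muln2; exact: dyadic_index_double.
Qed.

Lemma cvg_half_pow : (2^-1 : R) ^+ n @[n --> \oo] --> 0.
Proof. by apply: cvg_expr; rewrite ger0_norm// invf_lt1// ltr1n. Qed.

Lemma cvg_dyadic q : 0 <= q -> dyadic n q @[n --> \oo] --> q.
Proof.
move=> q0.
have c : q - 2^-1 ^+ n @[n --> \oo] --> q.
  rewrite -[X in _ --> X]subr0; apply: cvgB; [exact: cvg_cst | exact: cvg_half_pow].
apply: (squeeze_cvgr _ c (cvg_cst q)).
by apply: nearW => n; rewrite dyadic_le// ltW// dyadic_gt.
Qed.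

Lemma measurable_dyadic_index d (S : measurableType d) (f : S -> R) n k :
    measurable_fun setT f -> (forall s, 0 <= f s) ->
  measurable [set s | dyadic_index n (f s) = k].
Proof.
move=> mf f0.
rewrite (_ : [set s | _] = (fun s => 2 ^+ n * f s) @^-1` `[k%:R, k.+1%:R[%classic).
  rewrite -[X in measurable X]setTI; apply: (measurable_funM _ mf) => //.
apply/seteqP; split => s /=; rewrite in_itv/=.
  by move=> <-; exact: dyadic_index_itv.
by move=> h; apply/eqP; rewrite /dyadic_index truncn_eq// mulr_ge0// ltW.
Qed.

Lemma measurable_dyadic d (S : measurableType d) (f : S -> R) n :
    measurable_fun setT f -> (forall s, 0 <= f s) ->
  measurable_fun setT (fun s => dyadic n (f s)).
Proof.
move=> mf f0 _ B mB; rewrite setTI.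
rewrite (_ : _ @^-1` _ =
  \bigcup_k ([set s | dyadic_index n (f s) = k] `&` [set _ | B (k%:R / 2 ^+ n)])).
  apply: bigcup_measurable => k _; apply: measurableI; first exact: measurable_dyadic_index.
  have [h|h] := pselect (B (k%:R / 2 ^+ n)).
    by rewrite (_ : [set _ | _] = setT)//; apply/seteqP; split.
  by rewrite (_ : [set _ | _] = set0)//; apply/seteqP; split.
apply/seteqP; split => s /=.
  by move=> h; exists (dyadic_index n (f s)).
by move=> [k _ [/= <-]].
Qed.

Lemma integral_dyadic_cells d (S : measurableType d) (mu : {measure set S -> \bar R})
    (f : S -> R) n (F : S -> \bar R) :
    measurable_fun setT f -> (forall s, 0 <= f s) ->
    measurable_fun setT F -> (forall s, (0 <= F s)%E) ->
  (\int[mu]_s F s = \sum_(k <oo) \int[mu]_(s in [set s | dyadic_index n (f s) = k]) F s)%E.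
Proof.
move=> mf f0 mF F0.
have e : \bigcup_k [set s | dyadic_index n (f s) = k] = setT.
  by apply/seteqP; split => // s _; exists (dyadic_index n (f s)).
rewrite -[in LHS]e ge0_integral_bigcup//.
- by move=> k; exact: measurable_dyadic_index.
- by rewrite e.
- by move=> i j _ _ [s [/= <- <-]].
Qed.

End dyadic.

Section step_approximation.
Context (R : realType) (g : R * R -> R).
Hypothesis mg : measurable_fun setT g.
Hypothesis g0 : forall x, 0 <= g x.

Definition in_box (n : nat) (x : R * R) : bool := (`|x.1| < n%:R) && (`|x.2| < n%:R).

(** Level sets of the n-th dyadic approximation of g, cut to a box to have finite area. The shift
    [j.+1] leaves out the level 0, because [laplace_finite_partition] asks for positive weights. *)
Definition step_cell (n : nat) (j : 'I_(n * 2 ^ n)) : set (R * R) :=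
  [set x | dyadic_index n (g x) = j.+1 /\ in_box n x].

Definition in_support (n : nat) (x : R * R) : bool :=
  (dyadic_index n (g x) <= n * 2 ^ n)%N && in_box n x.

Definition step_fun (n : nat) (x : R * R) : R :=
  if in_support n x then dyadic n (g x) else 0.

Lemma step_fun_ge0 n x : 0 <= step_fun n x.
Proof. by rewrite /step_fun; case: ifP => // _; exact: dyadic_ge0. Qed.

Lemma measurable_in_box n : measurable [set x | in_box n x].
Proof.
rewrite (_ : [set x | _] = `]-n%:R, n%:R[%classic `*` `]-n%:R, n%:R[%classic).
  exact: measurableX.
by apply/seteqP; split => -[x y] /=; rewrite /in_box/= !in_itv/= -!ltr_norml => /andP.
Qed.

Lemma measurable_step_cell n j : measurable (@step_cell n j).
Proof.
by apply: measurableI; [exact: measurable_dyadic_index | exact: measurable_in_box].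
Qed.

Lemma area_step_cell n j : (area (@step_cell n j) < +oo)%E.
Proof.
suff h : (plane_measure [set x : R * R | in_box n x] < +oo)%E.
  rewrite areaE; apply: le_lt_trans h; apply: le_measure; rewrite ?inE.
  - exact: measurable_step_cell.
  - exact: measurable_in_box.
  - by move=> x [].
rewrite (_ : [set x | _] = `]-n%:R, n%:R[%classic `*` `]-n%:R, n%:R[%classic).
  rewrite /plane_measure/= product_measure1E; [|exact: measurable_itv|exact: measurable_itv].
  have lf : (lebesgue_measure (`](- n%:R)%R, (n%:R)%R[%classic : set R) < +oo)%E.
    by rewrite lebesgue_measure_itv/=; case: ifP => _; rewrite ?ltry// -EFinB ltry.
  by rewrite lte_mul_pinfty// ge0_fin_numE.
by apply/seteqP; split => -[x y] /=; rewrite /in_box/= !in_itv/= -!ltr_norml => /andP.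
Qed.

Lemma trivIset_step_cell n : trivIset setT (@step_cell n).
Proof.
by move=> i j _ _ [x [[ei _] [ej _]]]; apply/val_inj/eqP; rewrite -eqSS -ei -ej.
Qed.

(** Serves two choices of c: k / 2^n for the point sums, and 1 - exp (- k / 2^n) for the exponents.
    The level 0 has no cell, hence the condition on c. *)
Lemma step_sum (c : nat -> R) n x : c 0%N = 0 ->
  \sum_(j < n * 2 ^ n) c j.+1 * \1_(@step_cell n j) x =
  if in_support n x then c (dyadic_index n (g x)) else 0.
Proof.
move=> c0; case: ifPn => [/andP[le_k bx]|ns].
  case ek : (dyadic_index n (g x)) => [|k].
    rewrite c0 big1// => j _; rewrite indicE memNset ?mulr0// => -[].
    by rewrite ek.
  have kn : (k < n * 2 ^ n)%N by rewrite -ek.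
  rewrite (bigD1 (Ordinal kn))//= indicE mem_set; last by split.
  rewrite mulr1 big1 ?addr0// => j jk; rewrite indicE memNset ?mulr0// => -[].
  by rewrite ek => -[kj] _; move: jk; rewrite -(inj_eq val_inj)/= kj eqxx.
apply: big1 => j _; rewrite indicE memNset ?mulr0// => -[ej bx].
by move: ns; rewrite /in_support bx ej ltn_ord.
Qed.

(** From n to n + 1 an index i becomes at most 2 i + 1, whereas the bound n 2^n becomes 2 (n 2^n +
    2^n). The supports therefore grow, and [step_fun] is nondecreasing in n. *)
Lemma in_support_next n x : in_support n x -> in_support n.+1 x.
Proof.
move=> /andP[h /andP[b1 b2]]; apply/andP; split; last first.
  by apply/andP; split; [apply: (lt_le_trans b1)|apply: (lt_le_trans b2)]; rewrite ler_nat.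
have /andP[_ i1] := dyadic_index_itv n (g0 x).
apply: ltnW; rewrite /dyadic_index truncn_lt_nat; last by rewrite mulr_ge0// exprn_ge0.
rewrite exprS -mulrA.
apply: (@lt_le_trans _ _ (2 * (n * 2 ^ n).+1%:R)).
  rewrite ltr_pM2l//; apply: (lt_le_trans i1); by rewrite ler_nat.
rewrite -natrM ler_nat expnS mulnCA leq_pmul2l// mulSn addnC -addn1 leq_add2l expn_gt0//.
Qed.

Lemma step_fun_nd x : {homo step_fun ^~ x : m n / (m <= n)%N >-> m <= n}.
Proof.
apply/nondecreasing_seqP => n; rewrite /step_fun.
case: ifPn => [/in_support_next -> |_]; first by apply: dyadic_nd => //.
by case: ifP => // _; exact: dyadic_ge0.
Qed.

Lemma cvg_step_fun x : step_fun n x @[n --> \oo] --> g x.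
Proof.
have := cvg_dyadic (g0 x); apply: cvg_trans; apply: near_eq_cvg.
near=> n; rewrite /step_fun ifT//; apply/andP; split; last first.
  by apply/andP; split; near: n; exact: nbhs_infty_gtr.
rewrite -(ler_nat R).
have /andP[i1 _] := dyadic_index_itv n (g0 x).
apply: (le_trans i1); rewrite natrM mulrC natrX ler_pM2r ?exprn_gt0//.
by near: n; exact: nbhs_infty_ger.
Unshelve. all: by end_near. Qed.

Lemma measurable_step_fun n : measurable_fun setT (step_fun n).
Proof.
rewrite (_ : step_fun n = fun x =>
    \sum_(j < n * 2 ^ n) (j.+1%:R / 2 ^+ n) * \1_(@step_cell n j) x).
  apply: measurable_sum => j; apply: measurable_funM => //.
  by apply: measurable_indic; exact: measurable_step_cell.
by apply/funext => x; rewrite (step_sum (c := fun k => k%:R / 2 ^+ n)) ?mul0r.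
Qed.

End step_approximation.

Section laplace_functional.
Context d (T : measurableType d) (R : realType) (P : probability T R).
Local Open Scope ereal_scope.
Local Notation vol := (@plane_measure R).

Definition point_sum (g : R * R -> R) (X : points T R) (t : T) : \bar R :=
  \sum_(i <oo) (omark g (X i t))%:E.

Lemma point_sum_ge0 g X t : (forall x, (0 <= g x)%R) -> 0 <= point_sum g X t.
Proof. by move=> g0; apply: nneseries_EFin_ge0 => i; exact: omark_ge0. Qed.

Lemma measurable_point_sum (g : R * R -> R) (X : points T R) :
  (forall x, (0 <= g x)%R) -> measurable_fun setT g ->
  point_process X -> measurable_fun setT (point_sum g X).
Proof.
move=> g0 mg pX; apply: measurable_nneseries => [i|i t]; last exact: omark_ge0.
by apply: measurable_omark => // A mA; apply: pX; exists i, A.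
Qed.

Lemma measurable_section_integral (D : R -> set (R * R)) (h : R * R -> \bar R) :
    measurable [set zx : R * (R * R) | D zx.1 zx.2] ->
    measurable_fun setT h -> (forall x, 0 <= h x) ->
  measurable_fun setT (fun z => \int[vol]_(x in D z) h x).
Proof.
move=> mD mh h0.
pose f (zx : R * (R * R)) : \bar R := ((h \o snd) \_ [set zx : R * (R * R) | D zx.1 zx.2]) zx.
have mf : measurable_fun setT f.
  apply/(measurable_restrictT _ mD); apply: measurable_funTS.
  by apply: measurableT_comp => //; exact: measurable_snd.
have f0 zx : 0 <= f zx by rewrite /f patchE; case: ifP => // _; exact: h0.
have := @measurable_fun_fubini_tonelli_F _ _ _ _ _ vol f mf f0.
congr (measurable_fun _ _); apply/funext => z; rewrite /fubini_F [RHS]integral_mkcond.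
apply: eq_integral => x _; rewrite /f !patchE/=; congr (if _ then _ else _).
Qed.

Lemma void_ge0 (g : R * R -> R) x : (0 <= g x)%R -> 0 <= (1 - expR (- g x))%:E.
Proof. by move=> g0; rewrite lee_fin subr_ge0 -expR0 ler_expR lerNl oppr0. Qed.

Lemma measurable_void (g : R * R -> R) : measurable_fun setT g ->
  measurable_fun setT (fun x => (1 - expR (- g x))%:E).
Proof.
move=> mg; apply/measurable_EFinP; apply: measurable_funB; first exact: measurable_cst.
by apply: measurableT_comp => //; exact: measurableT_comp.
Qed.

(** For step functions this is the identity for finitely many disjoint cells. Step functions
    increasing to g make the point sums and the exponents increase, and the exponentials stay in
    [0, 1]. Keeping the event {Z in E} allows a different g on each such event later on. *)
Lemma laplace_functional (Z : {RV P >-> R}) (X : points T R) (lam : R)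
    (D : R -> set (R * R)) (g : R * R -> R) (E : set R) :
    (0 <= lam)%R -> measurable [set zx : R * (R * R) | D zx.1 zx.2] ->
    poisson_process_given Z X lam D ->
    measurable_fun setT g -> (forall x, (0 <= g x)%R) -> measurable E ->
  \int[P]_(t in Z @^-1` E) expeR (- point_sum g X t) =
  \int[P]_(t in Z @^-1` E)
    expeR (- (lam%:E * \int[vol]_(x in D (Z t)) (1 - expR (- g x))%:E)).
Proof.
move=> lam0 mD ppX mg g0 mE.
have [pX _] := ppX.
have mDz z : measurable (D z) by exact: (measurable_section mD).
have mZE : measurable (Z @^-1` E) by exact: measurable_funPTI.
have sg0 n x : (0 <= step_fun g n x)%R by exact: step_fun_ge0.
have msg n : measurable_fun setT (step_fun g n) by exact: measurable_step_fun.
have yE n (j : 'I_(n * 2 ^ n)) : (0 < j.+1%:R / 2 ^+ n :> R)%R by rewrite divr_gt0// exprn_gt0.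
have stepL n t : \sum_(j < n * 2 ^ n) ((j.+1%:R / 2 ^+ n)%R%:E * num_points X (@step_cell
  _ g n j) t)
    = point_sum (step_fun g n) X t.
  rewrite /point_sum.
  under eq_bigr => j _.
    rewrite num_points_indic -nneseriesZl; last by move=> i _; rewrite lee_fin omark_ge0.
    over.
  rewrite -nneseries_sum; last first.
    by move=> j i _; rewrite -EFinM lee_fin mulr_ge0 ?omark_ge0// ltW.
  apply: eq_eseriesr => i _.
  rewrite (eq_bigr (fun j : 'I_(n * 2 ^ n) =>
    (j.+1%:R / 2 ^+ n * omark \1_(@step_cell _ g n j) (X i t))%:E)); last by [].
  rewrite sumEFin; congr EFin; rewrite /omark; case: (X i t) => [x|].
    by rewrite (@step_sum _ g (fun k => k%:R / 2 ^+ n)%R) ?mul0r.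
  by rewrite big1// => j _; rewrite mulr0.
(* Off the cells the step function is 0 and 1 - exp (- 0) = 0, so the integral over D z reduces to
   the cells. *)
have stepR n z : (\sum_(j < n * 2 ^ n) (1 - expR (- (j.+1%:R / 2 ^+ n))) *
     fine (area (@step_cell _ g n j `&` D z)))%R%:E =
    \int[vol]_(x in D z) (1 - expR (- step_fun g n x))%:E.
  transitivity (\int[vol]_(x in D z) \sum_(j < n * 2 ^ n)
      ((1 - expR (- (j.+1%:R / 2 ^+ n)))%:E * (\1_(@step_cell _ g n j) x)%:E)); last first.
    apply: eq_integral => x _.
    rewrite (eq_bigr (fun j : 'I_(n * 2 ^ n) =>
      ((1 - expR (- (j.+1%:R / 2 ^+ n))) * \1_(@step_cell _ g n j) x)%:E)); last by [].
    rewrite sumEFin (@step_sum _ g (fun k => 1 - expR (- (k%:R / 2 ^+ n)))%R).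
      by rewrite /step_fun; case: ifP => // _; rewrite oppr0 expR0 subrr.
    by rewrite mul0r oppr0 expR0 subrr.
  have c0 (j : 'I_(n * 2 ^ n)) : (0 <= 1 - expR (- (j.+1%:R / 2 ^+ n)) :> R)%R.
    by rewrite subr_ge0 -expR0 ler_expR lerNl oppr0 ltW.
  have mc (j : 'I_(n * 2 ^ n)) :
    measurable_fun (D z) (fun x => (\1_(@step_cell _ g n j) x)%:E : \bar R).
    apply: measurable_funTS; apply/measurable_EFinP; apply: measurable_indic.
    exact: measurable_step_cell.
  rewrite ge0_integral_sum//; last 2 first.
  - exact (mDz z).
  - by move=> j; refine (measurable_funeM _ (mc j)).
  rewrite -sumEFin; apply: eq_bigr => j _.
  rewrite ge0_integralZl_EFin; [|exact (mDz z)|by []|exact (mc j)|exact: c0].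
  rewrite integral_indic; [|exact (mDz z)|exact (measurable_step_cell mg g0 j)].
  rewrite EFinM fineK// ge0_fin_numE ?areaE ?measure_ge0//.
  apply: (le_lt_trans _ (@area_step_cell _ g mg g0 n j)); rewrite areaE.
  apply: le_measure; rewrite ?inE; [|exact: measurable_step_cell|by move=> x []].
  by exact (measurableI _ _ (measurable_step_cell mg g0 j) (mDz z)).
have c1 : \int[P]_(t in Z @^-1` E) expeR (- point_sum (step_fun g n) X t) @[n --> \oo] -->
    \int[P]_(t in Z @^-1` E) expeR (- point_sum g X t).
  apply: bounded_cvg_integral => //.
  - move=> n; apply: measurableT_comp; first exact: measurable_expeR.
    by apply: measurableT_comp => //; exact: measurable_point_sum.
  - by move=> n t; apply: expeRN_ge0_le1; exact: point_sum_ge0.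
  - move=> t; apply: cvg_expeRN.
    + by move=> n; exact: point_sum_ge0.
    + exact: point_sum_ge0.
    + apply: cvg_monotone_nneseries.
      * by move=> n i; exact: omark_ge0.
      * by move=> i m n mn; rewrite /omark; case: (X i t) => // x; exact: step_fun_nd.
      * move=> i; rewrite /omark; case: (X i t) => [x|]; first exact: cvg_step_fun.
        exact: cvg_cst.
have I0 (h : R * R -> R) z : (forall x, (0 <= h x)%R) ->
    0 <= lam%:E * \int[vol]_(x in D z) (1 - expR (- h x))%:E.
  move=> h0; apply: mule_ge0; first by rewrite lee_fin.
  by apply: integral_ge0 => x _; exact: void_ge0.
have c2 : \int[P]_(t in Z @^-1` E) expeR
      (- (lam%:E * \int[vol]_(x in D (Z t)) (1 - expR (- step_fun g n x))%:E)) @[n --> \oo] -->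
    \int[P]_(t in Z @^-1` E) expeR
      (- (lam%:E * \int[vol]_(x in D (Z t)) (1 - expR (- g x))%:E)).
  apply: bounded_cvg_integral => //.
  - move=> n; apply: measurableT_comp; first exact: measurable_expeR.
    apply: measurableT_comp => //; apply: measurable_funeM.
    have := @measurable_section_integral D _ mD (measurable_void (msg n)) (fun x =>
      void_ge0 (sg0 n x)).
    by move=> /measurableT_comp; apply.
  - by move=> n t; apply: expeRN_ge0_le1; exact: I0.
  - move=> t; apply: cvg_expeRN.
    + by move=> n; exact: I0.
    + exact: I0.
    + apply: cvgeZl => //.
      rewrite [X in _ --> X](_ : _ = \int[vol]_(x in D (Z t))
          limn (fun n => (1 - expR (- step_fun g n x))%:E)).
        apply: cvg_monotone_convergence; [exact (mDz (Z t))| | |].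
        * by move=> n; exact (measurable_funTS (measurable_void (msg n))).
        * by move=> n x _; exact: void_ge0.
        * by move=> x _ m n mn; rewrite lee_fin lerD2l lerN2 ler_expR lerN2; exact: step_fun_nd.
      apply: eq_integral => x _; apply/esym/cvg_lim => //.
      apply: cvg_EFin; first exact: nearW.
      apply: cvgB; first exact: cvg_cst.
      apply: continuous_cvg; first exact: continuous_expR.
      by apply: cvgN; exact: cvg_step_fun.
rewrite -(cvg_lim _ c2)// -(cvg_lim _ c1)//; congr (lim _).
congr (_ @ \oo); apply/funext => n.
transitivity (\int[P]_(t in Z @^-1` E) expeR (- \sum_(j < n * 2 ^ n)
    ((j.+1%:R / 2 ^+ n)%R%:E * num_points X (@step_cell _ g n j) t))).
  by apply: eq_integral => t _; rewrite stepL.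
rewrite (@laplace_finite_partition _ _ _ _ Z X lam D lam0 mD ppX E (n * 2 ^ n)
  (@step_cell _ g n) (fun j => j.+1%:R / 2 ^+ n)%R)//; last 3 first.
- by move=> j; exact: measurable_step_cell.
- by move=> j; exact: area_step_cell.
- exact: trivIset_step_cell.
by apply: eq_integral => t _; rewrite EFinM stepR.
Qed.

End laplace_functional.

(** * Joint Laplace functional of both kinds of interferers *)

Section joint_laplace.
Context d (T : measurableType d) (R : realType) (P : probability T R).
Local Open Scope ereal_scope.
Local Notation vol := (@plane_measure R).

Lemma integral_prob_cst (c : \bar R) : \int[P]_t c = c.
Proof.
transitivity (c * P setT); first exact: integral_cst.
by rewrite -[RHS]mule1; congr (_ * _); exact: probability_setT.
Qed.

(** Conditioning on a constant is no conditioning, so that one Laplace functional serves both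
    notions of Poisson process. *)
Lemma poisson_process_unconditional (X : points T R) (lam : R) (D : set (R * R)) :
  poisson_process P X lam D ->
  poisson_process_given (cst 0%R : {RV P >-> R}) X lam (fun=> D).
Proof.
move=> [pX H]; split => // E n A k mE mA finA trivA.
have [E0|E0] := pselect (E 0%R).
  rewrite (_ : cst 0%R @^-1` E = setT); last by apply/seteqP; split.
  by rewrite setTI H// integral_prob_cst.
rewrite (_ : cst 0%R @^-1` E = set0); last by apply/seteqP; split.
by rewrite set0I measure0 integral_set0.
Qed.

Lemma measurable_generated_points (G : set (set T)) (X : points T R) (g : R * R -> R) i :
    point_events X `<=` <<s G >> -> measurable_fun setT g ->
  measurable_fun setT ((fun t => omark g (X i t)) : g_sigma_algebraType G -> R).
Proof.
move=> XG mg; apply: measurable_omark => // A mA.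
by apply: XG; exists i, A.
Qed.

Lemma measurable_generated_point_sum (G : set (set T)) (X : points T R) (g : R * R -> R) :
    point_events X `<=` <<s G >> -> measurable_fun setT g -> (forall x, (0 <= g x)%R) ->
  measurable_fun setT (point_sum g X : g_sigma_algebraType G -> \bar R).
Proof.
move=> XG mg g0; apply: ge0_emeasurable_sum => [i t _ _|i _].
  by rewrite lee_fin omark_ge0.
apply/measurable_EFinP; exact: measurable_generated_points.
Qed.

Lemma integral_indicM (D : set T) (f : T -> \bar R) :
  \int[P]_(t in D) f t = \int[P]_t ((\1_D t)%:E * f t).
Proof.
rewrite [LHS]integral_mkcond; apply: eq_integral => t _.
by rewrite patchE indicE; case: (t \in D); rewrite ?mul1e ?mul0e.
Qed.

Section fixed_radius.
Context (Z : {RV P >-> R}) (X Y : points T R) (lamX lamY : R) (D : R -> set (R * R)).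
Hypothesis lamX0 : (0 <= lamX)%R.
Hypothesis lamY0 : (0 <= lamY)%R.
Hypothesis mD : measurable [set zx : R * (R * R) | D zx.1 zx.2].
Hypothesis ppX : poisson_process P X lamX setT.
Hypothesis ppY : poisson_process_given Z Y lamY D.
Hypothesis ind : indep_systems P (rv_events Z `|` point_events Y) (point_events X).

(** Times the density, this is the exponent of the Laplace functional; for infinite g it would
    become the area of A and give the void probability. *)
Definition void_integral (A : set (R * R)) (g : R * R -> R) : \bar R :=
  \int[vol]_(x in A) (1 - expR (- g x))%:E.

Lemma void_integral_ge0 A g : (forall x, (0 <= g x)%R) -> 0 <= void_integral A g.
Proof. by move=> g0; apply: integral_ge0 => x _; exact: void_ge0. Qed.

Lemma laplace_unconditional (g : R * R -> R) :
    measurable_fun setT g -> (forall x, (0 <= g x)%R) ->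
  \int[P]_t expeR (- point_sum g X t) = expeR (- (lamX%:E * void_integral setT g)).
Proof.
move=> mg g0.
have mT : measurable [set zx : R * (R * R) | (fun=> setT : set (R * R)) zx.1 zx.2].
  by rewrite (_ : [set _ | _] = setT)//; apply/seteqP; split.
have := @laplace_functional _ _ _ P (cst 0%R : {RV P >-> R}) X lamX (fun=> setT) g setT lamX0 mT
  (poisson_process_unconditional ppX) mg g0 measurableT.
by rewrite !preimage_setT integral_prob_cst.
Qed.

(** As X is independent of the pair (Z, Y), its factor averages to a constant; the factor of Y is
    then treated conditionally on Z. *)
Lemma joint_laplace_fixed (gX gY : R * R -> R) (E : set R) :
    measurable_fun setT gX -> (forall x, (0 <= gX x)%R) ->
    measurable_fun setT gY -> (forall x, (0 <= gY x)%R) -> measurable E ->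
  \int[P]_(t in Z @^-1` E) expeR (- (point_sum gX X t + point_sum gY Y t)) =
  \int[P]_(t in Z @^-1` E) expeR (- (lamX%:E * void_integral setT gX
                                    + lamY%:E * void_integral (D (Z t)) gY)).
Proof.
move=> mgX gX0 mgY gY0 mE.
have [pX _] := ppX; have [pY _] := ppY.
pose F := rv_events Z `|` point_events Y; pose G := point_events X.
have ZF : rv_events Z `<=` <<s F >> by move=> A ZA; apply: sub_gen_smallest; left.
have YF : point_events Y `<=` <<s F >> by move=> A ZA; apply: sub_gen_smallest; right.
have XG : point_events X `<=` <<s G >> by move=> A ZA; exact: sub_gen_smallest.
have mZE : measurable (Z @^-1` E) by exact: measurable_funPTI.
have expD (a b : \bar R) : 0 <= a -> 0 <= b -> expeR (- (a + b)) = expeR (- a) * expeR (- b).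
  by move=> a0 b0; rewrite oppeD ?ge0_adde_def ?inE// expeRD.
pose phi (z : g_sigma_algebraType F * g_sigma_algebraType G) : \bar R :=
  (\1_E (Z z.1))%:E * expeR (- point_sum gY Y z.1) * expeR (- point_sum gX X z.2).
transitivity (\int[P]_t phi (t, t)).
  rewrite integral_indicM; apply: eq_integral => t _.
  by rewrite /phi/= addeC expD ?point_sum_ge0// muleA.
rewrite (indep_integral _ _ ind); last 4 first.
- by move=> A [|[i [B [mB ->]]]]; [exact: rv_events_measurable | apply: pY; exists i, B].
- exact: pX.
- apply: emeasurable_funM; first apply: emeasurable_funM.
  + apply/measurable_EFinP; apply: (@measurableT_comp _ _ _ _ _ _ (\1_E \o Z :
    g_sigma_algebraType F -> R) _ fst); last exact: measurable_fst.
    apply: measurableT_comp; first exact: measurable_indic.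
    exact: measurable_fun_generated.
  + apply: measurableT_comp; first exact: measurable_expeR.
    apply: measurableT_comp => //.
    apply: (@measurableT_comp _ _ _ _ _ _ (point_sum gY Y : g_sigma_algebraType F ->
      \bar R) _ fst); last exact: measurable_fst.
    exact: measurable_generated_point_sum.
  + apply: measurableT_comp; first exact: measurable_expeR.
    apply: measurableT_comp => //.
    apply: (@measurableT_comp _ _ _ _ _ _ (point_sum gX X : g_sigma_algebraType G ->
      \bar R) _ snd); last exact: measurable_snd.
    exact: measurable_generated_point_sum.
- move=> z; rewrite !mule_ge0 ?expeR_ge0//.
have mSX : measurable_fun setT (fun t => expeR (- point_sum gX X t)).
  apply: measurableT_comp; first exact: measurable_expeR.
  by apply: measurableT_comp => //; exact: measurable_point_sum.
have mSY : measurable_fun setT (fun t => expeR (- point_sum gY Y t)).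
  apply: measurableT_comp; first exact: measurable_expeR.
  by apply: measurableT_comp => //; exact: measurable_point_sum.
have mV : measurable_fun setT (fun t => expeR (- (lamY%:E * void_integral (D (Z t)) gY))).
  apply: measurableT_comp; first exact: measurable_expeR.
  apply: measurableT_comp => //; apply: measurable_funeM.
  have := @measurable_section_integral _ D _ mD (measurable_void mgY) (fun x => void_ge0
    (gY0 x)).
  by move=> /measurableT_comp; apply.
pose c := expeR (- (lamX%:E * void_integral setT gX)).
transitivity (\int[P]_t ((\1_E (Z t))%:E * expeR (- point_sum gY Y t) * c)).
  apply: eq_integral => t _; rewrite /phi/= /c -laplace_unconditional//.
  apply: ge0_integralZl; [exact: measurableT|exact: mSX| |].
    by move=> s _; exact: expeR_ge0.
  by rewrite mule_ge0 ?expeR_ge0.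
transitivity (\int[P]_(t in Z @^-1` E) (expeR (- point_sum gY Y t) * c)).
  by rewrite [RHS]integral_indicM; apply: eq_integral => t _; rewrite -muleA; congr (_ * _).
have c0 : 0 <= c by exact: expeR_ge0.
rewrite ge0_integralZr//; last 2 first.
- exact: measurable_funTS.
- by move=> t _; exact: expeR_ge0.
rewrite (laplace_functional lamY0 mD ppY mgY gY0 mE).
rewrite -ge0_integralZr//; last 2 first.
- exact: measurable_funTS.
- by move=> t _; exact: expeR_ge0.
apply: eq_integral => t _; rewrite addeC expD//.
- by rewrite mule_ge0 ?void_integral_ge0.
- by rewrite mule_ge0 ?void_integral_ge0.
Qed.

End fixed_radius.

(** The summed function depends on t, so [measurable_point_sum] does not apply. Since ln 1 = 0, the
    mark of a missing point can be taken inside the logarithm, which makes each term measurable. *)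
Lemma measurable_weighted_point_sum (q : T -> R) (f : R * R -> R) (W : points T R) :
    measurable_fun setT q -> (forall t, (0 <= q t)%R) ->
    measurable_fun setT f -> (forall x, (0 <= f x)%R) -> point_process W ->
  measurable_fun setT (fun t => point_sum (fun x => ln (1 + q t * f x)) W t).
Proof.
move=> mq q0 mf f0 pW.
rewrite (_ : (fun t => _) = (fun t => \sum_(i <oo) (ln (1 + q t * omark f (W i t)))%:E)).
  apply: measurable_nneseries => [i|i t].
    apply: measurableT_comp; first exact: measurable_ln.
    apply: measurable_funD => //; apply: measurable_funM => //.
    by apply: measurable_omark => // A mA; apply: pW; exists i, A.
  by rewrite ln_ge0// lerDl mulr_ge0// omark_ge0.
apply/funext => t; rewrite /point_sum; apply: eq_eseriesr => i _; congr EFin.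
by rewrite /omark; case: (W i t) => // ; rewrite mulr0 addr0 ln1.
Qed.

Section random_radius.
Context (Z : {RV P >-> R}) (X Y : points T R) (lamX lamY : R) (D : R -> set (R * R)).
Hypothesis lamX0 : (0 <= lamX)%R.
Hypothesis lamY0 : (0 <= lamY)%R.
Hypothesis mD : measurable [set zx : R * (R * R) | D zx.1 zx.2].
Hypothesis ppX : poisson_process P X lamX setT.
Hypothesis ppY : poisson_process_given Z Y lamY D.
Hypothesis ind : indep_systems P (rv_events Z `|` point_events Y) (point_events X).
Context (Q : R -> R) (fX fY : R * R -> R).
Hypothesis mQ : measurable_fun setT Q.
Hypothesis Q0 : forall z, (0 <= Q z)%R.
Hypothesis mfX : measurable_fun setT fX.
Hypothesis mfY : measurable_fun setT fY.
Hypothesis fX0 : forall x, (0 <= fX x)%R.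
Hypothesis fY0 : forall x, (0 <= fY x)%R.

Let lg (q : R) (f : R * R -> R) (x : R * R) : R := ln (1 + q * f x).

Let lg_ge0 (q : R) (f : R * R -> R) x : (0 <= q)%R -> (forall x, (0 <= f x)%R) ->
  (0 <= lg q f x)%R.
Proof. by move=> q0 f0; rewrite ln_ge0// lerDl mulr_ge0. Qed.

Let measurable_lg (q : R) (f : R * R -> R) : measurable_fun setT f ->
  measurable_fun setT (lg q f).
Proof.
move=> mf; apply: measurableT_comp; first exact: measurable_ln.
by apply: measurable_funD => //; apply: measurable_funM.
Qed.

Let lg_mono (p q : R) (f : R * R -> R) x : (0 <= p)%R -> (p <= q)%R ->
  (forall x, (0 <= f x)%R) -> (lg p f x <= lg q f x)%R.
Proof.
move=> p0 pq f0; have q0 : (0 <= q)%R by exact: le_trans p0 pq.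
rewrite ler_ln; first by rewrite lerD2l ler_wpM2r.
  by rewrite posrE ltr_wpDr// mulr_ge0.
by rewrite posrE ltr_wpDr// mulr_ge0.
Qed.

Let cvg_lg (u : nat -> R) (q : R) (f : R * R -> R) x : (0 <= q)%R -> (forall x, (0 <= f x)%R) ->
  u @ \oo --> q -> lg (u n) f x @[n --> \oo] --> lg q f x.
Proof.
move=> q0 f0 uq; apply: continuous_cvg.
  by apply: continuous_ln; rewrite ltr_wpDr// mulr_ge0.
by apply: cvgD; [exact: cvg_cst | apply: cvgMl].
Qed.

Let S (q : R) (f : R * R -> R) (W : points T R) t := point_sum (lg q f) W t.

Let cvg_S (u : nat -> R) (q : R) (f : R * R -> R) (W : points T R) t :
  (forall n, (0 <= u n)%R) ->
    {homo u : m n / (m <= n)%N >-> (m <= n)%R} ->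
    (0 <= q)%R -> (forall x, (0 <= f x)%R) ->
  u @ \oo --> q -> S (u n) f W t @[n --> \oo] --> S q f W t.
Proof.
move=> u0 ndu q0 f0 uq; apply: cvg_monotone_nneseries.
- by move=> n i; apply: omark_ge0 => x; exact: lg_ge0.
- move=> i m n mn; rewrite /omark; case: (W i t) => // x.
  by apply: lg_mono => //; exact: ndu.
- move=> i; rewrite /omark; case: (W i t) => [x|]; last exact: cvg_cst.
  exact: cvg_lg.
Qed.

Let cvg_V (u : nat -> R) (q : R) (f : R * R -> R) (A : set (R * R)) :
  (forall n, (0 <= u n)%R) -> measurable_fun setT f ->
    measurable A ->
    {homo u : m n / (m <= n)%N >-> (m <= n)%R} ->
    (0 <= q)%R -> (forall x, (0 <= f x)%R) ->
  u @ \oo --> q -> void_integral A (lg (u n) f) @[n --> \oo] --> void_integral A (lg q f).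
Proof.
move=> u0 mf mA ndu q0 f0 uq.
rewrite /void_integral [X in _ --> X](_ : _ = \int[vol]_(x in A)
    limn (fun n => (1 - expR (- lg (u n) f x))%:E)).
  apply: cvg_monotone_convergence; [exact mA| | |].
  - by move=> n; exact (measurable_funTS (measurable_void (measurable_lg _ mf))).
  - by move=> n x _; apply: void_ge0; exact: lg_ge0.
  - move=> x _ m n mn; rewrite lee_fin lerD2l lerN2 ler_expR lerN2.
    by apply: lg_mono => //; exact: ndu.
apply: eq_integral => x _; apply/esym/cvg_lim => //.
apply: cvg_EFin; first exact: nearW.
apply: cvgB; first exact: cvg_cst.
apply: continuous_cvg; first exact: continuous_expR.
by apply: cvgN; exact: cvg_lg.
Qed.

(** Rounded down to a multiple of 2^-n, the value of Q (Z t) is constant on countably many events of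
    Z, and [joint_laplace_fixed] applies on each. As n grows the rounded values increase, so the
    logarithms, their sums and their integrals converge. *)
Lemma joint_laplace :
  \int[P]_t expeR (- (point_sum (fun x => ln (1 + Q (Z t) * fX x)) X t
                    + point_sum (fun x => ln (1 + Q (Z t) * fY x)) Y t)) =
  \int[P]_t expeR (- (lamX%:E * void_integral setT (fun x => ln (1 + Q (Z t) * fX x))
              + lamY%:E * void_integral (D (Z t)) (fun x => ln (1 + Q (Z t) * fY x)))).
Proof.
have [pX _] := ppX; have [pY _] := ppY.
pose q n t := dyadic n (Q (Z t)).
have mQZ : measurable_fun setT (fun t => Q (Z t)) by exact: measurableT_comp.
have mq n : measurable_fun setT (q n) by exact: measurable_dyadic.
have q0 n t : (0 <= q n t)%R by exact: dyadic_ge0.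
have mDz z : measurable (D z) by exact: (measurable_section mD).
pose FL n t := expeR (- (S (q n t) fX X t + S (q n t) fY Y t)).
pose FR n t := expeR (- (lamX%:E * void_integral setT (lg (q n t) fX)
   + lamY%:E * void_integral (D (Z t)) (lg (q n t) fY))).
have SL0 (r : R) (f : R * R -> R) W t : (0 <= r)%R -> (forall x, (0 <= f x)%R) ->
  0 <= S r f W t.
  by move=> r0 f0; apply: point_sum_ge0 => x; exact: lg_ge0.
have V0 (r : R) (f : R * R -> R) A (l : R) : (0 <= l)%R -> (0 <= r)%R ->
  (forall x, (0 <= f x)%R) ->
    0 <= l%:E * void_integral A (lg r f).
  by move=> l0 r0 f0; rewrite mule_ge0// void_integral_ge0// => x; exact: lg_ge0.
have mSL n (f : R * R -> R) (W : points T R) : measurable_fun setT f ->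
    (forall x, (0 <= f x)%R) -> point_process W ->
      measurable_fun setT (fun t => S (q n t) f W t).
  by move=> mf f0 pW; apply: measurable_weighted_point_sum.
have mVL n (f : R * R -> R) (A : R -> set (R * R)) : measurable_fun setT f ->
  (forall x, (0 <= f x)%R) ->
    measurable [set zx : R * (R * R) | A zx.1 zx.2] ->
    measurable_fun setT (fun t => void_integral (A (Z t)) (lg (q n t) f)).
  move=> mf f0 mA.
  pose h (zx : R * (R * R)) : \bar R :=
    ((fun zx => (1 - expR (- lg (dyadic n (Q zx.1)) f zx.2))%:E) \_ [set zx :
      R * (R * R) | A zx.1 zx.2]) zx.
  have h0 zx : 0 <= h zx.
    rewrite /h patchE; case: ifP => // _; apply: void_ge0; apply: lg_ge0 => //.
    exact: dyadic_ge0.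
  have mh : measurable_fun setT h.
    apply/(measurable_restrictT _ mA); apply: measurable_funTS.
    apply/measurable_EFinP; apply: measurable_funB; first exact: measurable_cst.
    apply: measurableT_comp => //; apply: measurableT_comp => //.
    apply: measurableT_comp; first exact: measurable_ln.
    apply: measurable_funD => //; apply: measurable_funM.
      apply: (@measurableT_comp _ _ _ _ _ _ (fun z => dyadic n (Q z)) _ fst); last exact:
        measurable_fst.
      exact: measurable_dyadic.
    by apply: measurableT_comp => //; exact: measurable_snd.
  have := @measurable_fun_fubini_tonelli_F _ _ _ _ _ vol h mh h0.
  move=> mF; have := measurableT_comp mF (measurable_funP Z : measurable_fun setT Z).
  congr (measurable_fun _ _); apply/funext => t /=;
    rewrite /fubini_F /void_integral [RHS]integral_mkcond.
  by apply: eq_integral => x _; rewrite /h !patchE/=; congr (if _ then _ else _).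
have mT2 : measurable [set zx : R * (R * R) | (fun=> setT : set (R * R)) zx.1 zx.2].
  by rewrite (_ : [set _ | _] = setT)//; apply/seteqP; split.
have mFL n : measurable_fun setT (FL n).
  apply: measurableT_comp; first exact: measurable_expeR.
  by apply: measurableT_comp => //; apply: emeasurable_funD; exact: mSL.
have mFR n : measurable_fun setT (FR n).
  apply: measurableT_comp; first exact: measurable_expeR.
  apply: measurableT_comp => //; apply: emeasurable_funD; apply: measurable_funeM.
    exact: (mVL n fX (fun=> setT)).
  exact: mVL.
(* Cell by cell: on the k-th cell the rounded factor is the constant r = k / 2^n. *)
have e n : \int[P]_t FL n t = \int[P]_t FR n t.
  rewrite (@integral_dyadic_cells _ _ _ P (fun t => Q (Z t)) n (FL n))//; last first.
    by move=> t; exact: expeR_ge0.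
  rewrite [RHS](@integral_dyadic_cells _ _ _ P (fun t => Q (Z t)) n (FR n))//; last first.
    by move=> t; exact: expeR_ge0.
  apply: eq_eseriesr => k _.
  pose r : R := (k%:R / 2 ^+ n)%R.
  have r0 : (0 <= r)%R by rewrite divr_ge0// exprn_ge0.
  pose E : set R := [set z | dyadic_index n (Q z) = k].
  have mE : measurable E by exact: measurable_dyadic_index.
  have := @joint_laplace_fixed Z X Y lamX lamY D lamX0 lamY0 mD ppX ppY ind (lg r fX) (lg
    r fY) E
    (measurable_lg _ mfX) (fun x => lg_ge0 x r0 fX0) (measurable_lg _ mfY) (fun x =>
      lg_ge0 x r0 fY0) mE.
  have -> : Z @^-1` E = [set t | dyadic_index n (Q (Z t)) = k] by [].
  move=> H; etransitivity; [|etransitivity; [exact: H|]].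
    by apply: eq_integral => t; rewrite inE => /= tk; rewrite /FL /q /dyadic tk.
  by apply: eq_integral => t; rewrite inE => /= tk; rewrite /FR /q /dyadic tk.
have qnd t : {homo (fun n => q n t) : m n / (m <= n)%N >-> (m <= n)%R}.
  by apply: dyadic_nd.
have qc t : q n t @[n --> \oo] --> Q (Z t) by exact: cvg_dyadic.
have c1 : \int[P]_t FL n t @[n --> \oo] -->
    \int[P]_t expeR (- (S (Q (Z t)) fX X t + S (Q (Z t)) fY Y t)).
  apply: bounded_cvg_integral => //.
  - by move=> n t; apply: expeRN_ge0_le1; rewrite adde_ge0// SL0.
  - move=> t; apply: cvg_expeRN.
    + by move=> n; rewrite adde_ge0// SL0.
    + by rewrite adde_ge0// SL0.
    + apply: cvgeD; [|exact: cvg_S|exact: cvg_S].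
      by rewrite ge0_adde_def// inE SL0.
have c2 : \int[P]_t FR n t @[n --> \oo] -->
    \int[P]_t expeR (- (lamX%:E * void_integral setT (lg (Q (Z t)) fX)
              + lamY%:E * void_integral (D (Z t)) (lg (Q (Z t)) fY))).
  apply: bounded_cvg_integral => //.
  - by move=> n t; apply: expeRN_ge0_le1; rewrite adde_ge0// V0.
  - move=> t; apply: cvg_expeRN.
    + by move=> n; rewrite adde_ge0// V0.
    + by rewrite adde_ge0// V0.
    + apply: cvgeD; [|apply: cvgeZl => //; exact: cvg_V|apply: cvgeZl => //; exact: cvg_V].
      by rewrite ge0_adde_def// inE V0.
rewrite (funext e) in c1.
exact: (cvg_unique _ c1 c2).
Qed.

End random_radius.

End joint_laplace.

(** * Euler reflection formula *)

Section cosecant.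
Context (R : realType).
Implicit Types (x y : R).

(** Used in a chain: the error of each Taylor bound for sin and cos below has as derivative the
    error of the previous bound. *)
Lemma ge0_of_derive (f f' : R -> R) : f 0 = 0 ->
    (forall x, is_derive x 1 f (f' x)) -> (forall x, 0 <= x -> 0 <= f' x) ->
  forall x, 0 <= x -> 0 <= f x.
Proof.
move=> f0 df f'0 x; rewrite le_eqVlt => /orP[/eqP <-|x0]; first by rewrite f0.
have [c] : exists2 c, c \in `]0, x[%R & f x - f 0 = f' c * (x - 0).
  apply: MVT => //; apply: derivable_within_continuous => z _.
  by have [] := df z.
rewrite in_itv/= => /andP[c0 _]; rewrite f0 !subr0 => ->.
by rewrite mulr_ge0 ?f'0// ltW.
Qed.

Lemma sin_le_id x : 0 <= x -> sin x <= x.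
Proof.
have df y : is_derive y 1 (fun z => z - sin z) (1 - cos y).
  by refine (is_deriveB (is_derive_id y 1) (is_derive_sin y)).
move=> x0; rewrite -subr_ge0; move: x x0; apply: (ge0_of_derive _ df).
- by rewrite sin0 subr0.
- by move=> x _; rewrite subr_ge0 cos_le1.
Qed.

Lemma cos_ge_quadratic x : 0 <= x -> 1 - 2^-1 * x ^+ 2 <= cos x.
Proof.
have df y : is_derive y 1 (fun z => cos z - (1 - 2^-1 * z ^+ 2)) (y - sin y).
  have d := is_deriveZ 2^-1 (is_deriveX 2 (is_derive_id y 1)).
  have d' := is_deriveB (is_derive_cos y) (is_deriveB (is_derive_cst (1 : R) y 1) d).
  refine (is_derive_eq d' _).
  by rewrite /GRing.scale/= /id; field.
move=> x0; rewrite -subr_ge0; move: x x0; apply: (ge0_of_derive _ df).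
- by rewrite cos0 expr0n/= mulr0 subr0 subrr.
- by move=> x x0; rewrite subr_ge0 sin_le_id.
Qed.

Lemma sin_ge_cubic x : 0 <= x -> x - 6^-1 * x ^+ 3 <= sin x.
Proof.
have df y : is_derive y 1 (fun z => sin z - (z - 6^-1 * z ^+ 3))
    (cos y - (1 - 2^-1 * y ^+ 2)).
  have d := is_deriveZ 6^-1 (is_deriveX 3 (is_derive_id y 1)).
  have d' := is_deriveB (is_derive_sin y) (is_deriveB (is_derive_id y 1) d).
  refine (is_derive_eq d' _).
  by rewrite /GRing.scale/= /id; field.
move=> x0; rewrite -subr_ge0; move: x x0; apply: (ge0_of_derive _ df).
- by rewrite sin0 expr0n/= mulr0 !subr0.
- by move=> x x0; rewrite subr_ge0 cos_ge_quadratic.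
Qed.

Lemma sin_neq0 x : 0 < x -> x < pi -> sin x != 0.
Proof. by move=> x0 xp; rewrite gt_eqF// sin_gt0_pi// x0. Qed.

(** The cotangent without its pole at 0, which makes it Lipschitz on ]0, pi / 2]. *)
Definition cotr x : R := cos x / sin x - x^-1.

Lemma is_derive_cotr x : 0 < x -> x <= pi / 2 ->
  is_derive x 1 cotr (x ^- 2 - sin x ^- 2).
Proof.
move=> x0 xpi.
have s0 : sin x != 0.
  by apply: sin_neq0 => //; have := @pi_gt0 R; lra.
have x0' : x != 0 by rewrite gt_eqF.
have dV : is_derive x 1 (fun z => (sin z)^-1) (- sin x ^- 2 *: cos x).
  by refine (is_deriveV s0 (is_derive_sin x)).
have dV' : is_derive x 1 (fun z => z^-1) (- x ^- 2 *: 1).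
  by refine (is_deriveV x0' (is_derive_id x 1)).
have dM : is_derive x 1 (fun z => cos z / sin z)
    (cos x *: (- sin x ^- 2 *: cos x) + (sin x)^-1 *: - sin x)
  by refine (is_deriveM (is_derive_cos x) dV).
refine (is_derive_eq (is_deriveB dM dV') _).
rewrite /GRing.scale/= mulr1 opprK mulrN mulVf//.
have -> : cos x * (- sin x ^- 2 * cos x) = - sin x ^- 2 * cos x ^+ 2 by ring.
by rewrite cos2sin2; field; rewrite s0 x0'.
Qed.

(** At an intermediate c the derivative has modulus (c - sin c) (c + sin c) / (c^2 sin^2 c). The
    numerator is at most (c^3 / 6) (2 c) and the denominator at least c^4 / 9, whence the constant
    3. *)
Lemma cotr_lipschitz x y : 0 < x -> x <= y -> y <= pi / 2 ->
  `|cotr y - cotr x| <= 3 * (y - x).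
Proof.
move=> x0; rewrite le_eqVlt => /orP[/eqP <- _|xy yp].
  by rewrite !subrr normr0 mulr0.
have [c] : exists2 c, c \in `]x, y[%R & cotr y - cotr x = (c ^- 2 - sin c ^- 2) * (y - x).
  apply: MVT => //.
    move=> z; rewrite in_itv/= => /andP[xz zy].
    by apply: is_derive_cotr; lra.
  apply: derivable_within_continuous => z; rewrite in_itv/= => /andP[xz zy].
  by have [] : is_derive z 1 cotr (z ^- 2 - sin z ^- 2) by apply: is_derive_cotr; lra.
rewrite in_itv/= => /andP[xc cy] ->.
rewrite normrM (ger0_norm (_ : 0 <= y - x)); last by lra.
apply: ler_wpM2r; first by lra.
have c0 : 0 < c by lra.
have c2 : c <= 2 by have := @pihalf_lt2 R; lra.
have sc := sin_le_id (ltW c0).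
have sc3 := sin_ge_cubic (ltW c0).
(* From c <= 2 the cubic term c^3 / 6 is at most 2 c / 3. *)
have s3 : c / 3 <= sin c.
  apply: le_trans sc3; have : c ^+ 3 <= 4 * c by rewrite exprS; nra.
  lra.
have sp : 0 < sin c by lra.
have e : sin c ^- 2 - c ^- 2 = (c - sin c) * (c + sin c) / (c ^+ 2 * sin c ^+ 2).
  by field; rewrite !gt_eqF.
rewrite distrC e ger0_norm; last first.
  by rewrite divr_ge0// mulr_ge0//; [lra|lra|rewrite exprn_ge0// ltW|rewrite exprn_ge0// ltW].
rewrite ler_pdivrMr; last by rewrite mulr_gt0// exprn_gt0.
have h1 : (c - sin c) * (c + sin c) <= (6^-1 * c ^+ 3) * (2 * c).
  by apply: ler_pM; lra.
have h2 : c ^+ 2 / 9 <= sin c ^+ 2.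
  rewrite (_ : c ^+ 2 / 9 = (c / 3) ^+ 2); last by field.
  by rewrite ler_sqr ?nnegrE; lra.
have h3 : c ^+ 2 * (c ^+ 2 / 9) <= c ^+ 2 * sin c ^+ 2.
  by apply: ler_wpM2l => //; exact: sqr_ge0.
have e2 : (6^-1 * c ^+ 3) * (2 * c) = 3 * (c ^+ 2 * (c ^+ 2 / 9)) by field.
rewrite (le_trans h1)// e2; nra.
Qed.

(* The half-angle formula [2 / sin x = cot (x / 2) + cot ((pi - x) / 2)]. *)
Lemma csc_cotr x : 0 < x < pi ->
  (sin x)^-1 = x^-1 + (pi - x)^-1 + (cotr (x / 2) + cotr ((pi - x) / 2)) / 2.
Proof.
move=> /andP[x0 xpi].
have hs : sin (x / 2) != 0.
  by apply: sin_neq0; lra.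
have hc : cos (x / 2) != 0.
  by rewrite gt_eqF// cos_gt0_pihalf//; apply/andP; split; lra.
have -> : (pi - x) / 2 = pi / 2 - x / 2 by field.
rewrite /cotr.
have -> : cos (pi / 2 - x / 2) = sin (x / 2).
  by rewrite cosB cos_pihalf sin_pihalf mul0r add0r mul1r.
have -> : sin (pi / 2 - x / 2) = cos (x / 2).
  by rewrite sinB cos_pihalf sin_pihalf mul0r subr0 mul1r.
have e : sin x = 2 * sin (x / 2) * cos (x / 2).
  rewrite {1}(_ : x = x / 2 + x / 2); last by field.
  by rewrite sinD; ring.
have h := cos2Dsin2 (x / 2).
have e2 : (sin x)^-1 = (cos (x / 2) / sin (x / 2) + sin (x / 2) / cos (x / 2)) / 2.
  have -> : (cos (x / 2) / sin (x / 2) + sin (x / 2) / cos (x / 2)) / 2 =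
      (cos (x / 2) ^+ 2 + sin (x / 2) ^+ 2) / (2 * sin (x / 2) * cos (x / 2)).
    by field; rewrite hs hc.
  by rewrite h e div1r.
rewrite e2; clear e e2 h; move: (pi) xpi => p xpi; field.
have x0' : x != 0 by rewrite gt_eqF.
have px : p - x != 0 by rewrite gt_eqF// subr_gt0.
by rewrite ?hs ?hc ?x0' ?px.
Qed.

(** Put u = x / 3 and let s1, s2, s3 be the sines of u, u + pi / 3, u + 2 pi / 3. Then sin x = 4 s1
    s2 s3, and clearing denominators leaves 3 / 4 = s2 s3 + s1 (s2 - s3), which holds because s2 -
    s3 = s1. *)
Lemma csc_triple x : 0 < x -> x < pi ->
  3 * (sin x)^-1 = (sin (x / 3))^-1 - (sin ((x + pi) / 3))^-1
                   + (sin ((x + 2 * pi) / 3))^-1.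
Proof.
move=> x0 xpi.
pose a : R := pi / 3; pose u := x / 3.
have triple (z : R) : sin (z + z + z) = sin z * (3 - 4 * sin z ^+ 2).
  rewrite !sinD !cosD.
  transitivity (3 * sin z * cos z ^+ 2 - sin z ^+ 3); first by ring.
  by rewrite cos2sin2; ring.
have triplec (z : R) : cos (z + z + z) = cos z * (4 * cos z ^+ 2 - 3).
  rewrite !cosD !sinD.
  transitivity (cos z ^+ 3 - 3 * cos z * sin z ^+ 2); first by ring.
  by rewrite sin2cos2; ring.
have a3 : a + a + a = pi by rewrite /a; field.
have sa : 0 < sin a.
  by apply: sin_gt0_pi; rewrite /a; have := @pi_gt0 R; lra.
(* The sine and cosine of pi / 3 are read off the triple-angle formulas at a, since 3 a = pi. *)
have h2 : sin a ^+ 2 = 3 / 4.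
  have := triple a; rewrite a3 sinpi => /esym/eqP; rewrite mulf_eq0 gt_eqF//=.
  by rewrite subr_eq0 => /eqP ->; field.
have ca : cos a = 1 / 2.
  have := triplec a; rewrite a3 cospi cos2sin2 h2 => h.
  have : cos a * (-2) = -1 by rewrite h; field.
  by lra.
have s2a : sin (a + a) = sin a by rewrite sinD ca; field.
have c2a : cos (a + a) = - (1 / 2).
  by rewrite cosD ca -(expr2 (sin a)) h2; field.
have u3 : x = u + u + u by rewrite /u; field.
rewrite -/u (_ : (x + pi) / 3 = u + a); last by rewrite /u /a; field.
rewrite (_ : (x + 2 * pi) / 3 = u + (a + a)); last by rewrite /u /a; field.
have s1 : sin u != 0.
  by apply: sin_neq0; rewrite /u; lra.
have s2 : sin (u + a) != 0.
  by apply: sin_neq0; rewrite /u /a; lra.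
have s3 : sin (u + (a + a)) != 0.
  by apply: sin_neq0; rewrite /u /a; lra.
have s4 : sin x != 0.
  by apply: sin_neq0; lra.
have prod : sin (u + a) * sin (u + (a + a)) = (3 - 4 * sin u ^+ 2) / 4.
  rewrite !(sinD u) ca s2a c2a.
  transitivity (cos u ^+ 2 * sin a ^+ 2 - sin u ^+ 2 / 4); first by field.
  by rewrite h2 cos2sin2; field.
have diff : sin (u + a) - sin (u + (a + a)) = sin u.
  by rewrite !(sinD u) ca s2a c2a; field.
have xE : sin x = 4 * (sin u * (sin (u + a) * sin (u + (a + a)))).
  by rewrite prod {1}u3 triple; field.
rewrite xE.
have q : 3 = 4 * (sin (u + a) * sin (u + (a + a))) + 4 * sin u ^+ 2 :> R.
  by rewrite prod; field.
rewrite {1}q -{2}diff.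
move: (sin u) (sin (u + a)) (sin (u + (a + a))) s1 s2 s3 diff => A1 A2 A3 n1 n2 n3 d.
rewrite -d in n1 *; field.
by rewrite ?n1 ?n2 ?n3.
Qed.

End cosecant.

(** * The Euler integral on a half-line and its functional equations *)

Section euler_integral.
Context (R : realType).
Implicit Types (a b x y : R).
Local Notation mu := (@lebesgue_measure R).

(** Nielsen's beta function, the sum of (-1)^n / (a + n). The integral of exp (a y) / (1 + exp y)
    over the line folds at 0 into its values at a and 1 - a. *)
Definition half_int a : \bar R :=
  (\int[mu]_(y in `[0%R, +oo[) (expR (- (a * y)) / (1 + expR (- y)))%:E)%E.

Lemma cvg_exprN_infty a : 0 < a -> expR (- (a * y)) @[y --> +oo] --> 0.
Proof.
move=> a0.
have h : y * a @[y --> +oo] --> +oo by apply: gt0_cvgMly => //; exact: cvg_id.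
have e : (fun y => expR (- (a * y))) = (fun z => expR (- z)) \o (fun y => y * a).
  by apply/funext => y; rewrite /= mulrC.
by rewrite e; apply: cvg_comp h _; exact: cvgr_expR.
Qed.

Lemma integral_expRN a : 0 < a ->
  (\int[mu]_(y in `[0%R, +oo[) (expR (- (a * y)))%:E = (a^-1)%:E)%E.
Proof.
move=> a0.
have dF y : is_derive y 1 (fun y => - a^-1 * expR (- (a * y))) (expR (- (a * y))).
  have d1 := is_deriveN (is_deriveZ a (is_derive_id y 1)).
  have d2 := @is_derive1_comp R (@expR R) (fun z => - (a * z)) y _ _ (is_derive_expR (-
    (a * y))) d1.
  have d3 := is_deriveZ (- a^-1) d2.
  refine (is_derive_eq d3 _).
  by rewrite /GRing.scale/= mulr1; field; rewrite gt_eqF.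
rewrite (@ge0_continuous_FTC2y _ _ (fun y => - a^-1 * expR (- (a * y))) 0 0).
- by rewrite mulr0 oppr0 expR0 mulr1 EFinN oppeK add0e.
- by move=> y _; exact: expR_ge0.
- apply: continuous_subspaceT => y; apply: continuous_comp; last exact: continuous_expR.
  by apply: continuousN; apply: mulrl_continuous.
- rewrite -[X in _ --> X](mulr0 (- a^-1)); apply: cvgMr; exact: cvg_exprN_infty.
- by move=> y _; have [] := dF y.
- have [+ _] := dF 0 => /derivable1_diffP/differentiable_continuous; exact: cvg_at_right_filter.
- by move=> y _; rewrite derive1E; exact: derive_val.
Qed.

(** Lebesgue measure is c times its image under x -> c x, by uniqueness, since both measure
    half-open intervals alike. *)
Lemma integral_scale (c : R) (f : R -> \bar R) : 0 < c ->
    measurable_fun setT f -> (forall x, (0 <= f x)%E) ->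
  (\int[mu]_x f x = c%:E * \int[mu]_x f (c * x)%R)%E.
Proof.
move=> c0 mf f0.
pose phi : measurableTypeR R -> measurableTypeR R := fun x => c * x.
have mM : measurable_fun setT phi by apply: measurable_funM => //; exact: measurable_cst.
have mf' : measurable_fun (setT : set (measurableTypeR R)) f by exact: mf.
have e1 := @ge0_integral_pushforward _ _ _ _ _ _ mM mu setT f measurableT mf' (fun y _ => f0 y).
rewrite preimage_setT in e1; rewrite -[X in (_ * X)%E]e1.
rewrite -[RHS](@ge0_integral_mscale _ _ _ _ _ measurableT (NngNum (ltW c0)))//.
apply: eq_measure_integral => A mA _; apply: lebesgue_measure_unique => // _ [[u v]] _ <-.
rewrite /= /mscale/= /pushforward.
have -> : (fun x => c * x) @^-1` `]u, v] = `]u / c, v / c]%classic.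
  by apply/seteqP; split => x /=; rewrite !in_itv/= ltr_pdivrMr// ler_pdivlMr// mulrC.
rewrite !lebesgue_measure_itv/= !lte_fin ltr_pM2r ?invr_gt0//.
case: ifPn => _; last by rewrite mule0.
by rewrite -!EFinB -EFinM; congr EFin; field; rewrite gt_eqF.
Qed.

Lemma integral_scale_ge0 (c : R) (f : R -> \bar R) : 0 < c ->
    measurable_fun setT f -> (forall x, (0 <= f x)%E) ->
  (\int[mu]_(x in `[0%R, +oo[) f x = c%:E * \int[mu]_(x in `[0%R, +oo[) f (c * x)%R)%E.
Proof.
move=> c0 mf f0; rewrite integral_mkcond (@integral_scale c)//.
- congr (_ * _)%E; rewrite [RHS]integral_mkcond; apply: eq_integral => x _.
  by rewrite !patchE !mem_setE !in_itv/= !andbT pmulr_rge0.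
- by apply/(measurable_restrictT _ _).1 => //; exact: measurable_funTS.
- by move=> x; rewrite patchE; case: ifPn.
Qed.

Lemma measurable_half_int a :
  measurable_fun setT (fun y => (expR (- (a * y)) / (1 + expR (- y)))%:E : \bar R).
Proof.
apply/measurable_EFinP; apply: continuous_measurable_fun => y.
apply: cvgM.
  apply: continuous_comp; last exact: continuous_expR.
  by apply: continuousN; apply: mulrl_continuous.
apply: cvgV; first by rewrite gt_eqF// addr_gt0// expR_gt0.
apply: cvgD; first exact: cvg_cst.
apply: continuous_comp; last exact: continuous_expR.
exact: continuousN.
Qed.

Lemma half_int_ge0 a : (0 <= half_int a)%E.
Proof.
by apply: integral_ge0 => y _; rewrite lee_fin divr_ge0 ?expR_ge0// addr_ge0// expR_ge0.
Qed.

(** The numerators add up to exp (- a y) (1 + exp (- y)), which cancels the denominator. *)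
Lemma half_int_recurrence a : 0 < a -> (half_int a + half_int (a + 1) = (a^-1)%:E)%E.
Proof.
move=> a0; rewrite /half_int -ge0_integralD//.
- rewrite -integral_expRN//; apply: eq_integral => y _; congr EFin.
  rewrite mulrDl mul1r opprD expRD; field.
  by rewrite gt_eqF// addr_gt0// expR_gt0.
- apply: measurable_funTS; exact: measurable_half_int.
- apply: measurable_funTS; exact: measurable_half_int.
Qed.

Lemma half_int_fin a : 0 < a -> half_int a \is a fin_num.
Proof.
move=> a0; rewrite ge0_fin_numE ?half_int_ge0//.
apply: (@le_lt_trans _ _ (a^-1)%:E); last exact: ltry.
by rewrite -half_int_recurrence// leeDl// half_int_ge0.
Qed.

Let integralD_EFin (f g : R -> R) :
    measurable_fun setT f -> measurable_fun setT g ->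
    (forall y, 0 <= f y) -> (forall y, 0 <= g y) ->
  (\int[mu]_(y in `[0%R, +oo[) (f y)%:E + \int[mu]_(y in `[0%R, +oo[) (g y)%:E =
   \int[mu]_(y in `[0%R, +oo[) (f y + g y)%:E)%E.
Proof.
move=> mf mg f0 g0; rewrite -ge0_integralD//.
- by move=> y _; rewrite lee_fin.
- by apply: measurable_funTS; apply/measurable_EFinP.
- by move=> y _; rewrite lee_fin.
- by apply: measurable_funTS; apply/measurable_EFinP.
Qed.

(** After the scaling y -> 3 y and with q = exp (- y), this is (1 - q + q^2) / (1 + q^3) = 1 / (1 +
    q), written without subtraction for extended reals. *)
Lemma half_int_triple a : 0 < a ->
  (half_int (a / 3) + half_int ((a + 2) / 3) =
   3%:E * half_int a + half_int ((a + 1) / 3))%E.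
Proof.
move=> a0.
pose F b y : R := expR (- (b * y)) / (1 + expR (- (3 * y))).
have mF b : measurable_fun setT (F b).
  apply: continuous_measurable_fun => y; apply: cvgM.
    apply: continuous_comp; last exact: continuous_expR.
    by apply: continuousN; apply: mulrl_continuous.
  apply: cvgV; first by rewrite gt_eqF// addr_gt0// expR_gt0.
  apply: cvgD; first exact: cvg_cst.
  apply: continuous_comp; last exact: continuous_expR.
  by apply: continuousN; apply: mulrl_continuous.
have F0 b y : 0 <= F b y by rewrite divr_ge0 ?expR_ge0// addr_ge0// expR_ge0.
pose I b : \bar R := (\int[mu]_(y in `[0%R, +oo[) (F b y)%:E)%E.
have I0 b : (0 <= I b)%E by apply: integral_ge0 => y _; rewrite lee_fin.
have s b : half_int (b / 3) = (3%:E * I b)%E.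
  rewrite /half_int /I (@integral_scale_ge0 3 _ _ (measurable_half_int _)) //.
  by congr mule; apply: eq_integral => y _; congr EFin; congr (expR (- _) / _); field.
have key : (I a + I (a + 2)%R = half_int a + I (a + 1)%R)%E.
  rewrite /half_int /I integralD_EFin// integralD_EFin//; last first.
    by have /measurable_EFinP := measurable_half_int a.
  apply: eq_integral => y _; congr EFin; rewrite /F.
  have e3 : expR (- (3 * y)) = expR (- y) ^+ 3.
    by rewrite -expRM_natl mulrN mulrC.
  rewrite e3 (mulrDl a 2) (mulrDl a 1) mul1r !opprD !expRD.
  rewrite (_ : - (2 * y) = - y + - y); last by ring.
  rewrite expRD.
  have q0 : 0 < expR (- y) by exact: expR_gt0.
  move: (expR (- y)) q0 (expR (- (a * y))) => q q0 A.
  by field; rewrite !gt_eqF//= ?addr_gt0// exprn_gt0.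
have H0 := half_int_ge0 a.
rewrite !s; move: (half_int a) H0 (I a) (I (a + 1)) (I (a + 2)) (I0 a) (I0 (a + 1)) (I0
  (a + 2)) key.
move=> H H0 I1 I2 I3 p1 p2 p3 key.
by rewrite -ge0_muleDr// key ge0_muleDr.
Qed.

Lemma half_int_anti a b : a <= b -> (half_int b <= half_int a)%E.
Proof.
move=> ab; apply: ge0_le_integral => //.
- by apply: measurable_funTS; exact: measurable_half_int.
- by apply: measurable_funTS; exact: measurable_half_int.
- move=> y; rewrite /= in_itv/= andbT => y0; rewrite lee_fin ler_pM2r.
    by rewrite ler_expR lerN2 ler_wpM2r.
  by rewrite invr_gt0 addr_gt0// expR_gt0.
Qed.

(** The integrands differ by at most (b - a) y exp (- a y), and a >= 1 bounds this by (b - a) y exp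
    (- y) <= 2 (b - a) exp (- y / 2), of integral 4 (b - a). *)
Lemma half_int_lipschitz a b : 1 <= a -> a <= b ->
  (half_int a <= half_int b + (4 * (b - a))%:E)%E.
Proof.
move=> a1 ab.
have -> : (4 * (b - a))%:E =
    (\int[mu]_(y in `[0%R, +oo[) ((2 * (b - a))%:E * (expR (- (2^-1 * y)))%:E))%E.
  rewrite ge0_integralZl//.
  - by rewrite integral_expRN// -EFinM; congr EFin; field.
  - apply: measurable_funTS; apply/measurable_EFinP; apply: continuous_measurable_fun => y.
    apply: continuous_comp; last exact: continuous_expR.
    by apply: continuousN; apply: mulrl_continuous.
  - by rewrite lee_fin mulr_ge0// subr_ge0.
rewrite /half_int -ge0_integralD//; last 3 first.
- by apply: measurable_funTS; exact: measurable_half_int.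
- by move=> y _; rewrite -EFinM lee_fin mulr_ge0 ?expR_ge0// mulr_ge0// subr_ge0.
- apply: measurable_funTS; apply: measurable_funeM; apply/measurable_EFinP.
  apply: continuous_measurable_fun => y.
  apply: continuous_comp; last exact: continuous_expR.
  by apply: continuousN; apply: mulrl_continuous.
apply: ge0_le_integral => //.
- by apply: measurable_funTS; exact: measurable_half_int.
- apply: emeasurable_funD; first by apply: measurable_funTS; exact: measurable_half_int.
  apply: measurable_funTS; apply: measurable_funeM; apply/measurable_EFinP.
  apply: continuous_measurable_fun => y.
  apply: continuous_comp; last exact: continuous_expR.
  by apply: continuousN; apply: mulrl_continuous.
move=> y; rewrite /= in_itv/= andbT => y0.
rewrite -EFinM -EFinD lee_fin.
have q0 := expR_gt0 (- y).
have e1 : expR (- (b * y)) = expR (- (a * y)) * expR (- ((b - a) * y)).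
  by rewrite -expRD; congr expR; ring.
have h1 : 1 - (b - a) * y <= expR (- ((b - a) * y)) by exact: expR_ge1Dx.
have h2 : expR (- (a * y)) <= expR (- y).
  by rewrite ler_expR lerN2 -[leLHS]mul1r ler_wpM2r.
have h3 : y * expR (- y) <= 2 * expR (- (2^-1 * y)).
  have -> : expR (- y) = expR (- (2^-1 * y)) * expR (- (2^-1 * y)).
    by rewrite -expRD; congr expR; field.
  rewrite mulrA ler_wpM2r ?expR_ge0//.
  have h : y / 2 <= expR (2^-1 * y).
    by apply: le_trans (expR_ge1Dx _); lra.
  rewrite expRN ler_pdivrMr ?expR_gt0//; lra.
rewrite -lerBlDl -mulrBl ler_pdivrMr ?addr_gt0//.
have A0 := expR_ge0 (- (a * y)).
have B0 := expR_ge0 (- (2^-1 * y)).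
apply: (@le_trans _ _ (expR (- (a * y)) * ((b - a) * y))).
  by rewrite e1 -[X in X - _]mulr1 -mulrBr ler_wpM2l//; lra.
apply: (@le_trans _ _ (expR (- y) * ((b - a) * y))).
  by rewrite ler_wpM2r// mulr_ge0// subr_ge0.
apply: (@le_trans _ _ (2 * (b - a) * expR (- (2^-1 * y)))).
  have ba : 0 <= b - a by rewrite subr_ge0.
  have := ler_wpM2l ba h3; lra.
rewrite -[leLHS]mulr1 ler_wpM2l ?lerDl ?expR_ge0// mulr_ge0// mulr_ge0// subr_ge0//.
Qed.

End euler_integral.

(* A function satisfying the recurrence, the triplication formula and the
   Lipschitz bound below satisfies the reflection formula: the error in the
   latter is Lipschitz and three times it is an alternating sum of its values
   at three points that are three times closer. *)
Section reflection.
Context (R : realType) (k : R -> R).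
Implicit Types a b : R.
Hypothesis k_recurrence : forall a, 0 < a -> k a = a^-1 - k (a + 1).
Hypothesis k_triple : forall a, 0 < a ->
  3 * k a = k (a / 3) - k ((a + 1) / 3) + k ((a + 2) / 3).
Hypothesis k_lipschitz : forall a b, 1 <= a -> 1 <= b ->
  `|k a - k b| <= 4 * `|a - b|.

Let h a : R := k a + k (1 - a) - pi / sin (pi * a).

(** Triplication at 1 - a involves the reflections of the three points for a in reverse order, and
    the signs +, -, + are symmetric; [csc_triple] provides the third summand. *)
Let h_triple a : 0 < a < 1 -> 3 * h a = h (a / 3) - h ((a + 1) / 3) + h ((a + 2) / 3).
Proof.
move=> /andP[a0 a1]; rewrite /h.
have b0 : 0 < 1 - a by lra.
have p0 := @pi_gt0 R.
have := k_triple a0; have := k_triple b0.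
have := @csc_triple R (pi * a).
rewrite (_ : 0 < pi * a = true); last by rewrite mulr_gt0.
rewrite (_ : pi * a < pi = true); last by rewrite -[ltRHS]mulr1 ltr_pM2l.
move=> /(_ isT isT).
rewrite (_ : (1 - a) / 3 = 1 - (a + 2) / 3); last by field.
rewrite (_ : (1 - a + 1) / 3 = 1 - (a + 1) / 3); last by field.
rewrite (_ : (1 - a + 2) / 3 = 1 - a / 3); last by field.
rewrite (_ : pi * a / 3 = pi * (a / 3)); last by field.
rewrite (_ : (pi * a + pi) / 3 = pi * ((a + 1) / 3)); last by field.
rewrite (_ : (pi * a + 2 * pi) / 3 = pi * ((a + 2) / 3)); last by field.
move=> e1 e2 e3.
have := congr1 (fun z => pi * z) e1; rewrite /=.
move: (sin _)^-1 (sin _)^-1 (sin _)^-1 (sin _)^-1 => A1 A2 A3 A4 e4.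
lra.
Qed.

(** The recurrence isolates the poles a^-1 and (1 - a)^-1 of the terms in k, and [csc_cotr] the same
    poles of pi / sin (pi a). They cancel, and only Lipschitz terms remain: 4 + 4 from k, and twice
    (pi / 2) (3 pi / 2) from [cotr]. *)
Let h_lipschitz : exists2 C, 0 <= C & forall a b, 0 < a < 1 -> 0 < b < 1 ->
  `|h a - h b| <= C * `|a - b|.
Proof.
have p0 := @pi_gt0 R.
have hE a : 0 < a < 1 -> h a = - k (a + 1) - k ((1 - a) + 1)
    - pi / 2 * (cotr (pi * a / 2) + cotr (pi * (1 - a) / 2)).
  move=> /andP[a0 a1]; rewrite /h (k_recurrence a0) (@k_recurrence (1 - a)); last by lra.
  rewrite (@csc_cotr R (pi * a)); last first.
    by rewrite mulr_gt0//= -[ltRHS]mulr1 ltr_pM2l.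
  rewrite (_ : pi - pi * a = pi * (1 - a)); last by ring.
  move: (k _) (k _) (cotr _) (cotr _) => A1 A2 A3 A4.
  move: (pi) p0 => p p0.
  by field; rewrite !gt_eqF//; lra.
have cl a b : 0 < a < 1 -> 0 < b < 1 ->
    `|cotr (pi * a / 2) - cotr (pi * b / 2)| <= 3 * pi / 2 * `|a - b|.
  wlog ab : a b / b <= a.
    move=> H a1 b1; have [ab|/ltW ba] := leP b a; first exact: H.
    by rewrite distrC (distrC a); exact: H.
  move=> /andP[a0 a1] /andP[b0 b1].
  rewrite [`|a - b|]ger0_norm ?subr_ge0//.
  apply: (le_trans (@cotr_lipschitz R (pi * b / 2) (pi * a / 2) _ _ _)).
  - by rewrite divr_gt0// mulr_gt0.
  - by rewrite ler_pM2r// ler_pM2l.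
  - by rewrite ler_pM2r// -[leRHS]mulr1 ler_pM2l// ltW.
  - by rewrite le_eqVlt; apply/orP; left; apply/eqP; field.
exists (8 + 3 * pi ^+ 2 / 2); first by rewrite addr_ge0// divr_ge0// mulr_ge0// sqr_ge0.
move=> a b /[dup] a01 /andP[a0 a1] /[dup] b01 /andP[b0 b1].
rewrite !hE//.
have a01' : 0 < 1 - a < 1 by apply/andP; split; lra.
have b01' : 0 < 1 - b < 1 by apply/andP; split; lra.
have l1 : `|k (a + 1) - k (b + 1)| <= 4 * `|a - b|.
  have := @k_lipschitz (a + 1) (b + 1); rewrite (_ : a + 1 - (b + 1) = a - b); last by ring.
  by apply; lra.
have l2 : `|k (1 - a + 1) - k (1 - b + 1)| <= 4 * `|a - b|.
  have := @k_lipschitz (1 - a + 1) (1 - b + 1).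
  rewrite (_ : 1 - a + 1 - (1 - b + 1) = b - a); last by ring.
  by rewrite (distrC b); apply; lra.
have l3 := cl a b a01 b01.
have := cl _ _ a01' b01'.
rewrite (_ : 1 - a - (1 - b) = b - a); last by ring.
rewrite (distrC b) => l4.
move: l1 l2 l3 l4.
move: (k _) (k _) (k _) (k _) (cotr _) (cotr _) (cotr _) (cotr _) => A1 A2 A3 A4 B1 B2 B3 B4.
move: (`|a - b|) => D l1 l2 l3 l4.
rewrite [X in `|X| <= _](_ :
  _ = (A1 - A2) + (A3 - A4) + (pi / 2 * (B3 - B4) + pi / 2 * (B1 - B2))); last by ring.
have n1 (u v : R) : `|pi / 2 * (u - v)| = pi / 2 * `|v - u|.
  by rewrite normrM ger0_norm ?divr_ge0 ?ltW// distrC.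
apply: (le_trans (ler_normD _ _)); apply: (le_trans (lerD (ler_normD _ _) (ler_normD _ _))).
rewrite !n1 (distrC A1) (distrC A3).
have p2 : 0 <= pi / 2 :> R by rewrite divr_ge0 ?ltW.
have := ler_wpM2l p2 l3; have := ler_wpM2l p2 l4.
rewrite expr2; lra.
Qed.

(** In [h_triple] each of the three differences is taken at points three times closer, so every
    iteration gains a factor 3: 3^n |h a - h b| stays below C |a - b| for all n. *)
Let h_constant a b : 0 < a < 1 -> 0 < b < 1 -> h a = h b.
Proof.
move=> a01 b01; have [C C0 hC] := h_lipschitz.
have contr n : forall a b, 0 < a < 1 -> 0 < b < 1 ->
    3 ^+ n * `|h a - h b| <= C * `|a - b|.
  elim: n => [|n IH] {a01 b01} {}a {}b a01 b01; first by rewrite expr0 mul1r hC.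
  have /andP[a0 a1] := a01; have /andP[b0 b1] := b01.
  have i (j : R) : 0 <= j <= 2 -> 0 < (a + j) / 3 < 1 /\ 0 < (b + j) / 3 < 1.
    by move=> /andP[j0 j2]; split; apply/andP; split; lra.
  have s (j : R) : 0 <= j <= 2 ->
      3 ^+ n * `|h ((a + j) / 3) - h ((b + j) / 3)| <= C * `|a - b| / 3.
    move=> /i[i1 i2]; apply: (le_trans (IH _ _ i1 i2)).
    rewrite (_ : (a + j) / 3 - (b + j) / 3 = (a - b) / 3); last by field.
    by rewrite normrM (@ger0_norm _ 3^-1) ?invr_ge0// mulrA.
  have e1 := h_triple a01; have e2 := h_triple b01.
  have s0 : 3 ^+ n * `|h (a / 3) - h (b / 3)| <= C * `|a - b| / 3.
    by have := s 0; rewrite !addr0; apply; rewrite lexx ler0n.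
  have s1 := s 1; rewrite ler01 ler1n/= in s1; have {}s1 := s1 isT.
  have s2 := s 2; rewrite ler0n lexx/= in s2; have {}s2 := s2 isT.
  rewrite exprSr -mulrA -[X in _ * (X * _)]ger0_norm// -normrM mulrBr e1 e2.
  rewrite (_ : _ - _ = (h (a / 3) - h (b / 3)) - (h ((a + 1) / 3) - h ((b + 1) / 3))
    + (h ((a + 2) / 3) - h ((b + 2) / 3))); last by ring.
  apply: (@le_trans _ _ (3 ^+ n * (`|h (a / 3) - h (b / 3)| +
    `|h ((a + 1) / 3) - h ((b + 1) / 3)| + `|h ((a + 2) / 3) - h ((b + 2) / 3)|))).
    rewrite ler_wpM2l ?exprn_ge0//; apply: (le_trans (ler_normD _ _)).
    by rewrite lerD2r; apply: (le_trans (ler_normB _ _)).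
  rewrite !mulrDr; lra.
apply/eqP; rewrite -subr_eq0 -normr_eq0; apply/negPn/negP => n0.
have D0 : 0 < `|h a - h b| by rewrite lt_neqAle eq_sym n0/=.
pose n := (Num.truncn (C * `|a - b| / `|h a - h b|)).+1.
have := contr n a b a01 b01; rewrite -ler_pdivlMr//; apply/negP; rewrite -ltNge.
apply: (@lt_le_trans _ _ n%:R); first exact: truncnS_gt.
by rewrite -natrX ler_nat ltnW// ltn_expl.
Qed.

Lemma reflection_formula a : 0 < a < 1 -> k a + k (1 - a) = pi / sin (pi * a).
Proof.
move=> /[dup] a01 /andP[a0 a1].
have c1 : 0 < a / 3 < 1 by apply/andP; split; lra.
have c2 : 0 < (a + 1) / 3 < 1 by apply/andP; split; lra.
have c3 : 0 < (a + 2) / 3 < 1 by apply/andP; split; lra.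
(* For a constant h triplication reads 3 h = h - h + h, so h = 0. *)
have := h_triple a01; rewrite (h_constant c1 a01) (h_constant c2 a01) (h_constant c3 a01).
move=> e; have : h a = 0 by lra.
by move/subr0_eq.
Qed.

End reflection.

Section euler_reflection.
Context (R : realType).
Implicit Types a b : R.

Lemma half_int_reflection a : 0 < a < 1 ->
  (half_int a + half_int (1 - a) = (pi / sin (pi * a))%:E)%E.
Proof.
move=> /[dup] a01 /andP[a0 a1].
have b0 : 0 < 1 - a by lra.
have [k kE] : {k : R -> R | forall b, 0 < b -> half_int b = (k b)%:E}.
  by exists (fun b => fine (half_int b)) => b b0'; rewrite fineK// half_int_fin.
rewrite !kE// -EFinD; congr EFin; apply: reflection_formula => //.
- move=> b b0'; have := half_int_recurrence b0'.
  have b1 : 0 < b + 1 by rewrite addr_gt0.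
  by rewrite (kE _ b0') (kE _ b1) -EFinD => -[<-]; rewrite addrK.
- move=> b b0'; have := half_int_triple b0'.
  have f1 : 0 < b / 3 by lra.
  have f2 : 0 < (b + 1) / 3 by lra.
  have f3 : 0 < (b + 2) / 3 by lra.
  rewrite (kE _ b0') (kE _ f1) (kE _ f2) (kE _ f3) -EFinM -!EFinD => -[]; lra.
- move=> b c; wlog bc : b c / b <= c.
    move=> H b1 c1; have [bc|/ltW cb] := leP b c; first exact: H.
    by rewrite distrC (distrC b); exact: H.
  move=> b1 c1.
  have b0' : 0 < b by lra.
  have c0 : 0 < c by lra.
  have := half_int_anti bc; have := half_int_lipschitz b1 bc.
  rewrite (kE _ b0') (kE _ c0) -EFinD !lee_fin => h1 h2.
  rewrite ger0_norm; last by lra.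
  rewrite ler0_norm; last by lra.
  lra.
Qed.

End euler_reflection.

(** * Polar coordinates and the integrals H0 and H1 *)

Section polar_coordinates.
Context (R : realType).

Lemma measurable_sqrtr : measurable_fun setT (@Num.sqrt R).
Proof. by apply: continuous_measurable_fun; exact: sqrt_continuous. Qed.

Local Notation leb := (@lebesgue_measure R).
Local Notation rT := (measurableTypeR R).
Local Open Scope ereal_scope.

Lemma ge0_integral_fold (f : R -> \bar R) : measurable_fun setT f ->
    (forall x, 0 <= f x) ->
  \int[leb]_x f x =
  \int[leb]_(x in `[0%R, +oo[) f (- x)%R + \int[leb]_(x in `[0%R, +oo[) f x.
Proof.
move=> mf f0.
rewrite (_ : setT = `]-oo, 0%R] `|` `]0%R, +oo[); last first.
  by rewrite -set_itvNyy; apply/seteqP; split => x //= _; rewrite !in_itv/= andbT; case: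
    (leP x 0%R); [left|right].
rewrite ge0_integral_setU//; last 2 first.
- by apply: measurable_funS mf.
- rewrite disj_set2E; apply/eqP/seteqP; split => x //=.
  by rewrite !in_itv/= andbT => -[x0 /(le_lt_trans x0)]; rewrite ltxx.
rewrite integral_itv_obnd_cbnd; last by apply: measurable_funS mf.
have mfN : measurable_fun setT (fun x : R => f (- x)%R) by apply: measurableT_comp.
rewrite (ge0_integration_by_substitution0 mfN (fun x => f0 _)).
by congr (_ + _); apply: eq_integral => x _; rewrite opprK.
Qed.

Lemma ge0_even_integral (f : R -> \bar R) : measurable_fun setT f ->
    (forall x, 0 <= f x) -> (forall x, f (- x)%R = f x) ->
  \int[leb]_x f x = 2%:E * \int[leb]_(x in `[0%R, +oo[) f x.
Proof.
move=> mf f0 fN; rewrite ge0_integral_fold//.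
under eq_integral do rewrite fN.
by rewrite [in RHS](_ : 2%:E = 1 + 1)// ge0_muleDl// mul1e.
Qed.

Lemma measurable_enorm : measurable_fun setT (@enorm R).
Proof.
apply: measurableT_comp; first exact: measurable_sqrtr.
apply: measurable_funD; apply: measurable_funX; [exact: measurable_fst|exact: measurable_snd].
Qed.

(** The slope replaces the angle: y = |x| w gives the norm |x| sqrt (1 + w^2). After exchanging the
    integrals, scaling x by the inverse of this root leaves the factor 1 / (1 + w^2), whose integral
    over the line is pi; the two signs of x give the factor 2. *)
Lemma ge0_polar (q : R -> \bar R) : measurable_fun setT q -> (forall x, 0 <= q x) ->
  \int[@plane_measure R]_z q (enorm z) =
  (2 * pi)%:E * \int[leb]_(x in `[0%R, +oo[) (x%:E * q x).
Proof.
move=> mq q0.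
pose s (w : R) : R := Num.sqrt (oneDsqr w).
have o0 w : (0 < oneDsqr w :> R)%R by rewrite (lt_le_trans ltr01)// oneDsqr_ge1.
have s0 w : (0 < s w)%R by rewrite sqrtr_gt0.
have ms : measurable_fun setT s.
  apply: measurableT_comp; first exact: measurable_sqrtr.
  by apply: continuous_measurable_fun; exact: continuous_oneDsqr.
have mqn : measurable_fun (setT : set (rT * rT)) (fun z => q (enorm z)).
  by apply: measurableT_comp => //; exact: measurable_enorm.
pose k (z : rT * rT) : \bar R := `|z.1|%:E * q (`|z.1| * s z.2)%R.
have k0 z : 0 <= k z by rewrite /k mule_ge0 ?lee_fin.
have mk : measurable_fun setT k.
  have m1 : measurable_fun (setT : set (rT * rT)) (fun z : rT * rT => `|z.1|%R).
    by apply: measurableT_comp => //; exact: measurable_fst.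
  apply: emeasurable_funM; first exact/measurable_EFinP.
  apply: measurableT_comp => //; apply: measurable_funM => //.
  by apply: measurableT_comp => //; exact: measurable_snd.
have mG : measurable_fun setT (fun x : R => `|x|%:E * q `|x|%R).
  apply: emeasurable_funM; first exact/measurable_EFinP.
  by apply: measurableT_comp => //.
have G0 x : 0 <= `|x|%:E * q `|x|%R by rewrite mule_ge0 ?lee_fin.
transitivity (\int[leb]_x \int[leb]_y k (x, y)).
  rewrite [LHS](@fubini_tonelli1 _ _ _ _ _ leb leb _ mqn (fun z => q0 _)).
  apply: ge0_ae_eq_integral => //.
  - exact: (@measurable_fun_fubini_tonelli_F _ _ _ _ _ leb _ mqn (fun z => q0 _)).
  - exact: (@measurable_fun_fubini_tonelli_F _ _ _ _ _ leb _ mk k0).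
  - by move=> x _; apply: integral_ge0.
  - by move=> x _; apply: integral_ge0.
  (* The substitution degenerates on the axis x = 0 only, which is negligible. *)
  exists [set 0%R]; split => //; first exact: lebesgue_measure_set1.
  move=> x /= H; apply: contrapT => /eqP x0; apply: H => _.
  have nx : (0 < `|x|)%R by rewrite normr_gt0.
  rewrite /fubini_F (@integral_scale _ `|x|%R)//; last first.
    exact: (measurable_fun_pair2 x mqn).
  rewrite -ge0_integralZl//; last 2 first.
  - apply: eq_integral => y _; rewrite /k/=; congr (_ * q _).
    rewrite /enorm /= exprMn -normrX ger0_norm ?sqr_ge0// -{1}[(x ^+ 2)%R]mulr1 -mulrDr.
    by rewrite sqrtrM ?sqr_ge0// sqrtr_sqr.
  - apply: measurableT_comp (measurable_fun_pair2 x mqn) _.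
    exact: measurable_funM.
rewrite (@fubini_tonelli _ _ _ _ _ leb leb _ mk k0).
transitivity (\int[leb]_w ((oneDsqr w)^-1%:E * \int[leb]_x (`|x|%:E * q `|x|%R))).
  apply: eq_integral => w _.
  have sw0 : (0 < (s w)^-1)%R by rewrite invr_gt0.
  rewrite [in LHS](@integral_scale _ (s w)^-1 (fun x => k (x, w)))//; last first.
    exact: (measurable_fun_pair1 w mk).
  rewrite -[LHS]ge0_integralZl//; last 2 first.
  - apply: measurableT_comp (measurable_fun_pair1 w mk) _.
    exact: measurable_funM.
  - by rewrite lee_fin ltW.
  rewrite -[RHS]ge0_integralZl//.
  apply: eq_integral => x _; rewrite /k/= normrM (gtr0_norm sw0) !muleA.
  rewrite -!EFinM; congr (_%:E * q _).
    by rewrite mulrA -expr2 exprVn sqr_sqrtr// ltW.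
  by rewrite mulrC mulrA divff ?mul1r// gt_eqF.
rewrite ge0_integralZr//; last 2 first.
- apply/measurable_EFinP; apply: continuous_measurable_fun; exact: continuous_oneDsqrV.
- exact: integral_ge0.
rewrite (@ge0_even_integral (fun w : R => (oneDsqr w)^-1%:E)); last 3 first.
- apply/measurable_EFinP; apply: continuous_measurable_fun; exact: continuous_oneDsqrV.
- by move=> w; rewrite lee_fin invr_ge0 ltW.
- by move=> w; rewrite /oneDsqr sqrrN.
rewrite integral0y_oneDsqr ge0_even_integral//; last first.
  by move=> x; rewrite normrN.
rewrite muleA -!EFinM; congr (_%:E * _); first by field.
by apply: eq_integral => x; rewrite inE/= in_itv/= andbT => x0; rewrite ger0_norm.
Qed.

End polar_coordinates.

(** * The radial integral that produces [kappa] *)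

Section kappa_integral.
Context (R : realType).
Local Notation leb := (@lebesgue_measure R).
Local Open Scope ereal_scope.

(** The substitution t = exp y is made on the compact intervals [exp (- n), exp n], and both sides
    increase to the full integrals. *)
Lemma ge0_integral_exp_substitution (G : R -> R) :
    {in `]0%R, +oo[, continuous G} -> (forall x, 0 <= G x)%R ->
  \int[leb]_(t in `]0%R, +oo[) (G t)%:E = \int[leb]_y (G (expR y) * expR y)%:E.
Proof.
move=> cG G0.
have mG : measurable_fun (`]0%R, +oo[ : set R) G.
  by apply: open_continuous_measurable_fun => //; exact/in_continuous_mksetP.
have cGe : continuous (fun y => G (expR y) * expR y)%R.
  move=> y; apply: cvgM; last exact: continuous_expR.
  by apply: continuous_comp; [exact: continuous_expR|apply: cG; rewrite in_itv/= expR_gt0].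
pose A n := `[expR (- n%:R), expR (n%:R : R)]%classic.
pose B n := `[(- n%:R)%R, (n%:R : R)]%classic.
have nA : nondecreasing_seq A.
  move=> m n mn; apply/subsetPset => x; rewrite /A/= !in_itv/= => /andP[a b].
  by rewrite (le_trans _ a) ?(le_trans b)// ler_expR ?lerN2 ler_nat.
have nB : nondecreasing_seq B.
  move=> m n mn; apply/subsetPset => x; rewrite /B/= !in_itv/= => /andP[a b].
  by rewrite (le_trans _ a) ?(le_trans b)// ?lerN2 ler_nat.
have UB : \bigcup_n B n = setT.
  apply/seteqP; split => // x _; exists (Num.bound x) => //; rewrite /B/= in_itv/= -ler_norml.
  exact/ltW/unstable.ltr_norm_bound.
have UA : \bigcup_n A n = `]0%R, +oo[%classic.
  apply/seteqP; split => x /=.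
    move=> [n _]; rewrite /A/= !in_itv/= andbT => /andP[a _].
    by apply: lt_le_trans a; rewrite expR_gt0.
  rewrite in_itv/= andbT => x0.
  have : setT (ln x) by [].
  rewrite -UB => -[n _]; rewrite /B/= in_itv/= => /andP[a b].
  by exists n => //; rewrite /A/= in_itv/= -[x]lnK ?posrE// !ler_expR a.
have AB n : \int[leb]_(t in A n) (G t)%:E = \int[leb]_(y in B n) (G (expR y) * expR y)%:E.
  have D1 : derive1 (@expR R) = @expR R.
    by apply/funext => y; rewrite derive1E; exact: derive_val.
  rewrite /A integration_by_substitution_increasing.
  - by apply: eq_integral => y _; rewrite D1.
  - by rewrite lerNl (le_trans _ (ler0n _ _))// oppr_le0.
  - by move=> x y _ _ xy; rewrite ltr_expR.
  - by rewrite D1 => y _; exact: continuous_expR.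
  - rewrite D1; apply/cvg_ex; eexists; apply: cvg_at_right_filter; exact: continuous_expR.
  - rewrite D1; apply/cvg_ex; eexists; apply: cvg_at_left_filter; exact: continuous_expR.
  - split; first by move=> x _; exact: derivable_expR.
      by apply: cvg_at_right_filter; exact: continuous_expR.
    by apply: cvg_at_left_filter; exact: continuous_expR.
  - apply: continuous_in_subspaceT => x; rewrite inE/= in_itv/= => /andP[a _].
    by apply: cG; rewrite in_itv/= andbT (lt_le_trans _ a)// expR_gt0.
have c1 : \int[leb]_(t in A n) (G t)%:E @[n --> \oo] --> \int[leb]_(t in `]0%R, +oo[) (G t)%:E.
  rewrite -UA; apply: ge0_nondecreasing_set_cvg_integral => //.
  - by move=> n; exact: measurable_itv.
  - move=> n; apply/measurable_EFinP; apply: measurable_funS mG => //.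
    by rewrite -UA; exact: bigcup_sup.
  - by move=> n x _; rewrite lee_fin.
have c2 : \int[leb]_(y in B n) (G (expR y) * expR y)%:E @[n --> \oo] -->
    \int[leb]_y (G (expR y) * expR y)%:E.
  rewrite -[in X in _ --> X]UB; apply: ge0_nondecreasing_set_cvg_integral => //.
  - by move=> n; exact: measurable_itv.
  - move=> n; apply/measurable_EFinP; apply: measurable_funTS.
    exact: continuous_measurable_fun.
  - by move=> n x _; rewrite lee_fin mulr_ge0 ?expR_ge0.
rewrite (funext AB) in c1.
exact: (cvg_unique _ c1 c2).
Qed.

(** On nonnegative x this is the integrand of [H1] for b = beta and of [H0] for b = beta PB / PD;
    the absolute values keep it nonnegative on the whole line, as the scaling lemmas require. *)
Definition ratio_integrand (alpha b x : R) : R := `|x| / (1 + b^-1 * `|x| `^ alpha).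

Lemma ratio_denominator_gt0 (alpha b x : R) : (0 <= b)%R -> (0 < 1 + b^-1 * x `^ alpha)%R.
Proof. by move=> b0; rewrite ltr_wpDr// mulr_ge0 ?invr_ge0// powR_ge0. Qed.

Lemma measurable_ratio_integrand alpha b : (0 <= b)%R ->
  measurable_fun setT (ratio_integrand alpha b).
Proof.
move=> b0.
rewrite (_ : ratio_integrand _ _ = fun x => `|x| * expR (- ln (1 + b^-1 * `|x| `^ alpha)))%R.
  apply: measurable_funM => //; apply: measurableT_comp => //; apply: measurableT_comp => //.
  apply: measurableT_comp; first exact: measurable_ln.
  apply: measurable_funD => //; apply: measurable_funM => //.
  by apply: (measurableT_comp (measurable_powR alpha)).
apply/funext => x; rewrite /ratio_integrand expRN lnK// posrE.
exact: ratio_denominator_gt0.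
Qed.

Lemma ratio_integrand_ge0 alpha b x : (0 <= b)%R -> (0 <= ratio_integrand alpha b x)%R.
Proof. by move=> b0; rewrite divr_ge0// ltW// ratio_denominator_gt0. Qed.

(** With x = exp y and then y scaled by alpha, the integral is 1 / alpha times that of exp (a y) /
    (1 + exp y) over the line, with a = 2 / alpha. Folding at 0 gives the two sides of the
    reflection formula; alpha > 2 ensures a < 1. *)
Lemma integral_ratio1 alpha : (2 < alpha)%R ->
  \int[leb]_(x in `[0%R, +oo[) (ratio_integrand alpha 1 x)%:E = (kappa alpha / 2)%:E.
Proof.
move=> a2; have a0 : (0 < alpha)%R by exact: lt_trans a2.
have mr : measurable_fun setT (ratio_integrand alpha 1) by exact: measurable_ratio_integrand.
rewrite -integral_itv_obnd_cbnd; last by apply/measurable_EFinP; exact: measurable_funS mr.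
rewrite ge0_integral_exp_substitution; last 2 first.
- move=> x; rewrite in_itv/= andbT => x0.
  have cn : {for x, continuous (fun x : R => `|x|%R)} by exact: norm_continuous.
  apply: cvgM; first exact: cn.
  apply: cvgV; first by rewrite gt_eqF// ratio_denominator_gt0.
  apply: cvgD; first exact: cvg_cst.
  apply: cvgM; first exact: cvg_cst.
  apply: (@continuous_comp _ _ _ (fun x : R => `|x|%R) (fun y => y `^ alpha)%R) => //.
  apply/differentiable_continuous/derivable1_diffP.
  have nx : (0 < `|x|)%R by rewrite normr_gt0 gt_eqF.
  exact: (@ex_derive _ _ _ _ _ _ _ (is_derive1_powR alpha nx)).
- by move=> x; exact: ratio_integrand_ge0.
set a := (2 / alpha)%R.
pose h x : R := (expR (a * x) / (1 + expR x))%R.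
have ch : continuous h.
  move=> x; apply: cvgM.
    apply: continuous_comp; last exact: continuous_expR.
    exact: mulrl_continuous.
  apply: cvgV; first by rewrite gt_eqF// addr_gt0// expR_gt0.
  by apply: cvgD; [exact: cvg_cst|exact: continuous_expR].
have mh : measurable_fun setT h by exact: continuous_measurable_fun.
have h0 x : (0 <= h x)%R by rewrite divr_ge0 ?expR_ge0// addr_ge0 ?expR_ge0.
transitivity (\int[leb]_y (h (alpha * y)%R)%:E).
  apply: eq_integral => y _; congr EFin; rewrite /h /ratio_integrand.
  rewrite ger0_norm ?expR_ge0// invr1 mul1r -expRM mulrAC -expRD;
    congr (expR _ / (1 + expR _))%R.
    by rewrite mulrA /a divfK ?gt_eqF// mulrDl mul1r.
  by rewrite mulrC.
have e : alpha%:E * \int[leb]_y (h (alpha * y)%R)%:E = (pi / sin (pi * a))%:E.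
  rewrite -(@integral_scale R alpha (fun x => (h x)%:E))//; last exact/measurable_EFinP.
  rewrite -half_int_reflection; last first.
    by rewrite divr_gt0//= ltr_pdivrMr// mul1r.
  rewrite [LHS]ge0_integral_fold; last 2 first.
  - exact/measurable_EFinP.
  - by move=> x; rewrite lee_fin.
  rewrite /half_int; congr (_ + _); apply: eq_integral => x _; congr EFin; rewrite /h.
    by rewrite mulrN.
  have e0 : expR x != 0%R :> R by rewrite gt_eqF// expR_gt0.
  have -> : expR (- ((1 - a) * x)) = (expR (a * x) * expR (- x))%R.
    by rewrite -expRD; congr expR; ring.
  rewrite expRN; field.
  by rewrite e0 gt_eqF ?addr_gt0 ?expR_gt0.
rewrite -[LHS]mul1e [X in X * _](_ : 1 = (alpha^-1)%:E * alpha%:E); last first.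
  by rewrite -EFinM mulVf ?gt_eqF.
rewrite -muleA e -EFinM; congr EFin.
rewrite /kappa /a (_ : (pi * (2 / alpha) = 2 * pi / alpha)%R); last by field; rewrite gt_eqF.
by rewrite [RHS]mulrAC mulrA; congr (_ / _)%R; field; rewrite gt_eqF.
Qed.

(** Scaling x by c = b^(1 / alpha) reduces to b = 1; x and dx contribute one factor c each. *)
Lemma integral_ratio alpha b : (2 < alpha)%R -> (0 < b)%R ->
  \int[leb]_(x in `[0%R, +oo[) (ratio_integrand alpha b x)%:E =
  (b `^ (2 / alpha) * (kappa alpha / 2))%:E.
Proof.
move=> a2 b0; have a0 : (0 < alpha)%R by exact: lt_trans a2.
have mb : measurable_fun setT (ratio_integrand alpha b) by exact:
  measurable_ratio_integrand (ltW b0).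
have m1 : measurable_fun setT (ratio_integrand alpha 1) by exact: measurable_ratio_integrand.
pose c : R := (b `^ alpha^-1)%R.
have c0 : (0 < c)%R by exact: powR_gt0.
have ca : (c `^ alpha = b)%R by rewrite -powRrM mulVf ?gt_eqF// powRr1// ltW.
have cc : (c * c = b `^ (2 / alpha))%R.
  by rewrite -expr2 -powR_mulrn ?ltW// -powRrM mulrC.
rewrite (@integral_scale_ge0 _ c)//; last 2 first.
- exact/measurable_EFinP.
- by move=> x; rewrite lee_fin ratio_integrand_ge0// ltW.
rewrite -cc -mulrA EFinM; congr (_ * _); rewrite EFinM -integral_ratio1//.
rewrite -ge0_integralZl_EFin//; last 3 first.
- by move=> x _; rewrite lee_fin ratio_integrand_ge0.
- by apply/measurable_EFinP; exact: measurable_funTS.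
- exact: ltW.
apply: eq_integral => x _; rewrite -EFinM; congr EFin.
rewrite /ratio_integrand normrM (gtr0_norm c0) powRM ?(ltW c0)// ca mulrA mulVf ?gt_eqF//.
by rewrite invr1 mulrA.
Qed.

End kappa_integral.

Section void_integrals.
Context (R : realType) (alpha b : R).
Hypothesis b0 : (0 < b)%R.
Local Notation leb := (@lebesgue_measure R).
Local Open Scope ereal_scope.

(** Polar coordinates and the scaling of the radius by z; then 1 - 1 / (1 + b x^-alpha) = 1 / (1 +
    x^alpha / b). The parameter c covers both regions: c = 1 excludes the disc of the nearest base
    station, and a negative c excludes nothing. *)
Lemma void_integral_outside_disc (c z : R) : (0 < z)%R ->
  void_integral [set x | (c * z < enorm x)%R]
    (fun x => ln (1 + b * z `^ alpha * enorm x `^ (- alpha))) =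
  (2 * pi * z ^+ 2)%:E *
  \int[leb]_(x in `[0%R, +oo[ `&` `]c, +oo[) (ratio_integrand alpha b x)%:E.
Proof.
move=> z0.
have mr := measurable_ratio_integrand alpha (ltW b0).
have a_ge0 x : (0 <= b * z `^ alpha * x `^ (- alpha))%R by rewrite !mulr_ge0 ?powR_ge0// ltW.
pose q (x : R) : \bar R := if (c * z < x)%R
  then (1 - expR (- ln (1 + b * z `^ alpha * x `^ (- alpha))))%:E else 0.
have q0 x : 0 <= q x.
  by rewrite /q; case: ifP => // _;
    rewrite lee_fin subr_ge0 -[leRHS]expR0 ler_expR lerNl oppr0 ln_ge0// lerDl.
have mq : measurable_fun setT q.
  apply: measurable_fun_ifT => //; first exact: measurable_fun_ltr.
  apply/measurable_EFinP; apply: measurable_funB => //.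
  apply: measurableT_comp => //; apply: measurableT_comp => //.
  apply: measurableT_comp; first exact: measurable_ln.
  apply: measurable_funD => //; apply: measurable_funM => //; exact: measurable_powR.
rewrite /void_integral integral_mkcond.
transitivity (\int[@plane_measure R]_x q (enorm x)).
  by apply: eq_integral => x _; rewrite patchE /q mem_setE.
rewrite ge0_polar// expr2 !EFinM -!muleA; congr (_ * (_ * _)).
transitivity (\int[leb]_(x in `[0%R, +oo[) (`|x|%:E * q x)).
  by apply: eq_integral => x; rewrite inE/= in_itv/= andbT => x0; rewrite ger0_norm.
rewrite (@integral_scale_ge0 _ z)//; last 2 first.
- by apply: emeasurable_funM => //; apply/measurable_EFinP.
- by move=> x; rewrite mule_ge0 ?lee_fin.
congr (_ * _); rewrite integral_mkcondr -ge0_integralZl//; last 3 first.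
- apply: measurable_funTS; apply/(measurable_restrictT _ _).1 => //.
  by apply/measurable_EFinP; apply: measurable_funS mr.
- by move=> x _; rewrite patchE; case: ifP => // _; rewrite lee_fin ratio_integrand_ge0// ltW.
- by rewrite lee_fin ltW.
apply: eq_integral => x; rewrite inE/= in_itv/= andbT => x0.
rewrite patchE mem_setE in_itv/= andbT /q [(c * z)%R]mulrC ltr_pM2l//.
case: ifPn => cx; last by rewrite !mule0.
rewrite -!EFinM; congr EFin.
(* At x = 0 the factor x annihilates both sides, whatever the value of the negative power of 0. *)
move: x0; rewrite le_eqVlt => /predU1P[<-|x0].
  by rewrite /ratio_integrand !(mulr0, normr0, mul0r).
rewrite /ratio_integrand !gtr0_norm ?mulr_gt0// expRN lnK ?posrE ?ltr_wpDr//.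
rewrite !powRN powRM ?(ltW z0) ?(ltW x0)//.
have : (0 < z `^ alpha)%R by rewrite powR_gt0.
have : (0 < x `^ alpha)%R by rewrite powR_gt0.
move: (z `^ alpha)%R (x `^ alpha)%R => u w w0 u0.
by field; rewrite !gt_eqF ?addr_gt0 ?mulr_gt0.
Qed.

End void_integrals.

Section spectral_efficiency_integrals.
Context (R : realType) (alpha : R).
Hypothesis alpha2 : 2 < alpha.
Local Notation leb := (@lebesgue_measure R).

Let alpha0 : 0 < alpha. Proof. exact: lt_trans alpha2. Qed.

Lemma void_integral_plane (b z : R) : 0 < b -> 0 < z ->
  void_integral setT (fun x => ln (1 + b * z `^ alpha * enorm x `^ (- alpha))) =
  (pi * z ^+ 2 * (b `^ (2 / alpha) * kappa alpha))%:E.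
Proof.
move=> b0 z0; rewrite (_ : setT = [set x : R * R | (- 1) * z < enorm x]); last first.
  by apply/seteqP; split => // x _ /=; rewrite mulN1r (lt_le_trans _ (sqrtr_ge0 _))// oppr_lt0.
rewrite void_integral_outside_disc// setIidl; last first.
  move=> x; rewrite /= !in_itv/= !andbT => x0; apply: lt_le_trans x0; exact: ltrN10.
by rewrite integral_ratio// -EFinM; congr EFin; field.
Qed.

Lemma fin_num_integral_ratio_itv (b : R) (i : interval R) : 0 < b -> {subset i <= `[0, +oo[} ->
  (\int[leb]_(x in [set` i]) (ratio_integrand alpha b x)%:E)%E \is a fin_num.
Proof.
move=> b0 i0; have mr := measurable_ratio_integrand alpha (ltW b0).
have r0 x : (0 <= (ratio_integrand alpha b x)%:E)%E by rewrite lee_fin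
  ratio_integrand_ge0// ltW.
rewrite ge0_fin_numE; last exact: integral_ge0.
have : (\int[leb]_(x in [set` i]) (ratio_integrand alpha b x)%:E <=
  \int[leb]_(x in `[0%R, +oo[) (ratio_integrand alpha b x)%:E)%E.
  apply: ge0_subset_integral => //.
  by apply/measurable_EFinP; apply: measurable_funS mr.
by rewrite integral_ratio// => /le_lt_trans; apply; rewrite ltry.
Qed.

(** The D2D formula states the base station term through [H0], whereas the plane integral yields
    [kappa]; this identifies the two. *)
Lemma ratio_integral_H0 (PD PB beta : R) : 0 < PD -> 0 < PB -> 0 < beta ->
  H0 PD PB beta alpha = (beta * (PB / PD)) `^ (2 / alpha) * (kappa alpha / 2).
Proof.
move=> PD0 PB0 be0; have b0 : 0 < beta * (PB / PD) by rewrite mulr_gt0 ?divr_gt0.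
have -> : H0 PD PB beta alpha = fine (\int[leb]_(x in `[0%R, +oo[)
    (ratio_integrand alpha (beta * (PB / PD)) x)%:E)%E; last by rewrite integral_ratio.
rewrite /H0 /Rintegral; congr fine; apply: eq_integral => x;
  rewrite inE/= in_itv/= andbT => x0; congr EFin.
by rewrite /ratio_integrand ger0_norm// invfM invf_div.
Qed.

Lemma void_integral_beyond (b z : R) : 0 < b -> 0 < z ->
  void_integral [set x | z < enorm x] (fun x => ln (1 + b * z `^ alpha * enorm x `^ (-
    alpha))) =
  (2 * pi * z ^+ 2 * H1 b alpha)%:E.
Proof.
move=> b0 z0; have mr := measurable_ratio_integrand alpha (ltW b0).
have := @void_integral_outside_disc R alpha b b0 1 z z0.
rewrite mul1r => ->; rewrite [RHS]EFinM; congr (_ * _)%E.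
rewrite setIidr; last first.
  by move=> x; rewrite /= !in_itv/= !andbT => x1; exact/ltW/(lt_trans ltr01).
rewrite integral_itv_obnd_cbnd; last by apply/measurable_EFinP; apply: measurable_funS mr.
have -> : H1 b alpha = fine (\int[leb]_(x in `[1%R, +oo[) (ratio_integrand alpha b x)%:E)%E.
  rewrite /H1 /Rintegral; congr fine; apply: eq_integral => x;
    rewrite inE/= in_itv/= andbT => x1; congr EFin.
  by rewrite /ratio_integrand ger0_norm// (le_trans _ x1).
rewrite fineK//; apply: fin_num_integral_ratio_itv => // x.
by rewrite !in_itv/= !andbT; apply: le_trans.
Qed.

End spectral_efficiency_integrals.

Section gaussian_moment.
Context (R : realType).
Local Notation leb := (@lebesgue_measure R).

Lemma integral_rayleigh (A B : R) : 0 <= A -> 0 < B ->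
  (\int[leb]_(x in `[0%R, +oo[) (2 * A * x * expR (- (B * x ^+ 2)))%:E = (A / B)%:E)%E.
Proof.
move=> A0 B0.
pose F (x : R) : R := - (A / B) * expR (- (B * x ^+ 2)).
pose f (x : R) : R := 2 * A * x * expR (- (B * x ^+ 2)).
have dF (x : R) : is_derive x 1 F (f x).
  have d1 : is_derive x 1 (fun y : R => - (B * y ^+ 2)) (- (B * (2 * x))).
    rewrite (_ : (fun y => _) = - (B *: (fun y : R => y ^+ 2))); last by apply/funext.
    refine (is_derive_eq (is_deriveN (is_deriveZ B (is_deriveX 2 (is_derive_id x 1)))) _).
    by rewrite /= !scaler1 expr1; congr (- _).
  have d2 := @is_derive1_comp R (@expR R) (fun y :
    R => - (B * y ^+ 2)) x _ _ (is_derive_expR (- (B * x ^+ 2))) d1.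
  rewrite (_ : F = (- (A / B)) *: (expR \o (fun y : R => - (B * y ^+ 2))));
    last by apply/funext.
  refine (is_derive_eq (is_deriveZ (- (A / B)) d2) _).
  rewrite /f /GRing.scale/= ; field; exact: lt0r_neq0.
have cF : continuous F.
  by move=> x; apply/differentiable_continuous/derivable1_diffP; have [] := dF x.
have cf : continuous f.
  move=> x; apply: cvgM; first exact: mulrl_continuous.
  apply: continuous_comp; last exact: continuous_expR.
  by apply: cvgN; apply: cvgM; [exact: cvg_cst|exact: exprn_continuous].
rewrite (@ge0_continuous_FTC2y R f F 0 0)//.
- by rewrite /F expr0n mulr0 oppr0 expR0 mulr1 -EFinB sub0r opprK.
- by move=> x x0; rewrite !mulr_ge0 ?expR_ge0.
- exact: continuous_subspaceT.
- rewrite -[X in _ --> X](mulr0 (- (A / B))); apply: cvgMr.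
  (* For x >= 1 the square dominates x, which reduces the limit to that of a plain exponential. *)
  have n : \forall x \near +oo, 0 <= expR (- (B * x ^+ 2)) <= expR (- (B * x)).
    near=> x.
    have x1 : 1 <= x by near: x; exact: nbhs_pinfty_ge.
    have x0 : 0 <= x by exact: le_trans x1.
    by rewrite expR_ge0/= ler_expR lerN2 ler_wpM2l ?(ltW B0)// expr2 ler_peMl.
  by apply: (squeeze_cvgr n); [exact: cvg_cst|exact: cvg_exprN_infty].
- exact/cvg_at_right_filter/cF.
- by move=> x _; rewrite derive1E; have [_ ->] := dF x.
Unshelve. all: by end_near. Qed.

End gaussian_moment.

(** * Coverage probability *)

Section sinr_comparison.
Context d (T : measurableType d) (R : realType).
Local Open Scope ereal_scope.

(** Also true at x = +oo, where the quotient is 0, the product is +oo and both comparisons fail: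
    infinite interference means no coverage. *)
Lemma lt_div_ereal (b n : R) (x : \bar R) : (0 < b)%R -> 0 < x ->
  (b%:E < n%:E / x) = (b%:E * x < n%:E).
Proof.
move=> b0; case: x => [r| |]//.
  rewrite lte_fin => r0; rewrite inver gt_eqF// -!EFinM !lte_fin.
  by rewrite ltr_pdivlMr.
by rewrite invey mule0 gt0_muley ?lte_fin// (lt_gtF b0).
Qed.

Definition path_loss (Pw alpha : R) (x : R * R) : R := Pw * enorm x `^ (- alpha).

Lemma path_loss_ge0 Pw alpha x : (0 <= Pw)%R -> (0 <= path_loss Pw alpha x)%R.
Proof. by move=> Pw0; rewrite mulr_ge0// powR_ge0. Qed.

Lemma measurable_path_loss Pw alpha : measurable_fun setT (path_loss Pw alpha).
Proof.
apply: measurable_funM => //.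
exact: (measurableT_comp (measurable_powR (- alpha)) (@measurable_enorm R)).
Qed.

(** The unordered sum ignores negative terms, so fadings can be replaced by their positive parts at
    every t, without discarding a null set. *)
Lemma interferenceE (Pw alpha : R) (h : nat -> T -> R) (X : points T R) t : (0 <= Pw)%R ->
  interference Pw alpha h X t =
  \sum_(i <oo) (omark (path_loss Pw alpha) (X i t) * Num.max (h i t) 0)%:E.
Proof.
move=> Pw0; pose f i : R := (omark (path_loss Pw alpha) (X i t) * h i t)%R.
transitivity (\esum_(i in [set: nat]) (f i)%:E).
  apply: eq_esum => i _; congr EFin; rewrite /f /omark /path_loss.
  by case: (X i t) => [z|]; [ring|rewrite mul0r].
rewrite esum_positive_part; apply: eq_eseriesr => i _; congr EFin.
rewrite /f maxr_pMr ?mulr0// omark_ge0// => x; exact: path_loss_ge0.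
Qed.

Lemma weighted_fading_ge0 (a x : R) : (0 <= a)%R -> (0 <= a * Num.max x 0)%R.
Proof. by move=> a0; rewrite mulr_ge0// le_max lexx orbT. Qed.

Lemma interference_ge0 (Pw alpha : R) (h : nat -> T -> R) (X : points T R) t :
  (0 <= Pw)%R -> 0 <= interference Pw alpha h X t.
Proof.
move=> Pw0; rewrite interferenceE//; apply: nneseries_EFin_ge0 => i.
by apply/weighted_fading_ge0/omark_ge0 => x; exact: path_loss_ge0.
Qed.

Lemma measurable_interference (Pw alpha : R) (h : nat -> T -> R) (X : points T R) :
    (0 <= Pw)%R -> (forall i, measurable_fun setT (h i)) -> point_process X ->
  measurable_fun setT (interference Pw alpha h X).
Proof.
move=> Pw0 mh pX.
rewrite (_ : interference _ _ _ _ = (fun t =>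
  \sum_(i <oo) (omark (path_loss Pw alpha) (X i t) * Num.max (h i t) 0)%:E)); last first.
  by apply/funext => t; exact: interferenceE.
apply: measurable_nneseries => [i|i t]; last first.
  by apply/weighted_fading_ge0/omark_ge0 => x; exact: path_loss_ge0.
apply: measurable_funM; last exact: measurable_maxr.
apply: measurable_omark; last exact: measurable_path_loss.
by move=> A mA; apply: pX; exists i, A.
Qed.

Section parameters.
Context (Ps PD PB alpha s2 beta : R) (h0 dist : T -> R) (hD hB : nat -> T -> R)
  (X Y : points T R).
Hypotheses (Ps0 : (0 < Ps)%R) (PD0 : (0 <= PD)%R) (PB0 : (0 <= PB)%R)
  (s20 : (0 < s2)%R) (beta0 : (0 < beta)%R).

(** Positive noise keeps the denominator positive even where there is no interference; this is why
    the noise is sent to 0 only at the end. *)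
Lemma lt_sinr t :
  (beta%:E < sinr Ps PD PB alpha s2 h0 dist hD X hB Y t) =
  (beta%:E * (interference PD alpha hD X t + interference PB alpha hB Y t + s2%:E)
    < (Ps * h0 t * dist t `^ (- alpha))%:E).
Proof.
rewrite /sinr lt_div_ereal// -[X in X < _]add0e; apply: lee_ltD => //.
  by rewrite adde_ge0// interference_ge0.
Qed.

Lemma lt_sinr_fading t : (0 < dist t)%R ->
  (beta%:E < sinr Ps PD PB alpha s2 h0 dist hD X hB Y t) =
  ((beta / Ps * dist t `^ alpha * s2)%:E
   + \sum_(i <oo) (beta / Ps * dist t `^ alpha * omark (path_loss PD alpha) (X i t)
                   * Num.max (hD i t) 0)%:E
   + \sum_(i <oo) (beta / Ps * dist t `^ alpha * omark (path_loss PB alpha) (Y i t)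
                   * Num.max (hB i t) 0)%:E < (h0 t)%:E).
Proof.
move=> dt0; rewrite lt_sinr.
have p0 : (0 < dist t `^ alpha)%R by rewrite powR_gt0.
rewrite powRN; move: (dist t `^ alpha)%R p0 => p p0.
set q : R := (beta / Ps * p)%R.
have q0 : (0 < q)%R by rewrite mulr_gt0// divr_gt0.
have c0 : (0 < Ps / p)%R by rewrite divr_gt0.
rewrite -[RHS](@lte_pmul2l R (Ps / p)%:E)// -EFinM.
rewrite (_ : (Ps / p * h0 t = Ps * h0 t / p)%R); last by ring.
congr (_ < _).
have s0 Pw h W : (0 <= Pw)%R ->
  \sum_(i <oo) (q * omark (path_loss Pw alpha) (W i t) * Num.max (h i t) 0)%:E =
  q%:E * interference Pw alpha h W t.
  move=> Pw0; rewrite interferenceE// -nneseriesZl; last first.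
    by move=> i _; rewrite lee_fin; apply/weighted_fading_ge0/omark_ge0 => x; exact:
      path_loss_ge0.
  by apply: eq_eseriesr => i _; rewrite -EFinM mulrA.
have iD : 0 <= interference PD alpha hD X t by exact: interference_ge0.
have iB : 0 <= interference PB alpha hB Y t by exact: interference_ge0.
have s20' : 0 <= s2%:E by rewrite lee_fin ltW.
rewrite !s0// [(q * s2)%:E]EFinM -!ge0_muleDr ?adde_ge0//.
rewrite muleA -EFinM (_ : (Ps / p * q = beta)%R); last first.
  by rewrite /q; field; rewrite !gt_eqF.
by rewrite addeC addeA.
Qed.

End parameters.
End sinr_comparison.

Section coverage.
Context d (T : measurableType d) (R : realType) (P : probability T R).
Local Open Scope ereal_scope.

Lemma probability_ae_eq (E F N : set T) :
    measurable E -> measurable F -> measurable N -> P N = 0 ->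
    (forall t, ~ N t -> (E t <-> F t)) ->
  P E = P F.
Proof.
move=> mE mF mN N0 EF.
have H (A B : set T) : measurable A -> measurable B -> A `<=` B `|` N -> P A <= P B.
  move=> mA mB AB; apply: (@le_trans _ _ (P (B `|` N))).
    by apply: le_measure; rewrite ?inE//; exact: measurableU.
  apply: (le_trans (measureU2 P mB mN)); rewrite -[leRHS]adde0; apply: leeD => //.
  by rewrite le_eqVlt; apply/orP; left; apply/eqP; exact: N0.
apply/eqP; rewrite eq_le !H// => t.
  by have [|Nt Ft] := pselect (N t); [right|left; apply/(EF t Nt)].
by have [|Nt Ft] := pselect (N t); [right|left; apply/(EF t Nt)].
Qed.

Context (Z h0 : {RV P >-> R}) (hD hB : nat -> {RV P >-> R}) (X Y : points T R).
Context (Ps PD PB alpha beta : R).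
Hypotheses (Ps0 : (0 < Ps)%R) (PD0 : (0 < PD)%R) (PB0 : (0 < PB)%R)
  (alpha0 : (0 < alpha)%R) (beta0 : (0 < beta)%R).
Hypothesis Zpos : P [set t | (Z t <= 0)%R] = 0.
Hypotheses (pX : point_process X) (pY : point_process Y).
Hypothesis fad : iid_exp1_fading h0 hD hB.
Hypothesis ind : indep_systems P (rv_events Z `|` point_events Y `|` point_events X)
  (fading_events h0 hD hB).

(* Truncating at 0 changes nothing almost surely and makes the dependence on
   [z] explicit on the whole line. *)
Definition path_gain_inv (z : R) : R := (beta / Ps * Num.max z 0 `^ alpha)%R.

Lemma path_gain_inv_ge0 z : (0 <= path_gain_inv z)%R.
Proof. by rewrite mulr_ge0 ?powR_ge0// divr_ge0// ltW. Qed.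

Lemma measurable_path_gain_inv : measurable_fun setT path_gain_inv.
Proof.
apply: measurable_funM => //; apply: (measurableT_comp (measurable_powR alpha)).
exact: measurable_maxr.
Qed.

Let SX t := point_sum (fun x => ln (1 + path_gain_inv (Z t) * path_loss PD alpha x)) X t.
Let SY t := point_sum (fun x => ln (1 + path_gain_inv (Z t) * path_loss PB alpha x)) Y t.

Lemma measurable_sinr_event s2 : (0 < s2)%R ->
  measurable [set t | beta%:E < sinr Ps PD PB alpha s2 h0 Z hD X hB Y t].
Proof.
move=> s20.
pose f t := beta%:E * (interference PD alpha hD X t + interference PB alpha hB Y t + s2%:E).
pose g t := (Ps * h0 t * Z t `^ (- alpha))%:E.
rewrite (_ : [set _ | _] = [set t | f t < g t]); last first.
  by apply/seteqP; split => t /=; rewrite lt_sinr// ltW.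
refine (@measurable_lt_ereal _ _ _ f g _ _).
  apply: measurable_funeM; apply: emeasurable_funD => //.
  by apply: emeasurable_funD; apply: measurable_interference => //; exact: ltW.
apply/measurable_EFinP; apply: measurable_funM; first exact: measurable_funM.
exact: (measurableT_comp (measurable_powR (- alpha))).
Qed.

(** The fadings are independent of all locations, so the locations can be frozen at t and
    [fading_tail] applied to the fadings alone. *)
Lemma coverage_laplace s2 : (0 < s2)%R ->
  P [set t | beta%:E < sinr Ps PD PB alpha s2 h0 Z hD X hB Y t] =
  \int[P]_t expeR (- ((path_gain_inv (Z t) * s2)%:E + SX t + SY t)).
Proof.
move=> s20.
pose F := rv_events Z `|` point_events Y `|` point_events X; pose G := fading_events h0 hD hB.
have ZF : rv_events Z `<=` <<s F >> by move=> A ZA; apply: sub_gen_smallest; left; left.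
have YF : point_events Y `<=` <<s F >> by move=> A ZA; apply: sub_gen_smallest; left; right.
have XF : point_events X `<=` <<s F >> by move=> A ZA; apply: sub_gen_smallest; right.
pose q t := path_gain_inv (Z t).
have q0 t : (0 <= q t)%R by exact: path_gain_inv_ge0.
pose a Pw (W : points T R) i t : R := (q t * omark (path_loss Pw alpha) (W i t))%R.
have a0 Pw W i t : (0 < Pw)%R -> (0 <= a Pw W i t)%R.
  by move=> Pw0; rewrite mulr_ge0// omark_ge0// => x; apply/path_loss_ge0/ltW.
(* The first coordinate carries the locations and the second the fadings; the actual level is read
   on the diagonal. *)
pose W (z : g_sigma_algebraType F * g_sigma_algebraType G) : \bar R :=
  (q z.1 * s2)%:E + \sum_(i <oo) (a PD X i z.1 * Num.max (hD i z.2) 0)%:E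
  + \sum_(i <oo) (a PB Y i z.1 * Num.max (hB i z.2) 0)%:E.
have mq : measurable_fun setT (q : g_sigma_algebraType F -> R).
  apply: (measurableT_comp measurable_path_gain_inv); exact: measurable_fun_generated.
have ma Pw (V : points T R) i : point_events V `<=` <<s F >> ->
    measurable_fun setT (a Pw V i : g_sigma_algebraType F -> R).
  move=> VF; apply: measurable_funM => //.
  by apply: measurable_generated_points => //; exact: measurable_path_loss.
have mh k : measurable_fun setT (all_fadings h0 hD hB k : g_sigma_algebraType G -> R).
  by apply: measurable_fun_generated => A hA; apply: sub_gen_smallest; exists k.
have mW : measurable_fun setT W.
  have mt Pw (V : points T R) i k : point_events V `<=` <<s F >> -> measurable_fun setT
      (fun z : g_sigma_algebraType F * g_sigma_algebraType G =>
        a Pw V i z.1 * Num.max (all_fadings h0 hD hB k z.2) 0)%R.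
    move=> VF; apply: measurable_funM.
      exact: (measurableT_comp (ma Pw V i VF) measurable_fst).
    apply: measurable_maxr; last exact: measurable_cst.
    exact: (measurableT_comp (mh k) measurable_snd).
  apply: emeasurable_funD; first apply: emeasurable_funD.
  - apply/measurable_EFinP; apply: measurable_funM => //.
    exact: (measurableT_comp mq measurable_fst).
  - apply: measurable_nneseries => [i|i z]; first exact: (mt PD X i (Some (inl i))).
    exact/weighted_fading_ge0/a0.
  - apply: measurable_nneseries => [i|i z]; first exact: (mt PB Y i (Some (inr i))).
    exact/weighted_fading_ge0/a0.
pose phi (z : g_sigma_algebraType F * g_sigma_algebraType G) : \bar R :=
  ((W z < (h0 z.2)%:E)%E%:R : R)%:E.
have mWT : measurable_fun (setT : set T) (fun t : T => W (t, t)).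
  have mt Pw (V : points T R) i (h : {RV P >-> R}) : point_process V -> measurable_fun setT
      (fun t => a Pw V i t * Num.max (h t) 0)%R.
    move=> pV; apply: measurable_funM; last exact: measurable_maxr.
    apply: measurable_funM; first exact: (measurableT_comp measurable_path_gain_inv).
    apply: measurable_omark; last exact: measurable_path_loss.
    by move=> A mA; apply: pV; exists i, A.
  apply: emeasurable_funD; first apply: emeasurable_funD.
  - apply/measurable_EFinP; apply: measurable_funM => //.
    exact: (measurableT_comp measurable_path_gain_inv).
  - apply: measurable_nneseries => [i|i z]; first exact: mt.
    exact/weighted_fading_ge0/a0.
  - apply: measurable_nneseries => [i|i z]; first exact: mt.
    exact/weighted_fading_ge0/a0.
have mE : measurable ([set t : T | W (t, t) < (h0 t)%:E] : set T).
  by apply: measurable_lt_ereal => //; exact/measurable_EFinP.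
transitivity (P [set t | W (t, t) < (h0 t)%:E]).
  (* Solving for the serving fading divides by a power of the link length, so the null event Z <= 0
     is set aside. *)
  apply: (@probability_ae_eq _ _ [set t | (Z t <= 0)%R]) => //.
  - exact: measurable_sinr_event.
  - rewrite (_ : [set _ | _] = Z @^-1` `]-oo, 0%R]); last first.
      by apply/seteqP; split => t /=; rewrite in_itv.
    by rewrite -[X in measurable X]setTI; apply: measurable_funP.
  - move=> t /negP; rewrite -ltNge => Zt;
    rewrite /= (lt_sinr_fading alpha h0 hD hB X Y Ps0 (ltW PD0) (ltW PB0) s20 beta0 Zt).
    by rewrite /W /a /q /path_gain_inv/= (max_idPl (ltW Zt)).
transitivity (\int[P]_t phi (t, t)); first by rewrite prob_bool.
rewrite (indep_integral _ _ ind); last 4 first.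
- move=> A [[ZA|YA]|XA]; [exact: rv_events_measurable ZA|exact: pY|exact: pX].
- by move=> A [k _]; exact: rv_events_measurable.
- apply/measurable_EFinP; apply: measurableT_comp => //.
  apply: measurable_fun_lte => //; apply/measurable_EFinP.
  exact: (measurableT_comp (mh None) measurable_snd).
- by move=> z; rewrite lee_fin.
apply: eq_integral => t _.
transitivity (P [set t2 | W (t, t2) < (h0 t2)%:E]).
  rewrite prob_bool//; apply: measurable_lt_ereal; last exact/measurable_EFinP.
  rewrite /W/=; apply: emeasurable_funD; first apply: emeasurable_funD; first exact:
    measurable_cst.
  - apply: measurable_nneseries => [i|i z]; last exact/weighted_fading_ge0/a0.
    by apply: measurable_funM => //; exact: measurable_maxr.
  - apply: measurable_nneseries => [i|i z]; last exact/weighted_fading_ge0/a0.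
    by apply: measurable_funM => //; exact: measurable_maxr.
rewrite /W/= (fading_tail fad); last 3 first.
- by rewrite mulr_ge0// ltW.
- by move=> i; exact: a0.
- by move=> i; exact: a0.
have e Pw (V : points T R) : \sum_(i <oo) (ln (1 + a Pw V i t))%:E =
    point_sum (fun x => ln (1 + path_gain_inv (Z t) * path_loss Pw alpha x)) V t.
  apply: eq_eseriesr => i _; congr EFin; rewrite /a /omark.
  by case: (V i t) => [x//|]; rewrite mulr0 addr0 ln1.
by rewrite !e.
Qed.

Let SX_ge0 t : 0 <= SX t.
Proof.
apply: point_sum_ge0 => x; rewrite ln_ge0// lerDl mulr_ge0 ?path_gain_inv_ge0//.
exact/path_loss_ge0/ltW.
Qed.

Let SY_ge0 t : 0 <= SY t.
Proof.
apply: point_sum_ge0 => x; rewrite ln_ge0// lerDl mulr_ge0 ?path_gain_inv_ge0//.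
exact/path_loss_ge0/ltW.
Qed.

(** Only the noise term depends on sigma2, and it tends to 0 pointwise; the integrands stay in
    [0, 1], so bounded convergence applies along every sequence decreasing or not to 0 from the
    right. *)
Lemma coverage_cvg (l : R) : \int[P]_t expeR (- (SX t + SY t)) = l%:E ->
  P [set t | beta%:E < sinr Ps PD PB alpha sigma2 h0 Z hD X hB Y t]
    @[sigma2 --> 0%R^'+] --> l%:E.
Proof.
move=> el; apply: cvg_EFin.
  near=> s; apply: fin_num_measure; apply: measurable_sinr_event.
  by near: s; exact: nbhs_right_gt.
apply/cvg_at_rightP => u [u0 uc]; apply: fine_cvg; rewrite -el.
under eq_fun do rewrite coverage_laplace//.
have mS Pw (V : points T R) : (0 < Pw)%R -> point_process V -> measurable_fun setT (fun t =>
    point_sum (fun x => ln (1 + path_gain_inv (Z t) * path_loss Pw alpha x)) V t).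
  move=> Pw0 pV; apply: measurable_weighted_point_sum => //.
  - exact: (measurableT_comp measurable_path_gain_inv).
  - by move=> t; exact: path_gain_inv_ge0.
  - exact: measurable_path_loss.
  - by move=> x; exact/path_loss_ge0/ltW.
apply: bounded_cvg_integral => //.
- move=> n; apply: measurableT_comp; first exact: measurable_expeR.
  apply: measurableT_comp => //; apply: emeasurable_funD; last exact: mS.
  apply: emeasurable_funD; last exact: mS.
  apply/measurable_EFinP; apply: measurable_funM => //.
  exact: (measurableT_comp measurable_path_gain_inv).
- move=> n t; apply: expeRN_ge0_le1; rewrite !adde_ge0// lee_fin mulr_ge0 ?path_gain_inv_ge0//.
  exact: ltW.
- move=> t; apply: cvg_expeRN.
  + move=> n; rewrite !adde_ge0// lee_fin mulr_ge0 ?path_gain_inv_ge0//; exact: ltW.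
  + by rewrite adde_ge0.
  + have H : (path_gain_inv (Z t) * u n)%:E + (SX t + SY t) @[n --> \oo] --> 0 + (SX t + SY t).
      apply: cvgeD.
      * by rewrite ge0_adde_def ?inE ?adde_ge0.
      * apply: (@cvg_EFin _ _ _ _ _ 0%R); first exact: nearW.
        by rewrite -(mulr0 (path_gain_inv (Z t))); apply: cvgM; [exact: cvg_cst|exact: uc].
      * exact: cvg_cst.
    by move: H; rewrite add0e; under eq_fun do rewrite addeA.
Unshelve. all: by end_near. Qed.

End coverage.

(** * Independence in the two models *)

Section independence_of_models.
Context d (T : measurableType d) (R : realType) (P : probability T R).
Local Open Scope ereal_scope.

Lemma sigma_setT (K : set (set T)) : <<s K >> setT.
Proof.
have : <<s K >> (setT `\` set0) by apply: sigma_algebraCD; exact: sigma_algebra0.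
by rewrite setD0.
Qed.

Lemma sigma_measurable (K : set (set T)) : K `<=` measurable -> <<s K >> `<=` @measurable _ T.
Proof. by move=> Km; apply: smallest_sub => //; exact: sigma_algebra_measurable. Qed.

(** Intersections of an event of each sigma-algebra form a pi-system that generates the joint
    sigma-algebra, so the product rule only has to be checked on them. *)
Lemma product_rule_join (F1 F2 : set (set T)) (C : set T) :
    F1 `<=` measurable -> F2 `<=` measurable -> measurable C ->
    (forall A B, <<s F1 >> A -> <<s F2 >> B -> P (A `&` B `&` C) = P (A `&` B) * P C) ->
  forall A, <<s F1 `|` F2 >> A -> P (A `&` C) = P A * P C.
Proof.
move=> mF1 mF2 mC H A sA.
pose D : set (set T) := [set E | exists A B, [/\ <<s F1 >> A, <<s F2 >> B & E = A `&` B]].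
have sI (K : set (set T)) : setI_closed <<s K >>.
  move=> E E' KE KE'; rewrite -(setCK (E `&` E')) setCI.
  have C' X : <<s K >> X -> <<s K >> (~` X).
    by move=> ?; have : <<s K >> (setT `\` X); [exact: sigma_algebraCD | rewrite setTD].
  apply: (C' _); rewrite -bigcup2E; apply: sigma_algebra_bigcup => -[|[|n]] /=.
  - exact: (C' _).
  - exact: (C' _).
  - exact: sigma_algebra0.
rewrite setIC muleC; apply: (@product_rule_sigma _ _ _ P _ _ D) => //.
- by move=> _ [A' [B' [sA' sB' ->]]]; apply: measurableI; [exact:
  (sigma_measurable mF1)|exact: (sigma_measurable mF2)].
- move=> _ _ [A1 [B1 [s1 s1' ->]]] [A2 [B2 [s2 s2' ->]]].
  exists (A1 `&` A2), (B1 `&` B2); split; [exact: sI|exact: sI|].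
  by rewrite setIACA.
- by move=> _ [A' [B' [sA' sB' ->]]]; rewrite setIC H// muleC.
- move: sA; apply: smallest_sub; first exact: smallest_sigma_algebra.
  move=> E [FE|FE]; apply: sub_gen_smallest.
    by exists E, setT; split; [exact: sub_gen_smallest|exact: sigma_setT|rewrite setIT].
  by exists setT, E; split; [exact: sigma_setT|exact: sub_gen_smallest|rewrite setTI].
Qed.

Lemma mutually_independent3 (F1 F2 F3 : set (set T)) (A1 A2 A3 : set T) :
    mutually_independent P (tnth [tuple F1; F2; F3]) -> F1 A1 -> F2 A2 -> F3 A3 ->
  P (A1 `&` (A2 `&` A3)) = P A1 * (P A2 * P A3).
Proof.
move=> PF F1A F2A F3A.
pose o k : 'I_3 := inord k.
have := PF [:: o 0; o 1; o 2]%N (tnth [tuple A1; A2; A3]).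
rewrite !bigcap_in_cons bigcap_in_nil !big_cons big_nil setIT mule1 !(tnth_nth set0)/=
  !inordK//=.
apply.
  by rewrite /= !inE -!(inj_eq val_inj)/= !inordK.
by case=> [[|[|[|]]]] // H _; rewrite !(tnth_nth set0).
Qed.

Lemma mutually_independent4 (F1 F2 F3 F4 : set (set T)) (A1 A2 A3 A4 : set T) :
    mutually_independent P (tnth [tuple F1; F2; F3; F4]) -> F1 A1 -> F2 A2 -> F3 A3 -> F4 A4 ->
  P (A1 `&` (A2 `&` (A3 `&` A4))) = P A1 * (P A2 * (P A3 * P A4)).
Proof.
move=> PF F1A F2A F3A F4A.
pose o k : 'I_4 := inord k.
have := PF [:: o 0; o 1; o 2; o 3]%N (tnth [tuple A1; A2; A3; A4]).
rewrite !bigcap_in_cons bigcap_in_nil !big_cons big_nil setIT mule1 !(tnth_nth set0)/=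
  !inordK//=.
apply.
  by rewrite /= !inE -!(inj_eq val_inj)/= !inordK.
by case=> [[|[|[|[|]]]]] // H _; rewrite !(tnth_nth set0).
Qed.

Lemma fading_events_measurable (h0 : {RV P >-> R}) (hD hB : nat -> {RV P >-> R}) :
  fading_events h0 hD hB `<=` measurable.
Proof. by move=> A [k _]; exact: rv_events_measurable. Qed.

(** Brings the D2D link into the conditional framework of the cellular user: independence of the
    link length leaves the process Poisson given it, with a constant region. *)
Lemma poisson_process_indep (Z : {RV P >-> R}) (Y : points T R) (lam : R) (D : set (R * R)) :
    poisson_process P Y lam D -> indep_systems P (rv_events Z) (point_events Y) ->
  poisson_process_given Z Y lam (fun=> D).
Proof.
move=> [pY HY] ind; split => // E n A k mE mA finA trivA.
rewrite ind.
- have mZE : measurable (Z @^-1` E) by exact: measurable_funPTI.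
  by rewrite integral_cst// HY// muleC.
- by apply: sub_gen_smallest; exists E => //; rewrite setTI.
have mG : forall j, measurable_fun setT (num_points Y (A j) :
  g_sigma_algebraType (point_events Y) -> \bar R).
  move=> j; apply: (@measurable_num_points _ (g_sigma_algebraType (point_events Y))) => //.
  by move=> _ [i [B [mB ->]]]; apply: sub_gen_smallest; exists i, B.
suff : measurable (\bigcap_(j in [set: 'I_n])
    [set t : g_sigma_algebraType (point_events Y) | num_points Y (A j) t = (k j)%:R%:E]) by [].
apply: fin_bigcap_measurable => // j _.
rewrite (_ : [set _ | _] = num_points Y (A j) @^-1` [set (k j)%:R%:E])//.
by rewrite -[X in measurable X]setTI; apply: mG.
Qed.

End independence_of_models.

Section coverage_of_rayleigh_links.
Context d (T : measurableType d) (R : realType) (P : probability T R).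
Context (Z h0 : {RV P >-> R}) (hD hB : nat -> {RV P >-> R}) (X Y : points T R).
Context (Ps PD PB alpha beta : R) (lamX lamY : R) (D : R -> set (R * R)) (A K : R).
Hypotheses (Ps0 : 0 < Ps) (PD0 : 0 < PD) (PB0 : 0 < PB)
  (alpha0 : 0 < alpha) (beta0 : 0 < beta).
Hypotheses (lamX0 : 0 <= lamX) (lamY0 : 0 <= lamY) (A0 : 0 < A) (K0 : 0 <= K).

(** Common form of both link length densities: A = 1 / (2 delta^2) for the D2D link and A = lamB pi
    for the nearest base station. *)
Definition rayleigh_pdf (x : R) : R :=
  ((fun x => 2 * A * x * expR (- (A * x ^+ 2))) \_ `[0, +oo[) x.

Lemma rayleigh_pdf_ge0 x : 0 <= rayleigh_pdf x.
Proof.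
rewrite /rayleigh_pdf patchE mem_setE in_itv/= andbT; case: ifPn => // x0.
by rewrite !mulr_ge0 ?expR_ge0// ltW.
Qed.

Lemma rayleigh_pdf_le0 x : x <= 0 -> rayleigh_pdf x = 0.
Proof.
rewrite /rayleigh_pdf patchE mem_setE in_itv/= andbT => x0.
case: ifPn => // x0'; have -> : x = 0 by apply/eqP; rewrite eq_le x0.
by rewrite mulr0 mul0r.
Qed.

Lemma measurable_rayleigh_pdf : measurable_fun setT rayleigh_pdf.
Proof.
apply/(measurable_restrictT _ _).1 => //; apply: measurable_funTS.
apply: measurable_funM; first exact: measurable_funM.
apply: measurableT_comp => //; apply: measurableT_comp => //.
by apply: measurable_funM => //; exact: measurable_funX.
Qed.

Hypothesis Zf : has_density Z rayleigh_pdf.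
Hypothesis mD : measurable [set zx : R * (R * R) | D zx.1 zx.2].
Hypothesis ppX : poisson_process P X lamX setT.
Hypothesis ppY : poisson_process_given Z Y lamY D.
Hypothesis fad : iid_exp1_fading h0 hD hB.
Hypothesis indep3 : forall E F G, <<s rv_events Z `|` point_events Y >> E ->
  <<s point_events X >> F -> <<s fading_events h0 hD hB >> G ->
  (P (E `&` (F `&` G)) = P E * (P F * P G))%E.
(** The path loss is homogeneous and so is the region D z, which makes the total exponent quadratic
    in z; the models differ only in K. *)
Hypothesis void : forall z, 0 < z ->
  (lamX%:E * void_integral setT (fun x => ln (1 + beta / Ps * z `^ alpha * path_loss PD
    alpha x))
  + lamY%:E * void_integral (D z) (fun x => ln (1 + beta / Ps * z `^ alpha * path_loss PB
    alpha x)))%E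
  = (K * z ^+ 2)%:E.

Lemma coverage_rayleigh :
  P [set t | (beta%:E < sinr Ps PD PB alpha sigma2 h0 Z hD X hB Y t)%E]
    @[sigma2 --> 0^'+] --> (A / (A + K))%:E.
Proof.
have [pX _] := ppX; have [pY _] := ppY.
have mZY : rv_events Z `|` point_events Y `<=` @measurable _ T.
  by move=> E [|ZE]; [exact: rv_events_measurable|exact: pY].
have Zpos : P [set t | Z t <= 0] = 0%E.
  transitivity (distribution P Z `]-oo, 0]).
    by congr (P _); apply/seteqP; split => t /=; rewrite in_itv.
  rewrite Zf//; apply: integral0_eq => x; rewrite /= in_itv/= => x0.
  by rewrite rayleigh_pdf_le0.
have indF : indep_systems P (rv_events Z `|` point_events Y `|` point_events X)
    (fading_events h0 hD hB).
  move=> E G sE sG; apply: product_rule_join (sE) => //.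
  - exact: sigma_measurable (@fading_events_measurable _ _ _ _ h0 hD hB) _ sG.
  move=> E1 F sE1 sF; rewrite -setIA indep3//.
  have -> : (P (E1 `&` F) = P E1 * P F)%E.
    have := indep3 sE1 sF (@sigma_setT _ _ (fading_events h0 hD hB)).
    by rewrite setIT probability_setT mule1.
  by rewrite muleA.
have indX : indep_systems P (rv_events Z `|` point_events Y) (point_events X).
  move=> E F sE sF; have := indep3 sE sF (@sigma_setT _ _ (fading_events h0 hD hB)).
  by rewrite setIT probability_setT mule1.
apply: coverage_cvg => //.
rewrite (joint_laplace lamX0 lamY0 mD ppX ppY indX); last 6 first.
- exact: measurable_path_gain_inv.
- by move=> z; exact: path_gain_inv_ge0.
- exact: measurable_path_loss.
- exact: measurable_path_loss.
- by move=> x; exact/path_loss_ge0/ltW.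
- by move=> x; exact/path_loss_ge0/ltW.
pose F (x : R) : \bar R := (expR (- (K * Num.max x 0 ^+ 2)))%:E.
transitivity (\int[P]_t F (Z t))%E.
  apply: eq_integral => t _; rewrite /F; have [Zt|Zt] := leP (Z t) 0.
    (* Where Z <= 0 the truncated gain is 0 and both exponents vanish, in agreement with the
       truncation in F. *)
    have q0 : path_gain_inv Ps alpha beta (Z t) = 0.
      by rewrite /path_gain_inv (max_idPr Zt) powR0 ?mulr0// gt_eqF.
    have v0 B Pw : void_integral B (fun x => ln (1 + path_gain_inv Ps alpha beta (Z t) *
      path_loss Pw alpha x)) = 0%E.
      by apply: integral0_eq => x _; rewrite q0 mul0r addr0 ln1 oppr0 expR0 subrr.
    by rewrite !v0 !mule0 adde0 expr0n mulr0.
  by rewrite /path_gain_inv (max_idPl (ltW Zt)) void.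
rewrite (has_density_integral Zf); last 4 first.
- exact: measurable_rayleigh_pdf.
- exact: rayleigh_pdf_ge0.
- apply/measurable_EFinP; apply: measurableT_comp => //; apply: measurableT_comp => //.
  by apply: measurable_funM => //; apply: measurable_funX; exact: measurable_maxr.
- by move=> x; rewrite lee_fin expR_ge0.
rewrite -(integral_rayleigh (ltW A0) (ltr_wpDr K0 A0)) [RHS]integral_mkcond.
apply: eq_integral => x _; rewrite /rayleigh_pdf !patchE mem_setE in_itv/= andbT.
case: ifPn => x0; last by rewrite mule0.
rewrite /F -EFinM; congr EFin; rewrite (max_idPl x0) mulrCA -expRD; congr (_ * expR _).
ring.
Qed.

End coverage_of_rayleigh_links.

Lemma active_d2d_density_ge0 (R : realType) (M : nat) (pt pf lamD : 'I_M -> R) :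
    (forall i, 0 <= lamD i) -> (forall i, 0 <= pt i <= 1) -> (forall i, 0 <= pf i <= 1) ->
  0 <= active_d2d_density pt pf lamD.
Proof.
move=> l0 pt0 pf0; apply: sumr_ge0 => i _; have /andP[? _] := pt0 i; have /andP[? _] := pf0 i.
by rewrite !mulr_ge0.
Qed.

Lemma bs_load_ge0 (R : realType) (M : nat) (bC : nat) (bD : 'I_M -> nat) (B : nat)
    (lamU lamB : R) (pt lamD : 'I_M -> R) :
    (forall i, 0 <= lamD i) -> (forall i, 0 <= pt i <= 1) -> 0 <= lamU -> 0 <= lamB ->
  0 <= bs_load bC bD B lamU lamB pt lamD.
Proof.
move=> l0 pt0 U0 B0; rewrite le_min ler01 andbT divr_ge0 ?mulr_ge0// addr_ge0 ?mulr_ge0//.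
apply: sumr_ge0 => i _; have /andP[_ ?] := pt0 i.
by rewrite !mulr_ge0// subr_ge0.
Qed.

Lemma kappa_ge0 (R : realType) (alpha : R) : 2 < alpha -> 0 <= kappa alpha.
Proof.
move=> a2; have a0 : 0 < alpha by exact: lt_trans a2.
have p0 := @pi_gt0 R.
rewrite divr_ge0 ?divr_ge0 ?mulr_ge0 ?ltW// sin_gt0_pi// divr_gt0 ?mulr_gt0//=.
by rewrite ltr_pdivrMr// mulrC ltr_pM2l.
Qed.

Lemma inv_addr1_div (R : realType) (A K x : R) : 0 < A -> x = K / A -> (x + 1)^-1 = A / (A + K).
Proof. by move=> A0 ->; rewrite -[1](@divff _ A) ?gt_eqF// -mulrDl invf_div addrC. Qed.

(** * The D2D link and the cellular user *)

Section shared_network.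
Context d (T : measurableType d) (R : realType) (P : probability T R).
Context (h0 : {RV P >-> R}) (hD hB : nat -> {RV P >-> R}) (X Y : points T R).
Context (PD PB alpha beta lamX rho lamB : R).
Hypotheses (PD0 : 0 < PD) (PB0 : 0 < PB) (alpha2 : 2 < alpha) (beta0 : 0 < beta).
Hypotheses (lamX0 : 0 <= lamX) (rho0 : 0 <= rho) (lamB0 : 0 < lamB).

Let alpha0 : 0 < alpha. Proof. exact: lt_trans alpha2. Qed.
Let rholamB0 : 0 <= rho * lamB. Proof. by rewrite mulr_ge0// ltW. Qed.

Let path_lossE (Ps Pw z : R) :
  (fun x => ln (1 + beta / Ps * z `^ alpha * path_loss Pw alpha x)) =
  (fun x => ln (1 + beta * (Pw / Ps) * z `^ alpha * enorm x `^ (- alpha))).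
Proof. by apply/funext => x; congr (ln (1 + _)); rewrite /path_loss; ring. Qed.

Lemma d2d_coverage (v : {RV P >-> R}) (delta : R) : 0 < delta ->
    d2d_link_model delta lamX (rho * lamB) v h0 hD hB X Y ->
  P [set t | (beta%:E < sinr PD PD PB alpha sigma2 h0 v hD X hB Y t)%E]
        @[sigma2 --> 0^'+] -->
      ((2 * delta ^+ 2 * lamX * kappa alpha * pi * beta `^ (2 / alpha)
        + 4 * delta ^+ 2 * pi * rho * lamB * H0 PD PB beta alpha + 1)^-1)%:E.
Proof.
move=> delta0 [vf ppX ppY fad ind].
have [pX _] := ppX; have [pY _] := ppY.
have mv : rv_events v `<=` @measurable _ T by exact: rv_events_measurable.
have k0 := kappa_ge0 alpha2.
have h0H : 0 <= H0 PD PB beta alpha.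
  by rewrite ratio_integral_H0// mulr_ge0 ?powR_ge0// (divr_ge0 k0).
(* One summand of the exponent per process. The D2D interferers have the power of the serving
   transmitter, so no power ratio appears in the first one. *)
pose K : R := lamX * (pi * (beta `^ (2 / alpha) * kappa alpha)) + rho * lamB * (2 * pi *
  H0 PD PB beta alpha).
have p0 := @pi_gt0 R.
have K0 : 0 <= K.
  apply: addr_ge0.
  by apply: mulr_ge0 => //; apply: mulr_ge0; [exact: ltW|rewrite mulr_ge0 ?powR_ge0].
  by apply: mulr_ge0 => //; apply: mulr_ge0 => //; rewrite mulr_ge0// ltW.
pose A : R := (2 * delta ^+ 2)^-1.
have A0 : 0 < A by rewrite invr_gt0 mulr_gt0// exprn_gt0.
have indY : indep_systems P (rv_events v) (point_events Y).
  move=> E F sE sF; have := mutually_independent4 ind sE (@sigma_setT _ _ _) sF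
    (@sigma_setT _ _ _).
  by rewrite setIT setTI probability_setT mule1 mul1e.
rewrite (_ : (_ + _ + 1)^-1 = A / (A + K)); last first.
  by apply: inv_addr1_div => //; rewrite /K /A invrK; ring.
apply: (@coverage_rayleigh _ _ _ _ v h0 hD hB X Y PD PD PB alpha beta lamX (rho * lamB)
  (fun=> setT) A K) => //.
- move=> B mB; rewrite (vf B mB); apply: eq_integral => x _; congr EFin.
  rewrite /link_distance_pdf /rayleigh_pdf !patchE; case: ifP => // _.
  by rewrite /A; congr (_ * expR _); field; rewrite gt_eqF.
- by rewrite (_ : [set _ | _] = setT)//; apply/seteqP; split.
- exact: poisson_process_indep.
- move=> E F G sE sF sG.
  (* The fourfold independence is regrouped with v and Y in one sigma-algebra, as
     [coverage_rayleigh] expects. *)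
  rewrite (@product_rule_join _ _ _ P (rv_events v) (point_events Y) (F `&` G))//.
  + congr (_ * _)%E.
    have := mutually_independent4 ind (@sigma_setT _ _ _) sF (@sigma_setT _ _ _) sG.
    by rewrite !setTI probability_setT !mul1e.
  + apply: measurableI; first exact: (sigma_measurable pX).
    exact: (sigma_measurable (@fading_events_measurable _ _ _ _ h0 hD hB)).
  + move=> E1 E2 s1 s2.
    have e : (P (F `&` G) = P F * P G)%E.
      have := mutually_independent4 ind (@sigma_setT _ _ _) sF (@sigma_setT _ _ _) sG.
      by rewrite !setTI probability_setT !mul1e.
    rewrite e (indY _ _ s1 s2) -setIA [E2 `&` _]setICA (mutually_independent4 ind)//.
    by rewrite -!muleA; congr (_ * _)%E; rewrite muleCA.
- move=> z z0; rewrite !path_lossE !void_integral_plane// ?mulr_gt0 ?invr_gt0//.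
  rewrite -!EFinM -EFinD; congr EFin; rewrite /K ratio_integral_H0// divff ?gt_eqF// mulr1.
  by field.
Qed.

Lemma cellular_coverage (r : {RV P >-> R}) :
    cellular_user_model lamB lamX (rho * lamB) r h0 hD hB X Y ->
  P [set t | (beta%:E < sinr PB PD PB alpha sigma2 h0 r hD X hB Y t)%E]
        @[sigma2 --> 0^'+] -->
      ((lamX / lamB * kappa alpha * (beta * (PD / PB)) `^ (2 / alpha)
        + 2 * rho * H1 beta alpha + 1)^-1)%:E.
Proof.
move=> [rf ppX ppY fad ind].
have k0 := kappa_ge0 alpha2.
have h1H : 0 <= H1 beta alpha.
  apply: Rintegral_ge0 => x; rewrite /= in_itv/= andbT => x1.
  have x0 : 0 <= x by exact: le_trans x1.
  by rewrite divr_ge0// ltW// ratio_denominator_gt0// ltW.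
(* Here the base stations have the serving power, so the ratio PD / PB enters the D2D term only; the
   exclusion disc of radius z turns the second integral into [H1]. *)
pose K : R := lamX * (pi * ((beta * (PD / PB)) `^ (2 / alpha) * kappa alpha)) + rho *
  lamB * (2 * pi * H1 beta alpha).
have p0 := @pi_gt0 R.
have K0 : 0 <= K.
  apply: addr_ge0.
  by apply: mulr_ge0 => //; apply: mulr_ge0; [exact: ltW|rewrite mulr_ge0 ?powR_ge0].
  by apply: mulr_ge0 => //; apply: mulr_ge0 => //; rewrite mulr_ge0// ltW.
pose A : R := lamB * pi.
have A0 : 0 < A by rewrite mulr_gt0.
rewrite (_ : (_ + _ + 1)^-1 = A / (A + K)); last first.
  apply: inv_addr1_div => //; rewrite /K /A.
  move: (pi : R) (lt0r_neq0 p0) => q q0; field.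
  by rewrite q0 gt_eqF.
apply: (@coverage_rayleigh _ _ _ _ r h0 hD hB X Y PB PD PB alpha beta lamX (rho * lamB)
  (fun z => [set x | z < enorm x]) A K) => //.
- move=> B mB; rewrite (rf B mB); apply: eq_integral => x _; congr EFin.
  rewrite /nearest_bs_pdf /rayleigh_pdf !patchE; case: ifP => // _.
  by rewrite /A; congr (_ * expR _); ring.
- pose b (zx : R * (R * R)) := zx.1 < enorm zx.2.
  have mb : measurable_fun setT b.
    apply: measurable_fun_ltr; first exact: measurable_fst.
    exact: (measurableT_comp (@measurable_enorm R) measurable_snd).
  rewrite (_ : [set _ | _] = b @^-1` [set true])//.
  by rewrite -[X in measurable X]setTI; exact: mb.
- by move=> E F G sE sF sG; exact: (mutually_independent3 ind).
- move=> z z0; rewrite !path_lossE void_integral_plane// ?mulr_gt0 ?invr_gt0//.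
  rewrite divff ?gt_eqF// mulr1 void_integral_beyond//.
  rewrite -!EFinM -EFinD; congr EFin; rewrite /K; ring.
Qed.

End shared_network.

Theorem corollary2 (R : realType)
    (M : nat) (lamD pt pf : 'I_M -> R) (lamB lamU : R)
    (bC : nat) (bD : 'I_M -> nat) (B : nat) (PD PB alpha delta : R)
    (lamD_ge0 : forall i, 0 <= lamD i)
    (pt01 : forall i, 0 <= pt i <= 1) (pf01 : forall i, 0 <= pf i <= 1)
    (lamB_gt0 : 0 < lamB) (lamU_ge0 : 0 <= lamU) (B_gt0 : (0 < B)%N)
    (PD_gt0 : 0 < PD) (PB_gt0 : 0 < PB) (alpha_gt2 : 2 < alpha)
    (delta_gt0 : 0 < delta) :
  let lamDt := active_d2d_density pt pf lamD in
  let rho := bs_load bC bD B lamU lamB pt lamD in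
  (forall (d : measure_display) (T : measurableType d) (P : probability T R)
      (v h0 : {RV P >-> R}) (hD hB : nat -> {RV P >-> R}) (X Y : points T R),
    d2d_link_model delta lamDt (rho * lamB) v h0 hD hB X Y ->
    forall beta : R, 0 < beta ->
      P [set t | (beta%:E < sinr PD PD PB alpha sigma2 h0 v hD X hB Y t)%E]
        @[sigma2 --> 0^'+] -->
      ((2 * delta ^+ 2 * lamDt * kappa alpha * pi * beta `^ (2 / alpha)
        + 4 * delta ^+ 2 * pi * rho * lamB * H0 PD PB beta alpha + 1)^-1)%:E)
  /\
  (forall (d : measure_display) (T : measurableType d) (P : probability T R)
      (r h0 : {RV P >-> R}) (hD hB : nat -> {RV P >-> R}) (X Y : points T R),
    cellular_user_model lamB lamDt (rho * lamB) r h0 hD hB X Y ->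
    forall beta : R, 0 < beta ->
      P [set t | (beta%:E < sinr PB PD PB alpha sigma2 h0 r hD X hB Y t)%E]
        @[sigma2 --> 0^'+] -->
      ((lamDt / lamB * kappa alpha * (beta * (PD / PB)) `^ (2 / alpha)
        + 2 * rho * H1 beta alpha + 1)^-1)%:E).
Proof.
have lamDt0 := active_d2d_density_ge0 lamD_ge0 pt01 pf01.
have rho0 := bs_load_ge0 bC bD B lamD_ge0 pt01 lamU_ge0 (ltW lamB_gt0).
split=> d T P.
  move=> v h0 hD hB X Y model beta beta0; exact: d2d_coverage model.
move=> r h0 hD hB X Y model beta beta0; exact: cellular_coverage model.
Qed.
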